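(* Let $\mathcal{C}$ be the set of smooth maps $\gamma:\mathbb{R}^2\to\mathbb{R}^3$, $(x,t)\mapsto\gamma(x,t)$, with $\|\gamma_x\|=1$ and $\gamma_t=\frac12\gamma_x\times\gamma_{xx}$. Let $\mathfrak{R}(3)$ be the group of rigid motions of $\mathbb{R}^3$ acting on $\mathcal{C}$ by $C\cdot\gamma=C\circ\gamma$. Let $\mathcal{N}$ be the set of smooth solutions $q:\mathbb{R}^2\to\mathbb{C}$ of $q_t=\frac{i}{2}(q_{xx}+2|q|^2q)$, with $S^1=\{c\in\mathbb{C}:|c|=1\}$ acting by $c\cdot q=cq$. Define $\Psi:\mathcal{C}/\mathfrak{R}(3)\to\mathcal{N}/S^1$ by $\Psi([\gamma])=[q]$, where $q=\frac12(k_1+ik_2)$ is the solution of the NLS obtained from any adapted p-frame along $\gamma$. Then $\Psi$ is well-defined and is a bijection.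
   Context: Rigid motions of $\mathbb{R}^3$ are the maps $v\mapsto Av+w$ with $A\in SO(3)$, $w\in\mathbb{R}^3$. $[\cdot]$ denotes the orbit. For $\gamma\in\mathcal{C}$, an adapted p-frame along $\gamma$ is a smooth map $g=(e_0,e_1,e_2):\mathbb{R}^2\to SO(3)$ (columns $e_i$) with $e_0=\gamma_x$ such that, for some real functions $k_1,k_2$, $$g^{-1}g_x=\begin{pmatrix}0&-k_1&-k_2\\k_1&0&0\\k_2&0&0\end{pmatrix},\qquad g^{-1}g_t=\begin{pmatrix}0&\frac{(k_2)_x}{2}&-\frac{(k_1)_x}{2}\\-\frac{(k_2)_x}{2}&0&\frac{k_1^2+k_2^2}{4}\\ \frac{(k_1)_x}{2}&-\frac{k_1^2+k_2^2}{4}&0\end{pmatrix}.$$ Thus, for each $t$, $(e_1,e_2)(\cdot,t)$ is a parallel orthonormal frame of the normal bundle of the curve $\gamma(\cdot,t)$, and $k_i=(e_0)_x\cdot e_i$ are the corresponding principal curvatures. Every $\gamma\in\mathcal C$ admits an adapted p-frame, and for any such frame $q=\frac12(k_1+ik_2)$ solves $q_t=\frac{i}{2}(q_{xx}+2|q|^2q)$; these facts are part of what ''well-defined'' means. *)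

(* Defs.v *)
From Stdlib Require Import Reals Lra Lia FunctionalExtensionality.
From Coquelicot Require Import Coquelicot.
Open Scope R_scope.

(** * Calculus of maps on [R^2], with variables [x] and [t] *)

Definition Dx (f : R -> R -> R) : R -> R -> R :=
  fun x t => Derive (fun s => f s t) x.
Definition Dt (f : R -> R -> R) : R -> R -> R :=
  fun x t => Derive (fun s => f x s) t.

Definition smooth (f : R -> R -> R) : Prop :=
  forall (n : nat) (x t : R), ex_diff_n f n x t.

Definition entry {m n : nat} (F : R -> R -> @matrix R m n) (i j : nat)
  : R -> R -> R := fun x t => coeff_mat 0 (F x t) i j.

Definition Mdx {m n : nat} (F : R -> R -> @matrix R m n)
  : R -> R -> @matrix R m n :=
  fun x t => mk_matrix m n (fun i j => Dx (entry F i j) x t).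
Definition Mdt {m n : nat} (F : R -> R -> @matrix R m n)
  : R -> R -> @matrix R m n :=
  fun x t => mk_matrix m n (fun i j => Dt (entry F i j) x t).
Definition Msmooth {m n : nat} (F : R -> R -> @matrix R m n) : Prop :=
  forall i j : nat, (i < m)%nat -> (j < n)%nat -> smooth (entry F i j).

Definition Cdx (q : R -> R -> C) : R -> R -> C :=
  fun x t => (Dx (fun y s => Re (q y s)) x t, Dx (fun y s => Im (q y s)) x t).
Definition Cdt (q : R -> R -> C) : R -> R -> C :=
  fun x t => (Dt (fun y s => Re (q y s)) x t, Dt (fun y s => Im (q y s)) x t).
Definition Csmooth (q : R -> R -> C) : Prop :=
  smooth (fun x t => Re (q x t)) /\ smooth (fun x t => Im (q x t)).

(** * Linear algebra in [R^3] *)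

Definition vec3 := @matrix R 3 1.
Definition mat3 := @matrix R 3 3.

Definition vx (v : vec3) (i : nat) : R := coeff_mat 0 v i 0.
Definition mx (A : mat3) (i j : nat) : R := coeff_mat 0 A i j.

Definition norm3 (v : vec3) : R :=
  sqrt (vx v 0 * vx v 0 + vx v 1 * vx v 1 + vx v 2 * vx v 2).

Definition cross (u v : vec3) : vec3 :=
  [[vx u 1 * vx v 2 - vx u 2 * vx v 1],
   [vx u 2 * vx v 0 - vx u 0 * vx v 2],
   [vx u 0 * vx v 1 - vx u 1 * vx v 0]].

Definition scal3 (a : R) (v : vec3) : vec3 :=
  mk_matrix 3 1 (fun i j => a * coeff_mat 0 v i j).

Definition transp (A : mat3) : mat3 := mk_matrix 3 3 (fun i j => mx A j i).

Definition det3 (A : mat3) : R :=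
  mx A 0 0 * (mx A 1 1 * mx A 2 2 - mx A 1 2 * mx A 2 1)
  - mx A 0 1 * (mx A 1 0 * mx A 2 2 - mx A 1 2 * mx A 2 0)
  + mx A 0 2 * (mx A 1 0 * mx A 2 1 - mx A 1 1 * mx A 2 0).

Definition mat3_mul (A B : mat3) : mat3 := Mmult (T := R_Ring) A B.
Definition mat3_one : mat3 := Mone (T := R_Ring).

Definition mat3_act (A : mat3) (v : vec3) : vec3 := Mmult (T := R_Ring) A v.

Definition SO3 (A : mat3) : Prop :=
  mat3_mul (transp A) A = mat3_one /\ det3 A = 1.

Definition col (A : mat3) (j : nat) : vec3 :=
  mk_matrix 3 1 (fun i _ => mx A i j).

Lemma SO3_cofactors (A : mat3) : SO3 A ->
  (mx A 0 0 = mx A 1 1 * mx A 2 2 - mx A 1 2 * mx A 2 1 /\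
   mx A 0 1 = mx A 1 2 * mx A 2 0 - mx A 1 0 * mx A 2 2 /\
   mx A 0 2 = mx A 1 0 * mx A 2 1 - mx A 1 1 * mx A 2 0) /\
  (mx A 1 0 = mx A 2 1 * mx A 0 2 - mx A 2 2 * mx A 0 1 /\
   mx A 1 1 = mx A 2 2 * mx A 0 0 - mx A 2 0 * mx A 0 2 /\
   mx A 1 2 = mx A 2 0 * mx A 0 1 - mx A 2 1 * mx A 0 0) /\
  (mx A 2 0 = mx A 0 1 * mx A 1 2 - mx A 0 2 * mx A 1 1 /\
   mx A 2 1 = mx A 0 2 * mx A 1 0 - mx A 0 0 * mx A 1 2 /\
   mx A 2 2 = mx A 0 0 * mx A 1 1 - mx A 0 1 * mx A 1 0).
Proof.
destruct A as [[a [b [c []]]] [[d [e [f []]]] [[g [h [k []]]] []]]].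
unfold SO3.
cbv -[Rplus Rmult Rminus Ropp IZR].
intros [H D].
injection H; clear H; intros H22 H21 H20 H12 H11 H10 H02 H01 H00.
assert (cramer : forall p q r c0 c1 c2 : R,
  a * c0 + d * c1 + g * c2 = p -> b * c0 + e * c1 + h * c2 = q ->
  c * c0 + f * c1 + k * c2 = r ->
  c0 = p * (e * k - f * h) - q * (d * k - f * g) + r * (d * h - e * g) /\
  c1 = - p * (b * k - c * h) + q * (a * k - c * g) - r * (a * h - b * g) /\
  c2 = p * (b * f - c * e) - q * (a * f - c * d) + r * (a * e - b * d)).
{ intros p q r c0 c1 c2 <- <- <-; repeat split;
  match goal with |- ?c = _ => transitivity (c * 1); [ring | rewrite <- D; ring] end. }
destruct (cramer 1 0 0 a d g) as [? [? ?]]; try lra.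
destruct (cramer 0 1 0 b e h) as [? [? ?]]; try lra.
destruct (cramer 0 0 1 c f k) as [? [? ?]]; try lra.
Qed.

(* On [SO(3)] the inverse matrix is the transpose. *)
Lemma SO3_inverse (A : mat3) : SO3 A ->
  mat3_mul (transp A) A = mat3_one /\ mat3_mul A (transp A) = mat3_one.
Proof.
intros HA; split; [exact (proj1 HA)|].
destruct (SO3_cofactors A HA) as [[E1 [E2 E3]] [[E4 [E5 E6]] [E7 [E8 E9]]]].
destruct HA as [_ D].
destruct A as [[a [b [c []]]] [[d [e [f []]]] [[g [h [k []]]] []]]].
cbv -[Rplus Rmult Rminus Ropp IZR] in *.
assert (D0 : a * a + b * b + c * c = 1).
{ rewrite <- D; rewrite E1 at 2; rewrite E2 at 2; rewrite E3 at 2; ring. }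
assert (D1 : d * d + e * e + f * f = 1).
{ rewrite <- D; rewrite E4 at 2; rewrite E5 at 2; rewrite E6 at 2; ring. }
assert (D2 : g * g + h * h + k * k = 1).
{ rewrite <- D; rewrite E7 at 2; rewrite E8 at 2; rewrite E9 at 2; ring. }
assert (D3 : a * d + b * e + c * f = 0).
{ rewrite E1, E2, E3; ring. }
assert (D4 : a * g + b * h + c * k = 0).
{ rewrite E1, E2, E3; ring. }
assert (D5 : d * g + e * h + f * k = 0).
{ rewrite E4, E5, E6; ring. }
repeat apply f_equal2; try reflexivity; lra.
Qed.

(** * The two function spaces *)

Definition is_vfe (gamma : R -> R -> vec3) : Prop :=
  Msmooth gamma /\
  (forall x t : R, norm3 (Mdx gamma x t) = 1) /\
  (forall x t : R, Mdt gamma x t =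
     scal3 (1 / 2) (cross (Mdx gamma x t) (Mdx (Mdx gamma) x t))).

Record curve := Curve { curve_map :> R -> R -> vec3;
                        curveP : is_vfe curve_map }.

Definition is_nls (q : R -> R -> C) : Prop :=
  Csmooth q /\
  (forall x t : R, Cdt q x t =
     (Ci / 2 * (Cdx (Cdx q) x t
                + 2 * RtoC (Cmod (q x t) ^ 2) * q x t))%C).

Record nls := Nls { nls_map :> R -> R -> C; nlsP : is_nls nls_map }.

(** * The group actions *)

Record rigid := Rigid { rot : mat3; rotP : SO3 rot; trans : vec3 }.

Definition rigid_map (M : rigid) (v : vec3) : vec3 :=
  Mplus (G := R_AbelianGroup) (mat3_act (rot M) v) (trans M).

Record unit_circle := UnitCircle { uc_val :> C; ucP : Cmod uc_val = 1 }.

Lemma ex_diff_n_lin (a b : R) (n : nat) : forall f g : R -> R -> R,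
  (forall x t, ex_diff_n f n x t) -> (forall x t, ex_diff_n g n x t) ->
  forall x t, ex_diff_n (fun y s => a * f y s + b * g y s) n x t.
Proof.
induction n as [|n IH]; intros f g Hf Hg x t; simpl.
- split; [|trivial].
  apply continuity_2d_pt_plus; apply continuity_2d_pt_mult;
    try apply continuity_2d_pt_const; [apply Hf | apply Hg].
- destruct (Hf x t) as [cf [dxf [dtf _]]].
  destruct (Hg x t) as [cg [dxg [dtg _]]].
  split; [|split; [|split; [|split]]].
  + apply continuity_2d_pt_plus; apply continuity_2d_pt_mult;
      try apply continuity_2d_pt_const; assumption.
  + now auto_derive.
  + now auto_derive.
  + replace (fun u v => Derive (fun z => a * f z v + b * g z v) u)
      with (fun u v => a * Derive (fun z => f z v) u
                       + b * Derive (fun z => g z v) u).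
    * apply IH; intros u v; [apply Hf | apply Hg].
    * apply functional_extensionality; intro u.
      apply functional_extensionality; intro v.
      destruct (Hf u v) as [_ [df _]]; destruct (Hg u v) as [_ [dg _]].
      rewrite Derive_plus; [now rewrite !Derive_scal | |]; now auto_derive.
  + replace (fun u v => Derive (fun z => a * f u z + b * g u z) v)
      with (fun u v => a * Derive (fun z => f u z) v
                       + b * Derive (fun z => g u z) v).
    * apply IH; intros u v; [apply Hf | apply Hg].
    * apply functional_extensionality; intro u.
      apply functional_extensionality; intro v.
      destruct (Hf u v) as [_ [_ [df _]]]; destruct (Hg u v) as [_ [_ [dg _]]].
      rewrite Derive_plus; [now rewrite !Derive_scal | |]; now auto_derive.
Qed.

Lemma smooth_const (a : R) : smooth (fun _ _ => a).
Proof.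
intro n; revert a; induction n as [|n IH]; intros a x t; simpl.
- split; [apply continuity_2d_pt_const | trivial].
- split; [apply continuity_2d_pt_const|].
  split; [apply ex_derive_const|]; split; [apply ex_derive_const|].
  split.
  + replace (fun u _ : R => Derive (fun _ : R => a) u)
      with (fun _ _ : R => 0); [apply IH|].
    now do 2 (apply functional_extensionality; intro); rewrite Derive_const.
  + replace (fun _ v : R => Derive (fun _ : R => a) v)
      with (fun _ _ : R => 0); [apply IH|].
    now do 2 (apply functional_extensionality; intro); rewrite Derive_const.
Qed.

Lemma smooth_lin (a b : R) (f g : R -> R -> R) : smooth f -> smooth g ->
  smooth (fun x t => a * f x t + b * g x t).
Proof. intros Hf Hg n; apply ex_diff_n_lin; intros; [apply Hf | apply Hg]. Qed.

Lemma smooth_ex_Dx (f : R -> R -> R) (x t : R) :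
  smooth f -> ex_derive (fun s => f s t) x.
Proof. intros H; exact (proj1 (proj2 (H 1%nat x t))). Qed.

Lemma smooth_ex_Dt (f : R -> R -> R) (x t : R) :
  smooth f -> ex_derive (fun s => f x s) t.
Proof. intros H; exact (proj1 (proj2 (proj2 (H 1%nat x t)))). Qed.

Lemma smooth_Dx (f : R -> R -> R) : smooth f -> smooth (Dx f).
Proof.
intros H n x t; exact (proj1 (proj2 (proj2 (proj2 (H (S n) x t))))).
Qed.

Lemma Dx_lin (a b : R) (f g : R -> R -> R) (x t : R) : smooth f -> smooth g ->
  Dx (fun y s => a * f y s + b * g y s) x t = a * Dx f x t + b * Dx g x t.
Proof.
intros Hf Hg.
pose proof (smooth_ex_Dx f x t Hf); pose proof (smooth_ex_Dx g x t Hg).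
unfold Dx; rewrite Derive_plus; [now rewrite !Derive_scal | |]; now auto_derive.
Qed.

Lemma Dt_lin (a b : R) (f g : R -> R -> R) (x t : R) : smooth f -> smooth g ->
  Dt (fun y s => a * f y s + b * g y s) x t = a * Dt f x t + b * Dt g x t.
Proof.
intros Hf Hg.
pose proof (smooth_ex_Dt f x t Hf); pose proof (smooth_ex_Dt g x t Hg).
unfold Dt; rewrite Derive_plus; [now rewrite !Derive_scal | |]; now auto_derive.
Qed.

Lemma is_nls_act (c : unit_circle) (q : nls) :
  is_nls (fun x t => (c * q x t)%C).
Proof.
destruct c as [[a b] Hc], q as [q [[Hr Hi] Hq]]; simpl.
assert (Er : (fun x t => Re (Cmult (a, b) (q x t))) =
             (fun x t => a * Re (q x t) + (- b) * Im (q x t))).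
{ do 2 (apply functional_extensionality; intro); unfold Re, Im; simpl; ring. }
assert (Ei : (fun x t => Im (Cmult (a, b) (q x t))) =
             (fun x t => a * Im (q x t) + b * Re (q x t))).
{ do 2 (apply functional_extensionality; intro); unfold Re, Im; simpl; ring. }
split; [split|].
- rewrite Er; now apply smooth_lin.
- rewrite Ei; now apply smooth_lin.
- assert (Ex : forall p : R -> R -> C, Csmooth p ->
    Cdx (fun x t => Cmult (a, b) (p x t)) = fun x t => Cmult (a, b) (Cdx p x t)).
  { intros p [Pr Pi]; do 2 (apply functional_extensionality; intro).
    unfold Cdx, Cmult; simpl; apply f_equal2.
    - rewrite <- (Rplus_0_r (_ - _)).
      transitivity (Dx (fun y s => a * Re (p y s) + (- b) * Im (p y s)) x x0).
      + f_equal; do 2 (apply functional_extensionality; intro);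
          unfold Re, Im; simpl; ring.
      + rewrite Dx_lin by assumption; ring.
    - transitivity (Dx (fun y s => a * Im (p y s) + b * Re (p y s)) x x0).
      + f_equal.
      + now rewrite Dx_lin by assumption. }
  intros x t.
  rewrite (Ex q (conj Hr Hi)), (Ex (Cdx q)).
  2: { split; apply smooth_Dx; assumption. }
  rewrite Cmod_mult, Hc, Rmult_1_l.
  transitivity (Cmult (a, b) (Cdt q x t)).
  + unfold Cdt; rewrite Er, Ei, !Dt_lin by assumption.
    unfold Cmult; simpl; apply f_equal2; ring.
  + rewrite Hq; ring.
Qed.

Section Affine.
Variables (a b c w : R) (f g h : R -> R -> R).
Hypotheses (Hf : smooth f) (Hg : smooth g) (Hh : smooth h).

Let affE : (fun x t => a * f x t + b * g x t + c * h x t + w) =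
  (fun x t => 1 * (a * f x t + b * g x t) + 1 * (c * h x t + w * 1)).
Proof. do 2 (apply functional_extensionality; intro); ring. Qed.

Lemma smooth_affine : smooth (fun x t => a * f x t + b * g x t + c * h x t + w).
Proof.
rewrite affE; apply smooth_lin; [now apply smooth_lin|].
apply (smooth_lin c w h (fun _ _ => 1)); [assumption | apply smooth_const].
Qed.

Lemma Dx_affine (x t : R) :
  Dx (fun x t => a * f x t + b * g x t + c * h x t + w) x t =
  a * Dx f x t + b * Dx g x t + c * Dx h x t.
Proof.
pose proof (smooth_const 1) as H1.
pose proof (smooth_lin c w h _ Hh H1) as H2.
rewrite affE, Dx_lin, Dx_lin, (Dx_lin c w h (fun _ _ => 1)); trivial;
  [|now apply smooth_lin].
unfold Dx at 4; rewrite Derive_const; ring.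
Qed.

Lemma Dt_affine (x t : R) :
  Dt (fun x t => a * f x t + b * g x t + c * h x t + w) x t =
  a * Dt f x t + b * Dt g x t + c * Dt h x t.
Proof.
pose proof (smooth_const 1) as H1.
pose proof (smooth_lin c w h _ Hh H1) as H2.
rewrite affE, Dt_lin, Dt_lin, (Dt_lin c w h (fun _ _ => 1)); trivial;
  [|now apply smooth_lin].
unfold Dt at 4; rewrite Derive_const; ring.
Qed.

End Affine.

Lemma mat3_actE (A : mat3) (v : vec3) : mat3_act A v =
  mk_matrix 3 1 (fun i _ => mx A i 0 * vx v 0 + mx A i 1 * vx v 1 + mx A i 2 * vx v 2).
Proof.
destruct A as [[a [b [c []]]] [[d [e [f []]]] [[g [h [k []]]] []]]].
destruct v as [[v0 []] [[v1 []] [[v2 []] []]]].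
unfold mat3_act, Mmult, mk_matrix, mk_Tn.
apply f_equal2; [|apply f_equal2; [|apply f_equal2; [|reflexivity]]];
  (apply f_equal2; [|reflexivity]);
  cbv -[Rplus Rmult Rminus Ropp IZR]; ring.
Qed.

Lemma rigid_mapE (M : rigid) (v : vec3) : rigid_map M v =
  mk_matrix 3 1 (fun i _ => mx (rot M) i 0 * vx v 0 + mx (rot M) i 1 * vx v 1
    + mx (rot M) i 2 * vx v 2 + vx (trans M) i).
Proof.
unfold rigid_map; rewrite mat3_actE; reflexivity.
Qed.

Lemma entry_rigid (M : rigid) (gamma : R -> R -> vec3) (i : nat) : (i < 3)%nat ->
  entry (fun x t => rigid_map M (gamma x t)) i 0 =
  fun x t => mx (rot M) i 0 * entry gamma 0 0 x t
    + mx (rot M) i 1 * entry gamma 1 0 x t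
    + mx (rot M) i 2 * entry gamma 2 0 x t + vx (trans M) i.
Proof.
intros Hi; do 2 (apply functional_extensionality; intro).
unfold entry; rewrite rigid_mapE, coeff_mat_bij; [reflexivity | assumption | auto].
Qed.

Lemma Msmooth_entry (gamma : R -> R -> vec3) : Msmooth gamma ->
  smooth (entry gamma 0 0) /\ smooth (entry gamma 1 0) /\ smooth (entry gamma 2 0).
Proof. intros H; repeat split; apply H; auto. Qed.

Lemma Msmooth_rigid (M : rigid) (gamma : R -> R -> vec3) :
  Msmooth gamma -> Msmooth (fun x t => rigid_map M (gamma x t)).
Proof.
intros H i [|j] Hi Hj; [|lia].
destruct (Msmooth_entry gamma H) as [H0 [H1 H2]].
rewrite entry_rigid by assumption; now apply smooth_affine.
Qed.

Lemma Mdx_rigid (M : rigid) (gamma : R -> R -> vec3) (x t : R) :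
  Msmooth gamma ->
  Mdx (fun x t => rigid_map M (gamma x t)) x t = mat3_act (rot M) (Mdx gamma x t).
Proof.
intros H; destruct (Msmooth_entry gamma H) as [H0 [H1 H2]].
rewrite mat3_actE; unfold Mdx; apply mk_matrix_ext.
intros i [|j] Hi Hj; [|lia].
rewrite entry_rigid, Dx_affine by assumption; reflexivity.
Qed.

Lemma Mdt_rigid (M : rigid) (gamma : R -> R -> vec3) (x t : R) :
  Msmooth gamma ->
  Mdt (fun x t => rigid_map M (gamma x t)) x t = mat3_act (rot M) (Mdt gamma x t).
Proof.
intros H; destruct (Msmooth_entry gamma H) as [H0 [H1 H2]].
rewrite mat3_actE; unfold Mdt; apply mk_matrix_ext.
intros i [|j] Hi Hj; [|lia].
rewrite entry_rigid, Dt_affine by assumption; reflexivity.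
Qed.

Lemma Msmooth_Mdx (gamma : R -> R -> vec3) : Msmooth gamma -> Msmooth (Mdx gamma).
Proof.
intros H i j Hi Hj n x t.
replace (entry (Mdx gamma) i j) with (Dx (entry gamma i j));
  [now apply smooth_Dx, H|].
do 2 (apply functional_extensionality; intro).
unfold entry at 2, Mdx; now rewrite coeff_mat_bij.
Qed.

Lemma norm3_SO3 (A : mat3) (v : vec3) : SO3 A -> norm3 (mat3_act A v) = norm3 v.
Proof.
intros [H _]; rewrite mat3_actE; unfold norm3; f_equal.
destruct A as [[a [b [c []]]] [[d [e [f []]]] [[g [h [k []]]] []]]].
destruct v as [[v0 []] [[v1 []] [[v2 []] []]]].
cbv -[Rplus Rmult Rminus Ropp IZR] in *.
injection H; clear H; intros H22 H21 H20 H12 H11 H10 H02 H01 H00.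
transitivity (v0 * v0 * (a * a + d * d + g * g) + v1 * v1 * (b * b + e * e + h * h)
  + v2 * v2 * (c * c + f * f + k * k) + 2 * v0 * v1 * (a * b + d * e + g * h)
  + 2 * v0 * v2 * (a * c + d * f + g * k) + 2 * v1 * v2 * (b * c + e * f + h * k)).
- ring.
- rewrite Rplus_0_r, <- Rplus_assoc in H00, H01, H02, H11, H12, H22.
  rewrite H00, H11, H22, H01, H02, H12; ring.
Qed.

Lemma cross_SO3 (A : mat3) (u v : vec3) : SO3 A ->
  cross (mat3_act A u) (mat3_act A v) = mat3_act A (cross u v).
Proof.
intros HA; rewrite !mat3_actE.
destruct (SO3_cofactors A HA) as [[E1 [E2 E3]] [[E4 [E5 E6]] [E7 [E8 E9]]]].
unfold cross, mk_matrix, mk_Tn.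
apply f_equal2; [|apply f_equal2; [|apply f_equal2; [|reflexivity]]];
  (apply f_equal2; [|reflexivity]); unfold vx, coeff_mat; simpl.
- rewrite E1, E2, E3; ring.
- rewrite E4, E5, E6; ring.
- rewrite E7, E8, E9; ring.
Qed.

Lemma is_vfe_act (M : rigid) (gamma : curve) :
  is_vfe (fun x t => rigid_map M (gamma x t)).
Proof.
destruct gamma as [gamma [Hs [Hn Hf]]]; simpl.
split; [now apply Msmooth_rigid|]; split; intros x t.
- rewrite Mdx_rigid, norm3_SO3; trivial; apply rotP.
- set (M0 := Rigid (rot M) (rotP M) [[0], [0], [0]]).
  assert (E : Mdx (fun x t => rigid_map M (gamma x t)) =
              fun x t => rigid_map M0 (Mdx gamma x t)).
  { do 2 (apply functional_extensionality; intro); rewrite Mdx_rigid by trivial.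
    rewrite mat3_actE, rigid_mapE; simpl.
    apply mk_matrix_ext; intros [|[|[|i]]] j Hi Hj; try lia;
      cbv -[Rplus Rmult Rminus Ropp IZR Mdx]; ring. }
  assert (E2 : Mdx (Mdx (fun x t => rigid_map M (gamma x t))) x t =
               mat3_act (rot M) (Mdx (Mdx gamma) x t)).
  { rewrite E, Mdx_rigid by (now apply Msmooth_Mdx); reflexivity. }
  rewrite E2, Mdt_rigid, Mdx_rigid, Hf, cross_SO3 by (trivial; apply rotP).
  rewrite !mat3_actE; unfold scal3, mk_matrix, mk_Tn, vx, coeff_mat; simpl.
  apply f_equal2; [|apply f_equal2; [|apply f_equal2; [|reflexivity]]];
    (apply f_equal2; [|reflexivity]); ring.
Qed.

Definition rigid_act (M : rigid) (gamma : curve) : curve :=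
  Curve (fun x t => rigid_map M (gamma x t)) (is_vfe_act M gamma).

Definition circle_act (c : unit_circle) (q : nls) : nls :=
  Nls (fun x t => (c * q x t)%C) (is_nls_act c q).

Definition orbit {G X : Type} (act : G -> X -> X) (x : X) : X -> Prop :=
  fun y => exists a : G, y = act a x.

Definition orbit_space {G X : Type} (act : G -> X -> X) : Type :=
  { O : X -> Prop | exists x : X, O = orbit act x }.

Definition orbit_class {G X : Type} (act : G -> X -> X) (x : X)
  : orbit_space act :=
  exist _ (orbit act x) (ex_intro _ x eq_refl).

(** * Adapted p-frames *)

Definition adapted_pframe (gamma : curve) (g : R -> R -> mat3)
  (k1 k2 : R -> R -> R) : Prop :=
  Msmooth g /\
  (forall x t : R, SO3 (g x t)) /\
  (forall x t : R, col (g x t) 0 = Mdx gamma x t) /\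
  (* [transp (g x t)] is the inverse of [g x t], see [SO3_inverse] *)
  (forall x t : R,
     mat3_mul (transp (g x t)) (Mdx g x t) =
     [[0,       - k1 x t, - k2 x t],
      [k1 x t,  0,        0       ],
      [k2 x t,  0,        0       ]]) /\
  (forall x t : R,
     mat3_mul (transp (g x t)) (Mdt g x t) =
     [[0,                 Dx k2 x t / 2,                      - Dx k1 x t / 2],
      [- Dx k2 x t / 2,   0,                                  (k1 x t ^ 2 + k2 x t ^ 2) / 4],
      [Dx k1 x t / 2,     - (k1 x t ^ 2 + k2 x t ^ 2) / 4,    0]]).

Definition hasimoto (k1 k2 : R -> R -> R) : R -> R -> C :=
  fun x t => (/ 2 * (RtoC (k1 x t) + Ci * RtoC (k2 x t)))%C.

(* Main.v *)
(* A parallel frame along [gamma] is a solution of a linear system [v_x = a x v],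
   [v_t = b x v] (cross products) with [a = e x e_x], [b = e x e_t - |e_x|^2/4 e],
   [e = gamma_x], which is flat because of the equation of [gamma]. A flat linear
   system on the plane has a smooth solution for each initial value: solve
   it along [x = 0] and then along the lines [t = const]; flatness and Gronwall's
   inequality give the [t]-derivative, and smoothness follows by bootstrapping.
   The same theorem integrates a solution [q] of the NLS to a frame, hence to a
   curve, since the NLS is the flatness of the p-frame equations. Two p-frames of
   one curve differ by a constant rotation of the normal plane, which multiplies
   [q] by a unit; two curves with the same [q] have frames differing by a constant
   rotation of space, and so are congruent. *)
From Stdlib Require Import Reals Lra Lia Nsatz FinFun Ranalysis5 PSeries_reg.
From Stdlib Require Import FunctionalExtensionality PropExtensionality.
From Stdlib Require Import ProofIrrelevance ClassicalEpsilon.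
From Coquelicot Require Import Coquelicot.
Require Import Defs.
Open Scope R_scope.

(** * Linear ordinary differential equations *)

(** The obstacle is regularity in [t]. The flow is built line by line, and at first nothing is known
    on how it varies from one line [t = const] to the next, so compactness cannot bound it. All
    bounds come from Gronwall along the lines, applied to the solution and then to the defect of its
    candidate [t]-derivative; joint continuity comes only after that. The term [|e_x|^2/4] of [b] is
    forced. With [b = e x e_t - K e], the curvature [a_t - b_x + a x b] is tangent to the curve, and
    by [e_t = e x e_xx / 2] it equals [(K_x - e_x . e_xx / 2) e]. Hence [K = |e_x|^2/4] up to a
    function of [t], which the p-frame equations fix. One integration lemma serves in both
    directions: angular velocities computed from the curve transport the columns of the frame, those
    computed from [q] transport its rows. *)

Lemma is_derive_continuity_pt (f : R -> R) (x l : R) :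
  is_derive f x l -> continuity_pt f x.
Proof.
intros H; apply continuity_pt_filterlim.
apply (ex_derive_continuous f); now exists l.
Qed.

Lemma is_derive_mean_value (f f' : R -> R) (a b : R) :
  (forall s, Rmin a b <= s <= Rmax a b -> is_derive f s (f' s)) ->
  exists c, Rmin a b <= c <= Rmax a b /\ f b - f a = f' c * (b - a).
Proof.
intros H; apply MVT_gen; intros s Hs.
- apply H; lra.
- now apply (is_derive_continuity_pt f s (f' s)), H.
Qed.

Lemma derive_nonpos_le (f f' : R -> R) (a b : R) : a <= b ->
  (forall s, a <= s <= b -> is_derive f s (f' s)) ->
  (forall s, a <= s <= b -> f' s <= 0) -> f b <= f a.
Proof.
intros Hab Hd Hn.
destruct (is_derive_mean_value f f' a b) as [c [Hc E]];
  rewrite Rmin_left, Rmax_right in * by assumption; [assumption|].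
specialize (Hn c Hc); nra.
Qed.

Lemma is_derive_reflect (f : R -> R) (s l : R) :
  is_derive f (- s) l -> is_derive (fun y => f (- y)) s (- l).
Proof.
intros H; replace (- l) with (scal (-1) l) by (unfold scal; simpl; unfold mult; simpl; ring).
apply (is_derive_comp f (fun y => - y)); [assumption|].
now auto_derive.
Qed.

Lemma exp_le_compat (x y : R) : x <= y -> exp x <= exp y.
Proof. intros [H| ->]; [now apply Rlt_le, exp_increasing | apply Rle_refl]. Qed.

(** One Picard step in the norm weighted by [exp (- a |s|)]: integrating from 0 divides the weighted
    bound by [a]. *)
Lemma exp_growth_bound (f f' : R -> R) (c a x : R) : 0 <= c -> f 0 = 0 ->
  (forall s, Rabs s <= Rabs x -> is_derive f s (f' s)) ->
  (forall s, Rabs s <= Rabs x -> Rabs (f' s) <= c * a * exp (a * Rabs s)) ->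
  Rabs (f x) <= c * exp (a * Rabs x).
Proof.
assert (pos : forall (f f' : R -> R) x, 0 <= c -> 0 <= x -> f 0 = 0 ->
  (forall s, 0 <= s <= x -> is_derive f s (f' s)) ->
  (forall s, 0 <= s <= x -> Rabs (f' s) <= c * a * exp (a * s)) ->
  f x <= c * exp (a * x)).
{ clear; intros f f' x Hc Hx H0 Hd Hb.
  assert (H : f x - c * exp (a * x) <= f 0 - c * exp (a * 0)).
  { apply (derive_nonpos_le (fun s => f s - c * exp (a * s))
      (fun s => f' s - c * a * exp (a * s))); trivial.
    - intros s Hs; apply (is_derive_minus (V := R_NormedModule)); [now apply Hd|].
      auto_derive; trivial; ring.
    - intros s Hs; specialize (Hb s Hs).
      generalize (Rle_abs (f' s)); lra. }
  rewrite H0, Rmult_0_r, exp_0 in H; lra. }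
assert (pos' : forall (f f' : R -> R) x, 0 <= c -> 0 <= x -> f 0 = 0 ->
  (forall s, 0 <= s <= x -> is_derive f s (f' s)) ->
  (forall s, 0 <= s <= x -> Rabs (f' s) <= c * a * exp (a * s)) ->
  Rabs (f x) <= c * exp (a * x)).
{ intros g g' y Hc Hy H0 Hd Hb; apply Rabs_le; split.
  - cut (- g y <= c * exp (a * y)); [lra|].
    apply (pos (fun s => - g s) (fun s => - g' s)); trivial.
    + rewrite H0; ring.
    + intros s Hs; apply (is_derive_opp (V := R_NormedModule)); now apply Hd.
    + intros s Hs; rewrite Rabs_Ropp; now apply Hb.
  - now apply (pos g g'). }
intros Hc H0 Hd Hb.
destruct (Rle_dec 0 x) as [Hx|Hx].
- rewrite (Rabs_pos_eq x) in * by assumption.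
  apply (pos' f f'); trivial; intros s Hs.
  + apply Hd; rewrite Rabs_pos_eq; lra.
  + specialize (Hb s); rewrite Rabs_pos_eq in Hb by lra; apply Hb; lra.
- rewrite (Rabs_left x) in * by lra.
  replace (f x) with (f (- - x)) by (f_equal; ring).
  apply (pos' (fun s => f (- s)) (fun s => - f' (- s))); trivial; try lra.
  + now rewrite Ropp_0.
  + intros s Hs; apply is_derive_reflect, Hd; rewrite Rabs_Ropp, Rabs_pos_eq; lra.
  + intros s Hs; rewrite Rabs_Ropp.
    specialize (Hb (- s)); rewrite Rabs_Ropp, Rabs_pos_eq in Hb by lra.
    apply Hb; lra.
Qed.

(** [f s * exp (- K * s)] does not increase for [s >= 0]. Bounding [Rabs (f' s)] instead of [f' s]
    makes the hypothesis invariant under the reflection that handles [x < 0]. *)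
Lemma gronwall (f f' : R -> R) (K x : R) :
  (forall s, Rabs s <= Rabs x -> is_derive f s (f' s)) ->
  (forall s, Rabs s <= Rabs x -> Rabs (f' s) <= K * f s) ->
  f x <= f 0 * exp (K * Rabs x).
Proof.
assert (pos : forall (f f' : R -> R) x, 0 <= x ->
  (forall s, 0 <= s <= x -> is_derive f s (f' s)) ->
  (forall s, 0 <= s <= x -> Rabs (f' s) <= K * f s) ->
  f x <= f 0 * exp (K * x)).
{ clear; intros f f' x Hx Hd Hb.
  assert (H : f x * exp (- K * x) <= f 0 * exp (- K * 0)).
  { apply (derive_nonpos_le (fun s => f s * exp (- K * s))
      (fun s => f' s * exp (- K * s) + f s * (- K * exp (- K * s)))); trivial.
    - intros s Hs; apply (is_derive_mult f (fun s => exp (- K * s))).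
      + now apply Hd.
      + auto_derive; trivial; ring.
      + intros; apply Rmult_comm.
    - intros s Hs; specialize (Hb s Hs).
      generalize (Rle_abs (f' s)) (exp_pos (- K * s)); nra. }
  rewrite Rmult_0_r, exp_0, Rmult_1_r in H.
  replace (f x) with (f x * exp (- K * x) * exp (K * x)).
  - apply Rmult_le_compat_r; trivial; apply Rlt_le, exp_pos.
  - rewrite Rmult_assoc, <- exp_plus; replace (- K * x + K * x) with 0 by ring.
    rewrite exp_0; ring. }
intros Hd Hb.
destruct (Rle_dec 0 x) as [Hx|Hx].
- rewrite (Rabs_pos_eq x) in * by assumption.
  apply (pos f f'); trivial; intros s Hs.
  + apply Hd; rewrite Rabs_pos_eq; lra.
  + apply Hb; rewrite Rabs_pos_eq; lra.
- rewrite (Rabs_left x) in * by lra.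
  replace (f x) with (f (- - x)) by (f_equal; ring).
  replace (f 0) with (f (- 0)) by (f_equal; ring).
  apply (pos (fun s => f (- s)) (fun s => - f' (- s))); trivial; try lra.
  + intros s Hs; apply is_derive_reflect, Hd; rewrite Rabs_Ropp, Rabs_pos_eq; lra.
  + intros s Hs; rewrite Rabs_Ropp.
    apply Hb; rewrite Rabs_Ropp, Rabs_pos_eq; lra.
Qed.

Lemma geometric_cauchy (u : nat -> R) (K : R) :
  (forall n, Rabs (u (S n) - u n) <= K * (1 / 2) ^ n) ->
  forall n, Rabs (real (Lim_seq u) - u n) <= 2 * K * (1 / 2) ^ n.
Proof.
intros H.
(* The subtracted [(1 / 2) ^ (n + p)] keeps the exact geometric sum, which lets the induction on [p]
   close. *)
assert (tail : forall n p,
  Rabs (u (n + p)%nat - u n) <= 2 * K * ((1 / 2) ^ n - (1 / 2) ^ (n + p))).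
{ intros n p; induction p as [|p IH].
  - rewrite Nat.add_0_r, !Rminus_diag, Rabs_R0; lra.
  - replace (n + S p)%nat with (S (n + p)) by lia.
    specialize (H (n + p)%nat).
    replace (u (S (n + p)) - u n)
      with ((u (S (n + p)) - u (n + p)%nat) + (u (n + p)%nat - u n)) by ring.
    eapply Rle_trans; [apply Rabs_triang|]; simpl; lra. }
assert (K0 : 0 <= K).
{ specialize (H 0%nat); simpl in H; generalize (Rabs_pos (u 1%nat - u 0%nat)); lra. }
assert (tail' : forall n p, Rabs (u (n + p)%nat - u n) <= 2 * K * (1 / 2) ^ n).
{ intros n p; eapply Rle_trans; [apply tail|].
  apply Rmult_le_compat_l; [lra|].
  assert (0 < (1 / 2) ^ (n + p)) by (apply pow_lt; lra); lra. }
assert (L : is_lim_seq (fun n => 2 * K * (1 / 2) ^ n) 0).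
{ replace (Finite 0) with (Rbar_mult (Finite (2 * K)) (Finite 0))
    by (simpl; f_equal; ring).
  apply is_lim_seq_scal_l, is_lim_seq_geom; rewrite Rabs_pos_eq; lra. }
assert (cv : is_lim_seq u (real (Lim_seq u))).
{ apply Lim_seq_correct', ex_lim_seq_cauchy_corr; intros eps.
  apply is_lim_seq_spec in L.
  destruct (L (pos_div_2 eps)) as [N HN]; exists N.
  specialize (HN N (le_n N)); simpl in HN.
  rewrite Rminus_0_r in HN; apply Rabs_def2 in HN.
  intros n m Hn Hm.
  generalize (tail' N (n - N)%nat) (tail' N (m - N)%nat).
  replace (N + (n - N))%nat with n by lia; replace (N + (m - N))%nat with m by lia.
  intros H1 H2; apply Rcomplements.Rabs_le_between in H1, H2.
  apply Rabs_def1; lra. }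
intros n.
assert (cv' : is_lim_seq (fun p => Rabs (u (p + n)%nat - u n))
  (Rabs (real (Lim_seq u) - u n))).
{ apply (is_lim_seq_abs _ (Finite (real (Lim_seq u) - u n))).
  apply is_lim_seq_minus'; [|apply is_lim_seq_const].
  now apply is_lim_seq_incr_n. }
assert (Rbar_le (Rabs (real (Lim_seq u) - u n)) (2 * K * (1 / 2) ^ n)) as HH;
  [|exact HH].
apply (is_lim_seq_le (fun p => Rabs (u (p + n)%nat - u n))
  (fun _ => 2 * K * (1 / 2) ^ n)); trivial.
- intros p; rewrite Nat.add_comm; apply tail'.
- apply is_lim_seq_const.
Qed.

Lemma upper_bound_finite_family (P : nat -> R -> Prop) (N : nat) :
  (forall i K K', K <= K' -> P i K -> P i K') ->
  (forall i, exists K, P i K) -> exists K, 0 <= K /\ forall i, (i <= N)%nat -> P i K.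
Proof.
intros mono H; induction N as [|N [K [K0 HK]]].
- destruct (H 0%nat) as [K HK]; exists (Rmax 0 K); split; [apply Rmax_l|].
  intros i Hi; replace i with 0%nat by lia.
  apply (mono 0%nat K); [apply Rmax_r | assumption].
- destruct (H (S N)) as [K' HK']; exists (Rmax K K'); split.
  + apply Rle_trans with K; [assumption | apply Rmax_l].
  + intros i Hi; destruct (Nat.eq_dec i (S N)) as [->|Hne].
    * apply (mono _ K'); [apply Rmax_r | assumption].
    * apply (mono _ K); [apply Rmax_l | apply HK; lia].
Qed.

Lemma bounded_on_interval (f : R -> R) (r : R) :
  (forall x, continuity_pt f x) ->
  exists K, forall x, Rabs x <= r -> Rabs (f x) <= K.
Proof.
intros Hf.
destruct (bounded_continuity (V := R_NormedModule) f (- r) r) as [K HK].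
- intros x _; apply continuity_pt_filterlim, Hf.
- exists K; intros x Hx; apply Rlt_le, HK.
  now apply Rcomplements.Rabs_le_between.
Qed.

Lemma continuity_pt_sum (F : nat -> R -> R) (N : nat) (x : R) :
  (forall i, (i <= N)%nat -> continuity_pt (F i) x) ->
  continuity_pt (fun y => sum_f_R0 (fun i => F i y) N) x.
Proof.
intros H; induction N as [|N IH]; simpl; [now apply H|].
apply (continuity_pt_plus (fun y => sum_f_R0 (fun i => F i y) N) (F (S N))).
- apply IH; intros i Hi; apply H; lia.
- now apply H.
Qed.

Lemma sum_abs_le (F : nat -> R) (N : nat) (K : R) :
  (forall i, (i <= N)%nat -> Rabs (F i) <= K) ->
  Rabs (sum_f_R0 F N) <= INR (S N) * K.
Proof.
intros H; eapply Rle_trans; [apply Rsum_abs|].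
eapply Rle_trans; [apply (sum_Rle _ (fun _ => K)); assumption|].
rewrite sum_cte; lra.
Qed.

(** * Picard iteration for linear systems *)

Section LinearODE.
Variables (N : nat) (A : nat -> nat -> R -> R) (v0 : nat -> R).
Hypothesis HA : forall i j x, continuity_pt (A i j) x.

(** [sum_f_R0] includes its upper bound: the unknowns are indexed by 0, ..., [N], and the dimension
    is [S N], whence the factor [INR (S N)] in all estimates. *)
Fixpoint picard (n i : nat) (x : R) : R :=
  match n with
  | 0%nat => v0 i
  | S n => v0 i + RInt (fun s => sum_f_R0 (fun j => A i j s * picard n j s) N) 0 x
  end.

(** Continuity is a hypothesis because it is itself proved through this lemma: an iterate is
    continuous as it is differentiable, and differentiable as the previous one is continuous. *)
Lemma picard_derive_aux (n i : nat) (x : R) :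
  (forall j y, continuity_pt (picard n j) y) ->
  is_derive (picard (S n) i) x (sum_f_R0 (fun j => A i j x * picard n j x) N).
Proof.
intros Hc.
set (F := fun s => sum_f_R0 (fun j => A i j s * picard n j s) N).
assert (c : forall y, continuous F y).
{ intros y; apply continuity_pt_filterlim.
  apply (continuity_pt_sum (fun j s => A i j s * picard n j s)).
  intros j _; apply continuity_pt_mult; trivial. }
change (is_derive (fun y => v0 i + RInt F 0 y) x (F x)).
rewrite <- (Rplus_0_l (F x)).
apply (is_derive_plus (V := R_NormedModule) (fun _ => v0 i));
  [apply (is_derive_const (K := R_AbsRing) (V := R_NormedModule))|].
apply (is_derive_RInt F (fun y => RInt F 0 y) 0); [|apply c].
apply filter_forall; intros y; apply (RInt_correct (V := R_CompleteNormedModule)).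
apply (ex_RInt_continuous (V := R_CompleteNormedModule)); intros; apply c.
Qed.

Lemma picard_continuity (n i : nat) (x : R) : continuity_pt (picard n i) x.
Proof.
revert i x; induction n as [|n IH]; intros i x.
- apply continuity_pt_const; intros ? ?; reflexivity.
- now eapply is_derive_continuity_pt, picard_derive_aux.
Qed.

Lemma picard_derive (n i : nat) (x : R) :
  is_derive (picard (S n) i) x (sum_f_R0 (fun j => A i j x * picard n j x) N).
Proof. apply picard_derive_aux; intros; apply picard_continuity. Qed.

Lemma picard_0 (n i : nat) : picard n i 0 = v0 i.
Proof. destruct n; simpl; [|rewrite RInt_point; unfold zero; simpl]; ring. Qed.

Lemma coefficients_bound (r : R) : exists a, 0 <= a /\
  forall i j x, (i <= N)%nat -> (j <= N)%nat -> Rabs x <= r -> Rabs (A i j x) <= a.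
Proof.
destruct (upper_bound_finite_family (fun i K => forall j x, (j <= N)%nat ->
  Rabs x <= r -> Rabs (A i j x) <= K) N) as [a [a0 Ha]].
- intros i K K' HK H j x Hj Hx; eapply Rle_trans; [now apply H | assumption].
- intros i; destruct (upper_bound_finite_family (fun j K => forall x,
    Rabs x <= r -> Rabs (A i j x) <= K) N) as [a [a0 Ha]].
  + intros j K K' HK H x Hx; eapply Rle_trans; [now apply H | assumption].
  + intros j; now apply bounded_on_interval.
  + exists a; intros j x Hj Hx; now apply Ha.
- exists a; split; trivial; intros i j x Hi Hj Hx; now apply Ha.
Qed.

Lemma picard_geometric (r : R) : exists K, forall n i x, (i <= N)%nat ->
  Rabs x <= r -> Rabs (picard (S n) i x - picard n i x) <= K * (1 / 2) ^ n.
Proof.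
destruct (coefficients_bound r) as [a [a0 Ha]].
set (B := INR (S N) * a).
assert (B0 : 0 <= B) by (apply Rmult_le_pos; [apply pos_INR | assumption]).
destruct (upper_bound_finite_family (fun i K => forall x, Rabs x <= r ->
  Rabs (picard 1 i x - picard 0 i x) <= K) N) as [c [c0 Hc]].
{ intros i K K' HK H x Hx; eapply Rle_trans; [now apply H | assumption]. }
{ intros i; apply (bounded_on_interval (fun x => picard 1 i x - picard 0 i x)).
  intros x; apply continuity_pt_minus; apply picard_continuity. }
(* The weight [exp (2 B |x|)] makes the Picard map contract by a factor [1/2]. *)
assert (E : forall n i x, (i <= N)%nat -> Rabs x <= r ->
  Rabs (picard (S n) i x - picard n i x)
    <= c * (1 / 2) ^ n * exp (2 * B * Rabs x)).
{ induction n as [|n IH]; intros i x Hi Hx.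
  - rewrite pow_O, Rmult_1_r.
    eapply Rle_trans; [now apply Hc|].
    rewrite <- (Rmult_1_r c) at 1; apply Rmult_le_compat_l; trivial.
    rewrite <- exp_0; apply exp_le_compat.
    apply Rmult_le_pos; [lra | apply Rabs_pos].
  - apply (exp_growth_bound (fun y => picard (S (S n)) i y - picard (S n) i y)
      (fun y => sum_f_R0 (fun j => A i j y * picard (S n) j y) N
              - sum_f_R0 (fun j => A i j y * picard n j y) N)).
    + apply Rmult_le_pos; trivial; apply pow_le; lra.
    + rewrite !picard_0; ring.
    + intros s _; apply (is_derive_minus (V := R_NormedModule)); apply picard_derive.
    + intros s Hs; rewrite <- minus_sum.
      eapply Rle_trans.
      * apply (sum_abs_le _ N (a * (c * (1 / 2) ^ n * exp (2 * B * Rabs s)))).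
        intros j Hj; rewrite <- Rmult_minus_distr_l, Rabs_mult.
        apply Rmult_le_compat; try apply Rabs_pos.
        -- apply Ha; trivial; lra.
        -- apply IH; trivial; lra.
      * rewrite <- Rmult_assoc; fold B; simpl; lra. }
exists (c * exp (2 * B * r)); intros n i x Hi Hx.
eapply Rle_trans; [now apply E|].
replace (c * exp (2 * B * r) * (1 / 2) ^ n)
  with (c * (1 / 2) ^ n * exp (2 * B * r)) by ring.
apply Rmult_le_compat_l.
- apply Rmult_le_pos; trivial; apply pow_le; lra.
- apply exp_le_compat, Rmult_le_compat_l; lra.
Qed.

Definition linear_flow (i : nat) (x : R) : R := Lim_seq (fun n => picard n i x).

Lemma linear_flow_0 (i : nat) : linear_flow i 0 = v0 i.
Proof.
unfold linear_flow; rewrite (Lim_seq_ext _ (fun _ => v0 i)).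
- now rewrite Lim_seq_const.
- intros n; apply picard_0.
Qed.

Lemma picard_uniform (r : R) : exists K, forall n i x, (i <= N)%nat ->
  Rabs x <= r -> Rabs (linear_flow i x - picard n i x) <= K * (1 / 2) ^ n.
Proof.
destruct (picard_geometric r) as [K HK]; exists (2 * K); intros n i x Hi Hx.
apply (geometric_cauchy (fun n => picard n i x)); intros m; now apply HK.
Qed.

Lemma CVU_geometric (u : nat -> R -> R) (f : R -> R) (r : posreal) (K : R) :
  (forall n x, Rabs x <= r -> Rabs (f x - u n x) <= K * (1 / 2) ^ n) ->
  CVU u f 0 r.
Proof.
intros H eps Heps.
destruct (pow_lt_1_zero (1 / 2)) with (y := eps / (Rabs K + 1)) as [M HM].
- rewrite Rabs_pos_eq; lra.
- apply Rdiv_lt_0_compat; trivial; generalize (Rabs_pos K); lra.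
- exists M; intros n y Hn Hy; unfold Boule in Hy; rewrite Rminus_0_r in Hy.
  specialize (HM n Hn); rewrite Rabs_pos_eq in HM by (apply pow_le; lra).
  assert (K1 : 0 < Rabs K + 1) by (generalize (Rabs_pos K); lra).
  apply Rlt_div_r in HM; [|assumption].
  assert (0 < (1 / 2) ^ n) by (apply pow_lt; lra).
  eapply Rle_lt_trans; [apply H; lra|].
  generalize (Rle_abs K); nra.
Qed.

Lemma linear_flow_continuity (i : nat) (x : R) : (i <= N)%nat ->
  continuity_pt (linear_flow i) x.
Proof.
intros Hi.
assert (r0 : 0 < Rabs x + 1) by (generalize (Rabs_pos x); lra).
set (r := mkposreal _ r0).
destruct (picard_uniform r) as [K HK].
apply (CVU_continuity (fun n => picard n i) _ 0 r).
- apply (CVU_geometric _ _ _ K); intros; now apply HK.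
- intros; apply picard_continuity.
- unfold Boule; simpl; rewrite Rminus_0_r; lra.
Qed.

(** The derivatives of the iterates are [A] times the previous iterates, so they converge uniformly
    on balls and differentiation passes to the limit. The radius [Rabs x + 1] puts [x] in the
    interior. *)
Lemma linear_flow_derive (i : nat) (x : R) : (i <= N)%nat ->
  is_derive (linear_flow i) x (sum_f_R0 (fun j => A i j x * linear_flow j x) N).
Proof.
intros Hi.
assert (r0 : 0 < Rabs x + 1) by (generalize (Rabs_pos x); lra).
set (r := mkposreal _ r0).
destruct (picard_uniform r) as [K HK].
destruct (coefficients_bound r) as [a [a0 Ha]].
apply is_derive_Reals.
apply (derivable_pt_lim_CVU (fun n => picard (S n) i)
  (fun n y => sum_f_R0 (fun j => A i j y * picard n j y) N) _
  (fun y => sum_f_R0 (fun j => A i j y * linear_flow j y) N) x 0 r).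
- unfold Boule; simpl; rewrite Rminus_0_r; lra.
- intros y n _; apply is_derive_Reals, picard_derive.
- intros y Hy eps Heps.
  assert (U : CVU (fun n => picard n i) (linear_flow i) 0 r).
  { apply (CVU_geometric _ _ _ K); intros; now apply HK. }
  destruct (U eps Heps) as [M HM]; exists M; intros n Hn.
  unfold Rdist; rewrite Rabs_minus_sym; apply HM; trivial; lia.
- apply (CVU_geometric _ _ _ (INR (S N) * (a * K))).
  intros n y Hy; rewrite <- minus_sum.
  rewrite (Rmult_assoc (INR (S N))).
  apply sum_abs_le; intros j Hj.
  rewrite <- Rmult_minus_distr_l, Rabs_mult, Rmult_assoc.
  apply Rmult_le_compat; try apply Rabs_pos; [now apply Ha | now apply HK].
- intros y _; apply (continuity_pt_sum (fun j s => A i j s * linear_flow j s)).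
  intros j Hj; apply continuity_pt_mult; trivial; now apply linear_flow_continuity.
Qed.

End LinearODE.

(** * Flat linear systems on the plane *)

Lemma continuity_2d_pt_fst (f : R -> R -> R) (x t : R) :
  continuity_2d_pt f x t -> continuity_pt (fun s => f s t) x.
Proof.
intros H; apply continuity_pt_locally; intros eps.
destruct (H eps) as [d Hd]; exists d; intros y Hy.
apply Hd; [exact Hy | rewrite Rminus_diag, Rabs_R0; apply cond_pos].
Qed.

Lemma continuity_2d_pt_snd (f : R -> R -> R) (x t : R) :
  continuity_2d_pt f x t -> continuity_pt (fun s => f x s) t.
Proof.
intros H; apply continuity_pt_locally; intros eps.
destruct (H eps) as [d Hd]; exists d; intros y Hy.
apply Hd; [rewrite Rminus_diag, Rabs_R0; apply cond_pos | exact Hy].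
Qed.

(** Compactness is available as a positive lower bound [d] for a gauge. Choosing the gauge below
    [1 / (1 + |f|)] turns it into an upper bound for [|f|] at the tags, and the gauge also keeps [f]
    within 1 of its value at the tag. *)
Lemma bounded_on_square (f : R -> R -> R) (r : R) :
  (forall x t, continuity_2d_pt f x t) ->
  exists K, forall x t, Rabs x <= r -> Rabs t <= r -> Rabs (f x t) <= K.
Proof.
intros Hf.
assert (D : forall x t, {d : posreal | d <= / (1 + Rabs (f x t)) /\
  forall u v, Rabs (u - x) < d -> Rabs (v - t) < d -> Rabs (f u v - f x t) < 1}).
{ intros x t; apply constructive_indefinite_description.
  destruct (Hf x t (mkposreal 1 Rlt_0_1)) as [d Hd].
  assert (p : 0 < / (1 + Rabs (f x t))).
  { apply Rinv_0_lt_compat; generalize (Rabs_pos (f x t)); lra. }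
  assert (q : 0 < Rmin d (/ (1 + Rabs (f x t)))).
  { apply Rmin_glb_lt; [apply cond_pos | assumption]. }
  exists (mkposreal _ q); simpl; split; [apply Rmin_r|].
  intros u v Hu Hv; apply Hd; eapply Rlt_le_trans; try eassumption; apply Rmin_l. }
destruct (compactness_value_2d (- r) r (- r) r (fun x t => proj1_sig (D x t)))
  as [d Hd].
exists (/ d + 1); intros x t Hx Ht.
apply Rcomplements.Rabs_le_between in Hx, Ht.
(* Compactness yields the tag [(u, v)] only under a double negation. *)
apply NNPP; intros Hn; apply (Hd x t Hx Ht); intros [u [v [_ [_ [Hu [Hv Hle]]]]]].
destruct (D u v) as [e [He Hc]]; simpl in *; apply Hn.
assert (E : d <= / (1 + Rabs (f u v))) by lra.
assert (0 < 1 + Rabs (f u v)) by (generalize (Rabs_pos (f u v)); lra).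
apply Rinv_le_contravar in E; [|apply cond_pos].
rewrite Rinv_inv in E.
specialize (Hc x t Hu Hv); apply Rabs_def2 in Hc.
generalize (Rle_abs (f u v)) (Rle_abs (- f u v)); rewrite Rabs_Ropp; intros.
apply Rabs_le; lra.
Qed.

(** Stated at each finite order, because the smoothness of the flow is gained one order at a time.
    In the Leibniz rule the undifferentiated factor is lowered from order [S n] to [n]. *)
Lemma ex_diff_n_mult (n : nat) : forall f g : R -> R -> R,
  (forall x t, ex_diff_n f n x t) -> (forall x t, ex_diff_n g n x t) ->
  forall x t, ex_diff_n (fun y s => f y s * g y s) n x t.
Proof.
induction n as [|n IH]; intros f g Hf Hg x t; simpl.
- split; trivial; apply continuity_2d_pt_mult; [apply Hf | apply Hg].
- pose proof (fun x t => ex_diff_n_m (S n) n (Nat.le_succ_diag_r n) f x t (Hf x t)) as Hf'.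
  pose proof (fun x t => ex_diff_n_m (S n) n (Nat.le_succ_diag_r n) g x t (Hg x t)) as Hg'.
  destruct (Hf x t) as [cf [dxf [dtf _]]].
  destruct (Hg x t) as [cg [dxg [dtg _]]].
  split; [|split; [|split; [|split]]].
  + now apply continuity_2d_pt_mult.
  + now apply (ex_derive_mult (fun z => f z t) (fun z => g z t)).
  + now apply (ex_derive_mult (fun z => f x z) (fun z => g x z)).
  + replace (fun u v => Derive (fun z => f z v * g z v) u)
      with (fun u v => 1 * (Derive (fun z => f z v) u * g u v)
                       + 1 * (f u v * Derive (fun z => g z v) u)).
    * apply ex_diff_n_lin; apply IH; trivial; intros u v; [apply Hf | apply Hg].
    * do 2 (apply functional_extensionality; intro).
      rewrite (Derive_mult (fun z => f z x1) (fun z => g z x1)); [ring | |].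
      -- apply Hf.
      -- apply Hg.
  + replace (fun u v => Derive (fun z => f u z * g u z) v)
      with (fun u v => 1 * (Derive (fun z => f u z) v * g u v)
                       + 1 * (f u v * Derive (fun z => g u z) v)).
    * apply ex_diff_n_lin; apply IH; trivial; intros u v; [apply Hf | apply Hg].
    * do 2 (apply functional_extensionality; intro).
      rewrite (Derive_mult (fun z => f x0 z) (fun z => g x0 z)); [ring | |].
      -- apply Hf.
      -- apply Hg.
Qed.

Lemma ex_diff_n_sum (F : nat -> R -> R -> R) (n N : nat) :
  (forall j, (j <= N)%nat -> forall x t, ex_diff_n (F j) n x t) ->
  forall x t, ex_diff_n (fun y s => sum_f_R0 (fun j => F j y s) N) n x t.
Proof.
induction N as [|N IH]; intros H x t; simpl; [now apply H|].
replace (fun y s => sum_f_R0 (fun j => F j y s) N + F (S N) y s)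
  with (fun y s => 1 * sum_f_R0 (fun j => F j y s) N + 1 * F (S N) y s)
  by (do 2 (apply functional_extensionality; intro); ring).
apply ex_diff_n_lin; [|now apply H].
intros; apply IH; intros j Hj; apply H; lia.
Qed.

Lemma smooth_continuity (f : R -> R -> R) : smooth f ->
  forall x t, continuity_2d_pt f x t.
Proof. intros H x t; exact (proj1 (H 0%nat x t)). Qed.

Lemma smooth_mult (f g : R -> R -> R) : smooth f -> smooth g ->
  smooth (fun x t => f x t * g x t).
Proof. intros Hf Hg n; apply ex_diff_n_mult; intros; [apply Hf | apply Hg]. Qed.

Lemma smooth_Dt (f : R -> R -> R) : smooth f -> smooth (Dt f).
Proof.
intros H n x t; exact (proj2 (proj2 (proj2 (proj2 (H (S n) x t))))).
Qed.

Lemma smooth_is_derive_x (f : R -> R -> R) (x t : R) : smooth f ->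
  is_derive (fun s => f s t) x (Dx f x t).
Proof. intros H; apply Derive_correct; now apply smooth_ex_Dx. Qed.

Lemma smooth_is_derive_t (f : R -> R -> R) (x t : R) : smooth f ->
  is_derive (fun s => f x s) t (Dt f x t).
Proof. intros H; apply Derive_correct; now apply smooth_ex_Dt. Qed.

Lemma smooth_Dt_Dx (f : R -> R -> R) (x t : R) : smooth f ->
  Dt (Dx f) x t = Dx (Dt f) x t.
Proof.
intros H; symmetry; apply (Schwarz f x t).
- exists (mkposreal 1 Rlt_0_1); intros u v _ _; repeat split.
  + now apply smooth_ex_Dx.
  + now apply smooth_ex_Dt.
  + apply (smooth_ex_Dx (Dt f)); now apply smooth_Dt.
  + apply (smooth_ex_Dt (Dx f)); now apply smooth_Dx.
- apply (smooth_continuity (Dx (Dt f))); now apply smooth_Dx, smooth_Dt.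
- apply (smooth_continuity (Dt (Dx f))); now apply smooth_Dt, smooth_Dx.
Qed.

Lemma is_derive_sum (F F' : nat -> R -> R) (N : nat) (x : R) :
  (forall i, (i <= N)%nat -> is_derive (F i) x (F' i x)) ->
  is_derive (fun y => sum_f_R0 (fun i => F i y) N) x
    (sum_f_R0 (fun i => F' i x) N).
Proof.
intros H; induction N as [|N IH]; simpl; [now apply H|].
apply (is_derive_plus (V := R_NormedModule)); [|now apply H].
apply IH; intros; apply H; lia.
Qed.

Lemma sum_term_le (F : nat -> R) (N i : nat) :
  (forall j, 0 <= F j) -> (i <= N)%nat -> F i <= sum_f_R0 F N.
Proof.
intros H; induction N as [|N IH]; intros Hi; simpl.
- replace i with 0%nat by lia; lra.
- generalize (H (S N)); destruct (Nat.eq_dec i (S N)) as [->|Hne].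
  + generalize (cond_pos_sum F N H); lra.
  + specialize (IH ltac:(lia)); lra.
Qed.

(** Gronwall for the energy [phi], the sum of the squares, which is differentiable. Adding the
    constant [n E^2] absorbs the forcing [e] and makes the inequality homogeneous: the rate [2 n K]
    comes from the coefficients, the [1] from [2 |rho_i| E <= rho_i^2 + E^2]. It is used with
    [E = 0] to bound the flow and with [E = C h^2] to bound a defect. *)
Lemma linear_gronwall (N : nat) (a : nat -> nat -> R -> R) (e rho : nat -> R -> R)
    (K E x : R) :
  (forall i s, (i <= N)%nat -> Rabs s <= Rabs x ->
     is_derive (rho i) s (sum_f_R0 (fun j => a i j s * rho j s) N + e i s)) ->
  (forall i j s, (i <= N)%nat -> (j <= N)%nat -> Rabs s <= Rabs x ->
     Rabs (a i j s) <= K) ->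
  (forall i s, (i <= N)%nat -> Rabs s <= Rabs x -> Rabs (e i s) <= E) ->
  sum_f_R0 (fun i => (rho i x) ^ 2) N <=
    (sum_f_R0 (fun i => (rho i 0) ^ 2) N + INR (S N) * E ^ 2)
    * exp ((2 * INR (S N) * K + 1) * Rabs x).
Proof.
intros Hd Ha He.
set (n := INR (S N)); set (phi := fun s => sum_f_R0 (fun i => (rho i s) ^ 2) N).
assert (n0 : 0 <= n) by apply pos_INR.
assert (E2 : 0 <= n * E ^ 2) by (apply Rmult_le_pos; trivial; apply pow2_ge_0).
assert (K0 : 0 <= K).
{ eapply Rle_trans; [apply Rabs_pos | apply (Ha 0%nat 0%nat x); try lia; lra]. }
apply Rle_trans with (phi x + n * E ^ 2); [unfold phi; lra|].
apply (gronwall (fun s => phi s + n * E ^ 2)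
  (fun s => sum_f_R0 (fun i => 2 * rho i s
     * (sum_f_R0 (fun j => a i j s * rho j s) N + e i s)) N)).
- intros s Hs; rewrite <- (Rplus_0_r (sum_f_R0 _ N)).
  apply (is_derive_plus (V := R_NormedModule));
    [|apply (is_derive_const (K := R_AbsRing) (V := R_NormedModule))].
  apply (is_derive_sum (fun i s => rho i s ^ 2) (fun i s => 2 * rho i s
     * (sum_f_R0 (fun j => a i j s * rho j s) N + e i s))).
  intros i Hi; evar_last; [apply is_derive_pow, Hd; assumption | simpl; ring].
- intros s Hs.
  apply Rle_trans with (sum_f_R0 (fun i => K * phi s + n * K * rho i s ^ 2
    + rho i s ^ 2 + E ^ 2) N).
  + eapply Rle_trans; [apply Rsum_abs|]; apply sum_Rle; intros i Hi.
    rewrite Rabs_mult, (Rabs_mult 2), (Rabs_pos_eq 2) by lra.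
    (* [2 |rho_i| |rho_j| <= rho_i^2 + rho_j^2], and likewise for [e_i] *)
    apply Rle_trans with (2 * Rabs (rho i s)
      * (sum_f_R0 (fun j => K * Rabs (rho j s)) N + E)).
    * apply Rmult_le_compat_l; [generalize (Rabs_pos (rho i s)); lra|].
      eapply Rle_trans; [apply Rabs_triang|].
      apply Rplus_le_compat; [|now apply He].
      eapply Rle_trans; [apply Rsum_abs|]; apply sum_Rle; intros j Hj.
      rewrite Rabs_mult; apply Rmult_le_compat_r; [apply Rabs_pos | now apply Ha].
    * rewrite Rmult_plus_distr_l, scal_sum.
      apply Rle_trans with (sum_f_R0 (fun j => K * rho j s ^ 2 + K * rho i s ^ 2) N
        + (rho i s ^ 2 + E ^ 2)).
      -- apply Rplus_le_compat.
         ++ apply sum_Rle; intros j Hj.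
            rewrite <- (pow2_abs (rho i s)), <- (pow2_abs (rho j s)).
            generalize (pow2_ge_0 (Rabs (rho i s) - Rabs (rho j s))); nra.
         ++ rewrite <- (pow2_abs (rho i s)).
            generalize (pow2_ge_0 (Rabs (rho i s) - E)); nra.
      -- rewrite plus_sum, sum_cte; fold n; unfold phi.
         rewrite scal_sum; apply Req_le.
         rewrite (sum_eq (fun l => K * rho l s ^ 2) (fun l => rho l s ^ 2 * K))
           by (intros; ring); ring.
  + rewrite 3!plus_sum, !sum_cte; fold n.
    replace (sum_f_R0 (fun l => n * K * rho l s ^ 2) N) with (n * K * phi s)
      by (unfold phi; rewrite scal_sum; apply sum_eq; intros; ring).
    fold (phi s).
    assert (0 <= 2 * n * K * (n * E ^ 2)).
    { apply Rmult_le_pos; trivial; apply Rmult_le_pos; lra. }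
    lra.
Qed.

(** * The Frobenius theorem for linear systems *)

Section Frobenius.
Variables (N : nat) (L M : nat -> nat -> R -> R -> R) (v0 : nat -> R).
Hypotheses (HL : forall i j, smooth (L i j)) (HM : forall i j, smooth (M i j)).
(* The zero curvature equation [M_x + M L = L_t + L M], applied to a vector. *)
Hypothesis flat : forall (x t : R) (u : nat -> R) (i : nat), (i <= N)%nat ->
  sum_f_R0 (fun j => Dx (M i j) x t * u j
    + M i j x t * sum_f_R0 (fun k => L j k x t * u k) N) N =
  sum_f_R0 (fun j => Dt (L i j) x t * u j
    + L i j x t * sum_f_R0 (fun k => M j k x t * u k) N) N.

Let H (i : nat) (t : R) : R := linear_flow N (fun i j s => M i j 0 s) v0 i t.
Let v (i : nat) (x t : R) : R :=
  linear_flow N (fun i j s => L i j s t) (fun i => H i t) i x.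

Let H_derive (i : nat) (t : R) : (i <= N)%nat ->
  is_derive (H i) t (sum_f_R0 (fun j => M i j 0 t * H j t) N).
Proof.
intros Hi; apply (linear_flow_derive N (fun i j s => M i j 0 s)); trivial.
intros; now apply continuity_2d_pt_snd, smooth_continuity.
Qed.

Let v_base (i : nat) (t : R) : v i 0 t = H i t.
Proof. apply (linear_flow_0 N). Qed.

Let v_derive_x (i : nat) (x t : R) : (i <= N)%nat ->
  is_derive (fun s => v i s t) x (sum_f_R0 (fun j => L i j x t * v j x t) N).
Proof.
intros Hi; apply (linear_flow_derive N (fun i j s => L i j s t)); trivial.
intros; now apply (continuity_2d_pt_fst (L _ _)), smooth_continuity.
Qed.

(** The family is a parameter because [L], [M] and the first two [t]-derivatives of [L] all have to
    be bounded. *)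
Let coefficient_bound (F : nat -> nat -> R -> R -> R) (r : R) :
  (forall i j, smooth (F i j)) -> exists K, 0 <= K /\
  forall i j x t, (i <= N)%nat -> (j <= N)%nat -> Rabs x <= r -> Rabs t <= r ->
  Rabs (F i j x t) <= K.
Proof.
intros HF.
destruct (upper_bound_finite_family (fun i K => forall j x t, (j <= N)%nat ->
  Rabs x <= r -> Rabs t <= r -> Rabs (F i j x t) <= K) N) as [a [a0 Ha]].
- intros i K K' HK E j x t Hj Hx Ht; eapply Rle_trans; [now apply E | assumption].
- intros i; destruct (upper_bound_finite_family (fun j K => forall x t,
    Rabs x <= r -> Rabs t <= r -> Rabs (F i j x t) <= K) N) as [a [a0 Ha]].
  + intros j K K' HK E x t Hx Ht; eapply Rle_trans; [now apply E | assumption].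
  + intros j; apply bounded_on_square, smooth_continuity, HF.
  + exists a; intros j x t Hj Hx Ht; now apply Ha.
- exists a; split; trivial; intros; now apply Ha.
Qed.

(** [v] is not yet known to be continuous in the two variables, so [bounded_on_square] does not
    apply. The bound comes from Gronwall along each line, uniformly in [t], with initial values [H]
    that are bounded on an interval. *)
Let v_bound (r : R) : exists V, 0 <= V /\ forall i x t, (i <= N)%nat ->
  Rabs x <= r -> Rabs t <= r -> Rabs (v i x t) <= V.
Proof.
destruct (coefficient_bound L r HL) as [K [K0 HK]].
destruct (upper_bound_finite_family (fun i b => forall t, (i <= N)%nat ->
  Rabs t <= r -> Rabs (H i t) <= b) N) as [b [b0 Hb]].
{ intros i k k' Hk E t Hi Ht; eapply Rle_trans; [now apply E | assumption]. }
{ intros i; destruct (Nat.le_gt_cases i N) as [Hi|Hi].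
  - destruct (bounded_on_interval (H i) r) as [b Hb].
    + intros t; eapply is_derive_continuity_pt, H_derive, Hi.
    + exists b; intros; now apply Hb.
  - exists 0; intros; lia. }
set (n := INR (S N)).
set (W := (n * b ^ 2 + n * 0 ^ 2) * exp ((2 * n * K + 1) * r)).
assert (n0 : 0 <= n) by apply pos_INR.
(* [W] bounds the squares, and [y^2 <= W] gives [|y| <= W + 1] without a square root. *)
exists (W + 1).
assert (E : forall i x t, (i <= N)%nat ->
  Rabs x <= r -> Rabs t <= r -> v i x t ^ 2 <= W).
{ intros i x t Hi Hx Ht.
  apply Rle_trans with (sum_f_R0 (fun i => v i x t ^ 2) N).
  { apply (sum_term_le (fun i => v i x t ^ 2)); trivial.
    intros; apply pow2_ge_0. }
  eapply Rle_trans;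
    [apply (linear_gronwall N (fun i j s => L i j s t) (fun _ _ => 0)
      (fun i s => v i s t) K 0 x)|].
  - intros j s Hj _; rewrite Rplus_0_r; now apply v_derive_x.
  - intros; apply HK; trivial; lra.
  - intros; rewrite Rabs_R0; lra.
  - fold n; unfold W; apply Rmult_le_compat.
    + apply Rplus_le_le_0_compat.
      * apply cond_pos_sum; intros; apply pow2_ge_0.
      * apply Rmult_le_pos; trivial; apply pow2_ge_0.
    + apply Rlt_le, exp_pos.
    + apply Rplus_le_compat_r.
      replace (n * b ^ 2) with (sum_f_R0 (fun _ => b ^ 2) N)
        by (rewrite sum_cte; fold n; ring).
      apply sum_Rle; intros j Hj; rewrite v_base.
      apply pow_maj_Rabs; now apply Hb.
    + apply exp_le_compat, Rmult_le_compat_l; trivial.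
      assert (0 <= 2 * n * K) by (apply Rmult_le_pos; lra); lra. }
assert (W0 : 0 <= W).
{ apply Rmult_le_pos; [|apply Rlt_le, exp_pos].
  generalize (Rmult_le_pos n _ n0 (pow2_ge_0 b)); lra. }
split; [lra|]; intros i x t Hi Hx Ht; specialize (E i x t Hi Hx Ht).
apply Rabs_le; split; nra.
Qed.

Let dv (i : nat) (x t : R) : R := sum_f_R0 (fun j => M i j x t * v j x t) N.
Let rho (t h : R) (i : nat) (x : R) : R :=
  v i x (t + h) - v i x t - h * dv i x t.
(** What remains of the [x]-derivative of [rho] once [L(t + h) rho] is taken out. Both terms are of
    second order in [h]: a Taylor remainder, and [h] times an increment. *)
Let err (t h : R) (i : nat) (x : R) : R := sum_f_R0 (fun j =>
  (L i j x (t + h) - L i j x t - h * Dt (L i j) x t) * v j x t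
  + h * (L i j x (t + h) - L i j x t) * dv j x t) N.

(** The product rule for [dv = M v] gives [M_x v + M L v]. By [flat], applied to the vector
    [v(x, t)], this is [L_t v + L dv], so [dv] solves the [x]-equation differentiated in [t]. *)
Let rho_derive (t h : R) (i : nat) (x : R) : (i <= N)%nat ->
  is_derive (rho t h i) x
    (sum_f_R0 (fun j => L i j x (t + h) * rho t h j x) N + err t h i x).
Proof.
intros Hi.
assert (dv_derive : is_derive (fun x => dv i x t) x (sum_f_R0 (fun j =>
  Dt (L i j) x t * v j x t + L i j x t * dv j x t) N)).
{ unfold dv at 2; rewrite <- flat by assumption.
  apply (is_derive_sum (fun j x => M i j x t * v j x t) (fun j x =>
    Dx (M i j) x t * v j x t
    + M i j x t * sum_f_R0 (fun k => L j k x t * v k x t) N)).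
  intros j Hj; apply (is_derive_mult (fun x => M i j x t) (fun x => v j x t)).
  - now apply smooth_is_derive_x.
  - now apply v_derive_x.
  - intros; apply Rmult_comm. }
evar_last.
- apply (is_derive_minus (V := R_NormedModule));
    [apply (is_derive_minus (V := R_NormedModule)); apply v_derive_x, Hi|].
  apply (is_derive_scal (fun x => dv i x t)); exact dv_derive.
- unfold minus, plus, opp, scal; simpl; unfold mult; simpl.
  unfold err; rewrite <- plus_sum, (scal_sum _ _ h).
  match goal with |- _ + - sum_f_R0 ?F N + - sum_f_R0 ?G N = _ =>
    change (sum_f_R0 (fun j => L i j x (t + h) * v j x (t + h)) N
      - sum_f_R0 F N - sum_f_R0 G N = sum_f_R0 (fun j =>
        L i j x (t + h) * rho t h j x
        + ((L i j x (t + h) - L i j x t - h * Dt (L i j) x t) * v j x t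
        + h * (L i j x (t + h) - L i j x t) * dv j x t)) N) end.
  rewrite <- !minus_sum; apply sum_eq; intros j Hj; unfold rho; ring.
Qed.

(** Two applications of the mean value theorem bound the Taylor remainder by [K2 h^2], and one
    bounds the increment by [K1 |h|]. The condition [|h| <= 1] and the summand 1 in [r] keep all
    intermediate points in the square of radius [r]. *)
Let err_bound (x t : R) : exists C, 0 <= C /\ forall h i s, (i <= N)%nat ->
  Rabs h <= 1 -> Rabs s <= Rabs x -> Rabs (err t h i s) <= C * h ^ 2.
Proof.
set (r := Rabs x + Rabs t + 1).
assert (Hr : Rabs t <= r /\ Rabs x <= r).
{ unfold r; generalize (Rabs_pos x) (Rabs_pos t); lra. }
assert (Hr' : forall y, Rabs (y - t) <= 1 -> Rabs y <= r).
{ intros y Hy; replace y with ((y - t) + t) by ring.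
  eapply Rle_trans; [apply Rabs_triang|]; unfold r; generalize (Rabs_pos x); lra. }
destruct (coefficient_bound (fun i j => Dt (L i j)) r) as [K1 [K10 HK1]].
{ intros; now apply smooth_Dt. }
destruct (coefficient_bound (fun i j => Dt (Dt (L i j))) r) as [K2 [K20 HK2]].
{ intros; now apply smooth_Dt, smooth_Dt. }
destruct (coefficient_bound M r HM) as [K3 [K30 HK3]].
destruct (v_bound r) as [V [V0 HV]].
set (W := INR (S N) * (K3 * V)).
assert (n0 : 0 <= INR (S N)) by apply pos_INR.
assert (W0 : 0 <= W) by (repeat apply Rmult_le_pos; trivial).
exists (INR (S N) * (K2 * V + K1 * W)); split.
{ apply Rmult_le_pos; trivial.
  apply Rplus_le_le_0_compat; now apply Rmult_le_pos. }
intros h i s Hi Hh Hs; rewrite Rmult_assoc; apply sum_abs_le; intros j Hj.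
assert (B : forall c, Rmin t (t + h) <= c <= Rmax t (t + h) -> Rabs (c - t) <= Rabs h).
{ intros c; unfold Rmin, Rmax; destruct (Rle_dec t (t + h)) as [Hth|Hth]; intros Hc.
  - rewrite !Rabs_pos_eq; lra.
  - rewrite !Rabs_left1; lra. }
assert (h2 : Rabs h * Rabs h = h ^ 2) by (rewrite <- pow2_abs; ring).
assert (D1 : exists c, Rabs (c - t) <= Rabs h /\
  L i j s (t + h) - L i j s t = Dt (L i j) s c * h).
{ destruct (is_derive_mean_value (fun y => L i j s y) (fun y => Dt (L i j) s y)
    t (t + h)) as [c [Hc Ec]].
  - intros; now apply smooth_is_derive_t.
  - exists c; split; [now apply B | rewrite Ec; ring]. }
destruct D1 as [c [Hc Ec]].
assert (D2 : Rabs (Dt (L i j) s c - Dt (L i j) s t) <= K2 * Rabs h).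
{ destruct (is_derive_mean_value (fun y => Dt (L i j) s y)
    (fun y => Dt (Dt (L i j)) s y) t c) as [d [Hd Ed]].
  - intros; now apply smooth_is_derive_t, smooth_Dt.
  - rewrite Ed, Rabs_mult; apply Rmult_le_compat; try apply Rabs_pos; trivial.
    apply HK2; trivial; try lra; apply Hr'.
    unfold Rmin, Rmax in Hd; destruct (Rle_dec t c); apply Rabs_le;
      apply Rcomplements.Rabs_le_between in Hc; lra. }
assert (dvW : Rabs (dv j s t) <= W).
{ apply sum_abs_le; intros k Hk; rewrite Rabs_mult.
  apply Rmult_le_compat; try apply Rabs_pos; [apply HK3 | apply HV]; trivial; lra. }
rewrite Ec; eapply Rle_trans; [apply Rabs_triang|].
replace (Dt (L i j) s c * h - h * Dt (L i j) s t)
  with (h * (Dt (L i j) s c - Dt (L i j) s t)) by ring.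
rewrite !Rabs_mult, Rmult_plus_distr_r; apply Rplus_le_compat.
- apply Rle_trans with (Rabs h * (K2 * Rabs h) * V).
  + apply Rmult_le_compat; try apply Rabs_pos.
    * apply Rmult_le_pos; apply Rabs_pos.
    * apply Rmult_le_compat_l; trivial; apply Rabs_pos.
    * apply HV; trivial; lra.
  + rewrite <- h2; apply Req_le; ring.
- apply Rle_trans with (Rabs h * (K1 * Rabs h) * W).
  + apply Rmult_le_compat; try apply Rabs_pos; trivial.
    * apply Rmult_le_pos; [apply Rabs_pos | apply Rmult_le_pos; apply Rabs_pos].
    * apply Rmult_le_compat_l; [apply Rabs_pos|].
      apply Rmult_le_compat_r; [apply Rabs_pos|].
      apply HK1; trivial; try lra; apply Hr'; lra.
  + rewrite <- h2; apply Req_le; ring.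
Qed.

(** On [x = 0] the flow is [H], which solves the [t]-equation, so the initial defect is [o(h)]. The
    radius of the neighbourhood is encoded by its inverse [b], so that a minimum of radii over the
    indices becomes the maximum that [upper_bound_finite_family] provides. *)
Let rho_0_small (t eps : R) : 0 < eps -> exists b, 0 <= b /\ forall i h, (i <= N)%nat ->
  h <> 0 -> Rabs h * b < 1 -> Rabs (rho t h i 0) <= eps * Rabs h.
Proof.
intros He.
destruct (upper_bound_finite_family (fun i b => forall h, (i <= N)%nat ->
  h <> 0 -> Rabs h * b < 1 -> Rabs (rho t h i 0) <= eps * Rabs h) N) as [b [b0 Hb]].
- intros i k k' Hk E h Hi Hh Hhk; apply E; trivial.
  generalize (Rabs_pos h); nra.
- intros i; destruct (Nat.le_gt_cases i N) as [Hi|Hi]; [|exists 0; intros; lia].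
  pose proof (proj1 (is_derive_Reals _ _ _) (H_derive i t Hi)) as D.
  destruct (D eps He) as [d Hd]; exists (/ d); intros h _ Hh Hhd.
  assert (Hhd' : Rabs h < d).
  { apply (Rmult_lt_compat_r d) in Hhd; [|apply cond_pos].
    rewrite Rmult_assoc, Rinv_l, Rmult_1_r, Rmult_1_l in Hhd; trivial.
    apply Rgt_not_eq, cond_pos. }
  specialize (Hd h Hh Hhd').
  unfold rho, dv; rewrite !v_base.
  rewrite (sum_eq _ (fun j => M i j 0 t * H j t)) by (intros; now rewrite v_base).
  replace (H i (t + h) - H i t - h * sum_f_R0 (fun j => M i j 0 t * H j t) N)
    with (((H i (t + h) - H i t) / h - sum_f_R0 (fun j => M i j 0 t * H j t) N) * h)
    by (now field).
  rewrite Rabs_mult; apply Rmult_le_compat_r; [apply Rabs_pos | now apply Rlt_le].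
- exists b; split; trivial; intros; now apply Hb.
Qed.

(* Flatness makes [rho], the defect of [dv] as a [t]-derivative, solve the
   [x]-equation up to [O(h^2)], and its initial value is [o(h)]. *)
Let v_derive_t (i : nat) (x t : R) : (i <= N)%nat ->
  is_derive (fun s => v i x s) t (dv i x t).
Proof.
intros Hi; apply is_derive_Reals; intros eps Heps.
destruct (err_bound x t) as [C [C0 HC]].
destruct (coefficient_bound L (Rabs x + Rabs t + 1) HL) as [K [K0 HK]].
set (n := INR (S N)).
assert (n0 : 0 <= n) by apply pos_INR.
set (G := exp ((2 * n * K + 1) * Rabs x)).
assert (G0 : 0 < G) by apply exp_pos.
(* Gronwall will give [2 n G (e h)^2] with [e = eps / (4 k)]. As [n G <= k^2], this is at most
   [(2 e k h)^2 = (eps h / 2)^2]; thus [k] avoids the square root of [n G]. *)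
set (k := n * G + 1).
assert (k1 : 1 <= k) by (generalize (Rmult_le_pos n G n0 (Rlt_le _ _ G0)); unfold k; lra).
destruct (rho_0_small t (eps / (4 * k))) as [b [b0 Hb]].
{ apply Rdiv_lt_0_compat; lra. }
assert (c0 : 0 < eps / (4 * k * (C + 1))).
{ apply Rdiv_lt_0_compat; trivial; repeat apply Rmult_lt_0_compat; lra. }
(* The three bounds on [|h|] serve [err_bound], [rho_0_small] and [C h^2 <= e |h|], in this order.
   The summands 1 allow [b] and [C] to vanish. *)
assert (d0 : 0 < Rmin (Rmin 1 (/ (b + 1))) (eps / (4 * k * (C + 1)))).
{ repeat apply Rmin_glb_lt; trivial; [lra|]; apply Rinv_0_lt_compat; lra. }
exists (mkposreal _ d0); simpl; intros h Hh Hhd.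
assert (Hh1 : Rabs h < 1 /\ Rabs h < / (b + 1) /\ Rabs h < eps / (4 * k * (C + 1))).
{ repeat split; eapply Rlt_le_trans; try exact Hhd.
  - eapply Rle_trans; [apply Rmin_l | apply Rmin_l].
  - eapply Rle_trans; [apply Rmin_l | apply Rmin_r].
  - apply Rmin_r. }
destruct Hh1 as [Hh1 [Hh2 Hh3]].
assert (hp : 0 < Rabs h) by now apply Rabs_pos_lt.
assert (hb : Rabs h * b < 1).
{ apply (Rmult_lt_compat_r (b + 1)) in Hh2; [|lra].
  rewrite Rinv_l in Hh2 by lra; nra. }
set (e := eps / (4 * k)) in *.
assert (e0 : 0 < e) by (apply Rdiv_lt_0_compat; lra).
assert (Ch : C * Rabs h <= e).
{ apply Rle_trans with ((C + 1) * Rabs h); [nra|].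
  apply (Rmult_lt_compat_l (C + 1)) in Hh3; [|lra]; apply Rlt_le in Hh3.
  replace ((C + 1) * (eps / (4 * k * (C + 1)))) with e in Hh3; trivial.
  unfold e; field; lra. }
assert (main : rho t h i x ^ 2 <= (2 * e * k * Rabs h) ^ 2).
{ apply Rle_trans with (sum_f_R0 (fun i => rho t h i x ^ 2) N).
  { apply (sum_term_le (fun i => rho t h i x ^ 2)); trivial; intros; apply pow2_ge_0. }
  eapply Rle_trans; [apply (linear_gronwall N (fun i j s => L i j s (t + h))
    (fun i s => err t h i s) (fun i s => rho t h i s) K (C * h ^ 2) x)|].
  - intros; now apply rho_derive.
  - intros; apply HK; trivial; [generalize (Rabs_pos t); lra|].
    eapply Rle_trans; [apply Rabs_triang|]; generalize (Rabs_pos x); lra.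
  - intros; apply HC; trivial; lra.
  - fold n; fold G.
    assert (S1 : sum_f_R0 (fun i => rho t h i 0 ^ 2) N <= n * (e * Rabs h) ^ 2).
    { replace (n * (e * Rabs h) ^ 2) with (sum_f_R0 (fun _ => (e * Rabs h) ^ 2) N)
        by (rewrite sum_cte; fold n; ring).
      apply sum_Rle; intros; apply pow_maj_Rabs; now apply Hb. }
    assert (S2 : (C * h ^ 2) ^ 2 <= (e * Rabs h) ^ 2).
    { apply pow_incr; split; [apply Rmult_le_pos; trivial; apply pow2_ge_0|].
      rewrite <- (pow2_abs h); simpl; nra. }
    apply Rle_trans with (2 * (e * Rabs h) ^ 2 * (n * G)).
    + replace (2 * (e * Rabs h) ^ 2 * (n * G))
        with ((n * (e * Rabs h) ^ 2 + n * (e * Rabs h) ^ 2) * G) by ring.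
      apply Rmult_le_compat_r; [lra|].
      apply Rplus_le_compat; trivial; now apply Rmult_le_compat_l.
    + replace ((2 * e * k * Rabs h) ^ 2) with (4 * (e * Rabs h) ^ 2 * (k * k)) by ring.
      generalize (pow2_ge_0 (e * Rabs h)); intros; apply Rmult_le_compat; try lra.
      * apply Rmult_le_pos; lra.
      * unfold k in *; nra. }
assert (ek : 2 * e * k = eps / 2) by (unfold e; field; lra).
rewrite ek in main.
assert (main' : Rabs (rho t h i x) <= eps / 2 * Rabs h).
{ assert (0 < eps / 2 * Rabs h) by (apply Rmult_lt_0_compat; lra).
  apply Rabs_le; nra. }
replace ((v i x (t + h) - v i x t) / h - dv i x t) with (rho t h i x / h)
  by (unfold rho; now field).
unfold Rdiv; rewrite Rabs_mult, Rabs_inv.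
apply (Rmult_lt_reg_r (Rabs h)); trivial.
rewrite Rmult_assoc, Rinv_l by lra; nra.
Qed.

(** Partial derivatives alone would not suffice: the bound [D] on [dv] makes [v] Lipschitz in [t]
    with one constant for all nearby [x], and continuity in [x] is then used at the single value
    [t]. *)
Let v_continuity (i : nat) (x t : R) : (i <= N)%nat -> continuity_2d_pt (v i) x t.
Proof.
intros Hi eps.
set (r := Rabs x + Rabs t + 1).
destruct (coefficient_bound M r HM) as [K [K0 HK]].
destruct (v_bound r) as [V [V0 HV]].
set (D := INR (S N) * (K * V)).
assert (D0 : 0 <= D) by (repeat apply Rmult_le_pos; trivial; apply pos_INR).
pose proof (is_derive_continuity_pt _ _ _ (v_derive_x i x t Hi)) as cx.
destruct (proj1 (continuity_pt_locally _ _) cx (pos_div_2 eps)) as [d Hd]; simpl in Hd.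
assert (q0 : 0 < eps / 2 / (D + 1)).
{ apply Rdiv_lt_0_compat; [apply is_pos_div_2 | lra]. }
assert (d0 : 0 < Rmin (Rmin 1 d) (eps / 2 / (D + 1))).
{ repeat apply Rmin_glb_lt; trivial; [lra | apply cond_pos]. }
exists (mkposreal _ d0); simpl; intros y s Hy Hs.
assert (Hb : Rabs (y - x) < 1 /\ Rabs (y - x) < d /\ Rabs (s - t) < 1
  /\ Rabs (s - t) < eps / 2 / (D + 1)).
{ generalize (Rmin_l (Rmin 1 d) (eps / 2 / (D + 1)))
    (Rmin_r (Rmin 1 d) (eps / 2 / (D + 1))) (Rmin_l 1 d) (Rmin_r 1 d); lra. }
destruct Hb as [Hy1 [Hy2 [Hs1 Hs2]]].
assert (E : Rabs (v i y s - v i y t) <= D * Rabs (s - t)).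
{ destruct (is_derive_mean_value (fun c => v i y c) (fun c => dv i y c) t s)
    as [c [Hc Ec]].
  - intros; now apply v_derive_t.
  - rewrite Ec, Rabs_mult; apply Rmult_le_compat_r; [apply Rabs_pos|].
    assert (Hyr : Rabs y <= r).
    { replace y with ((y - x) + x) by ring.
      eapply Rle_trans; [apply Rabs_triang|]; unfold r; generalize (Rabs_pos t); lra. }
    assert (Hcr : Rabs c <= r).
    { apply Rle_trans with (1 + Rabs t); [|unfold r; generalize (Rabs_pos x); lra].
      replace c with ((c - t) + t) by ring.
      eapply Rle_trans; [apply Rabs_triang|]; apply Rplus_le_compat_r.
      apply Rabs_le; apply Rabs_def2 in Hs1; unfold Rmin, Rmax in Hc.
      destruct (Rle_dec t s); lra. }
    apply sum_abs_le; intros j Hj; rewrite Rabs_mult.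
    apply Rmult_le_compat; try apply Rabs_pos; [now apply HK | now apply HV]. }
specialize (Hd y Hy2).
replace (v i y s - v i x t) with ((v i y s - v i y t) + (v i y t - v i x t)) by ring.
eapply Rle_lt_trans; [apply Rabs_triang|].
assert (D * Rabs (s - t) <= eps / 2).
{ apply (Rmult_lt_compat_l (D + 1)) in Hs2; [|lra].
  replace ((D + 1) * (eps / 2 / (D + 1))) with (eps / 2) in Hs2 by (field; lra).
  generalize (Rabs_pos (s - t)); nra. }
lra.
Qed.

Let v_ex_diff (n : nat) : forall i x t, (i <= N)%nat -> ex_diff_n (v i) n x t.
Proof.
induction n as [|n IH]; intros i x t Hi; simpl.
- split; trivial; now apply v_continuity.
- split; [now apply v_continuity|].
  split; [now eexists; apply v_derive_x|].
  split; [now eexists; apply v_derive_t|]; split.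
  + replace (fun u s => Derive (fun z => v i z s) u)
      with (fun u s => sum_f_R0 (fun j => L i j u s * v j u s) N).
    * apply (ex_diff_n_sum (fun j u s => L i j u s * v j u s)); intros j Hj.
      apply ex_diff_n_mult; intros; [apply HL | now apply IH].
    * do 2 (apply functional_extensionality; intro).
      symmetry; now apply is_derive_unique, v_derive_x.
  + replace (fun u s => Derive (fun z => v i u z) s)
      with (fun u s => sum_f_R0 (fun j => M i j u s * v j u s) N).
    * apply (ex_diff_n_sum (fun j u s => M i j u s * v j u s)); intros j Hj.
      apply ex_diff_n_mult; intros; [apply HM | now apply IH].
    * do 2 (apply functional_extensionality; intro).
      symmetry; now apply is_derive_unique, v_derive_t.
Qed.

Lemma frobenius_linear : exists v : nat -> R -> R -> R,
  forall i, (i <= N)%nat -> smooth (v i) /\ v i 0 0 = v0 i /\ forall x t,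
    Dx (v i) x t = sum_f_R0 (fun j => L i j x t * v j x t) N /\
    Dt (v i) x t = sum_f_R0 (fun j => M i j x t * v j x t) N.
Proof.
exists v; intros i Hi; split; [|split; [|split]].
- intros n x t; now apply v_ex_diff.
- rewrite v_base; apply linear_flow_0.
- now apply is_derive_unique, v_derive_x.
- now apply is_derive_unique, v_derive_t.
Qed.

End Frobenius.

(** * Calculus and linear algebra for frames *)

Lemma smooth_plus (f g : R -> R -> R) : smooth f -> smooth g ->
  smooth (fun x t => f x t + g x t).
Proof.
intros Hf Hg; replace (fun x t => f x t + g x t)
  with (fun x t => 1 * f x t + 1 * g x t) by
  (do 2 (apply functional_extensionality; intro); ring).
now apply smooth_lin.
Qed.

Lemma smooth_minus (f g : R -> R -> R) : smooth f -> smooth g ->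
  smooth (fun x t => f x t - g x t).
Proof.
intros Hf Hg; replace (fun x t => f x t - g x t)
  with (fun x t => 1 * f x t + (-1) * g x t) by
  (do 2 (apply functional_extensionality; intro); ring).
now apply smooth_lin.
Qed.

Lemma smooth_opp (f : R -> R -> R) : smooth f -> smooth (fun x t => - f x t).
Proof.
intros Hf; replace (fun x t => - f x t) with (fun x t => (-1) * f x t + 0 * f x t)
  by (do 2 (apply functional_extensionality; intro); ring).
now apply smooth_lin.
Qed.

Lemma smooth_div_const (f : R -> R -> R) (c : R) : smooth f ->
  smooth (fun x t => f x t / c).
Proof. intros Hf; apply smooth_mult; trivial; apply (smooth_const (/ c)). Qed.

#[local] Hint Resolve smooth_plus smooth_minus smooth_opp smooth_mult smooth_const
  smooth_Dx smooth_Dt smooth_div_const : smooth.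

Lemma Dx_plus (f g : R -> R -> R) (x t : R) : smooth f -> smooth g ->
  Dx (fun x t => f x t + g x t) x t = Dx f x t + Dx g x t.
Proof. intros Hf Hg; apply Derive_plus; now apply smooth_ex_Dx. Qed.

Lemma Dt_plus (f g : R -> R -> R) (x t : R) : smooth f -> smooth g ->
  Dt (fun x t => f x t + g x t) x t = Dt f x t + Dt g x t.
Proof. intros Hf Hg; apply Derive_plus; now apply smooth_ex_Dt. Qed.

Lemma Dx_minus (f g : R -> R -> R) (x t : R) : smooth f -> smooth g ->
  Dx (fun x t => f x t - g x t) x t = Dx f x t - Dx g x t.
Proof. intros Hf Hg; apply Derive_minus; now apply smooth_ex_Dx. Qed.

Lemma Dt_minus (f g : R -> R -> R) (x t : R) : smooth f -> smooth g ->
  Dt (fun x t => f x t - g x t) x t = Dt f x t - Dt g x t.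
Proof. intros Hf Hg; apply Derive_minus; now apply smooth_ex_Dt. Qed.

Lemma Dx_mult (f g : R -> R -> R) (x t : R) : smooth f -> smooth g ->
  Dx (fun x t => f x t * g x t) x t = Dx f x t * g x t + f x t * Dx g x t.
Proof.
intros Hf Hg.
apply (Derive_mult (fun s => f s t) (fun s => g s t)); now apply smooth_ex_Dx.
Qed.

Lemma Dt_mult (f g : R -> R -> R) (x t : R) : smooth f -> smooth g ->
  Dt (fun x t => f x t * g x t) x t = Dt f x t * g x t + f x t * Dt g x t.
Proof.
intros Hf Hg.
apply (Derive_mult (fun s => f x s) (fun s => g x s)); now apply smooth_ex_Dt.
Qed.

Lemma Dx_opp (f : R -> R -> R) (x t : R) :
  Dx (fun x t => - f x t) x t = - Dx f x t.
Proof. apply Derive_opp. Qed.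

Lemma Dt_opp (f : R -> R -> R) (x t : R) :
  Dt (fun x t => - f x t) x t = - Dt f x t.
Proof. apply Derive_opp. Qed.

Lemma Dx_const (c x t : R) : Dx (fun _ _ => c) x t = 0.
Proof. apply (Derive_const c). Qed.

Lemma Dt_const (c x t : R) : Dt (fun _ _ => c) x t = 0.
Proof. apply (Derive_const c). Qed.

Lemma Dx_div_const (f : R -> R -> R) (c x t : R) : smooth f ->
  Dx (fun x t => f x t / c) x t = Dx f x t / c.
Proof.
intros Hf; unfold Rdiv.
rewrite (Dx_mult f (fun _ _ => / c)), Dx_const by auto with smooth; ring.
Qed.

Lemma Dt_div_const (f : R -> R -> R) (c x t : R) : smooth f ->
  Dt (fun x t => f x t / c) x t = Dt f x t / c.
Proof.
intros Hf; unfold Rdiv.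
rewrite (Dt_mult f (fun _ _ => / c)), Dt_const by auto with smooth; ring.
Qed.

Ltac Dsimpl := repeat first
  [ rewrite Dx_plus by auto 20 with smooth | rewrite Dt_plus by auto 20 with smooth
  | rewrite Dx_minus by auto 20 with smooth | rewrite Dt_minus by auto 20 with smooth
  | rewrite Dx_mult by auto 20 with smooth | rewrite Dt_mult by auto 20 with smooth
  | rewrite Dx_opp | rewrite Dt_opp | rewrite Dx_const | rewrite Dt_const
  | rewrite Dx_div_const by auto 20 with smooth
  | rewrite Dt_div_const by auto 20 with smooth ].

(** This stands in for uniqueness of solutions: below, frames and curves are compared through
    expressions, mostly inner products, with zero gradient and a value known at the origin. *)
Lemma gradient_0_constant (f : R -> R -> R) : smooth f ->
  (forall x t, Dx f x t = 0) -> (forall x t, Dt f x t = 0) ->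
  forall x t, f x t = f 0 0.
Proof.
intros Hf Hx Ht x t; transitivity (f 0 t).
- destruct (is_derive_mean_value (fun s => f s t) (fun s => Dx f s t) 0 x)
    as [c [_ E]]; [intros; now apply smooth_is_derive_x|].
  rewrite Hx in E; lra.
- destruct (is_derive_mean_value (fun s => f 0 s) (fun s => Dt f 0 s) 0 t)
    as [c [_ E]]; [intros; now apply smooth_is_derive_t|].
  rewrite Ht in E; lra.
Qed.

(* [(f, 1)] solves a linear system, flat because [P_t = Q_x]. *)
Lemma potential (P Q : R -> R -> R) : smooth P -> smooth Q ->
  (forall x t, Dt P x t = Dx Q x t) ->
  exists f, smooth f /\ forall x t, Dx f x t = P x t /\ Dt f x t = Q x t.
Proof.
intros HP HQ E.
pose (sys := fun (F : R -> R -> R) (i j : nat) =>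
  match i, j with 0%nat, 1%nat => F | _, _ => fun _ _ => 0 end).
assert (Hsys : forall F, smooth F -> forall i j, smooth (sys F i j)).
{ intros F HF [|i] [|[|j]]; simpl; auto with smooth. }
destruct (frobenius_linear 1 (sys P) (sys Q)
  (fun i => match i with 0%nat => 0 | _ => 1 end)) as [v Hv]; auto.
- intros x t u [|[|i]] Hi; simpl; try lia; Dsimpl; rewrite ?E; ring.
- destruct (Hv 0%nat) as [S0 [_ D0]]; [lia|].
  destruct (Hv 1%nat) as [S1 [I1 D1]]; [lia|]; simpl in *.
  assert (one : forall x t, v 1%nat x t = 1).
  { intros x t; rewrite <- I1; apply gradient_0_constant; trivial; intros y s.
    - rewrite (proj1 (D1 y s)); ring.
    - rewrite (proj2 (D1 y s)); ring. }
  exists (v 0%nat); split; trivial; intros x t; split.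
  + rewrite (proj1 (D0 x t)), one; ring.
  + rewrite (proj2 (D0 x t)), one; ring.
Qed.

(** * Entries of matrices and the group SO(3) *)

Lemma entry_Mdx {m n : nat} (F : R -> R -> @matrix R m n) (i j : nat) :
  (i < m)%nat -> (j < n)%nat -> entry (Mdx F) i j = Dx (entry F i j).
Proof.
intros Hi Hj; do 2 (apply functional_extensionality; intro).
unfold entry at 1, Mdx; now rewrite coeff_mat_bij.
Qed.

Lemma entry_Mdt {m n : nat} (F : R -> R -> @matrix R m n) (i j : nat) :
  (i < m)%nat -> (j < n)%nat -> entry (Mdt F) i j = Dt (entry F i j).
Proof.
intros Hi Hj; do 2 (apply functional_extensionality; intro).
unfold entry at 1, Mdt; now rewrite coeff_mat_bij.
Qed.

Lemma entry_mk_matrix {m n : nat} (P : nat -> nat -> R -> R -> R) (i j : nat) :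
  (i < m)%nat -> (j < n)%nat ->
  entry (fun x t => mk_matrix m n (fun i j => P i j x t)) i j = P i j.
Proof.
intros Hi Hj; do 2 (apply functional_extensionality; intro).
unfold entry; now rewrite coeff_mat_bij.
Qed.

Lemma mat3_eq (A B : mat3) :
  (forall i j, (i < 3)%nat -> (j < 3)%nat -> mx A i j = mx B i j) -> A = B.
Proof. intros H; now apply (coeff_mat_ext_aux 0 0). Qed.

Lemma vec3_eq (u v : vec3) :
  (forall i, (i < 3)%nat -> vx u i = vx v i) -> u = v.
Proof.
intros H; apply (coeff_mat_ext_aux 0 0); intros i [|j] Hi Hj; [now apply H | lia].
Qed.

Lemma mx_mul (A B : mat3) (i j : nat) : (i < 3)%nat -> (j < 3)%nat ->
  mx (mat3_mul A B) i j =
  mx A i 0 * mx B 0 j + mx A i 1 * mx B 1 j + mx A i 2 * mx B 2 j.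
Proof.
intros Hi Hj; unfold mx at 1, mat3_mul, Mmult; rewrite coeff_mat_bij by assumption.
simpl; rewrite !sum_Sn, sum_O; unfold plus, mult; simpl; reflexivity.
Qed.

Lemma mx_transp (A : mat3) (i j : nat) : (i < 3)%nat -> (j < 3)%nat ->
  mx (transp A) i j = mx A j i.
Proof. intros Hi Hj; unfold mx at 1, transp; now rewrite coeff_mat_bij. Qed.

Lemma mx_one (i j : nat) : (i < 3)%nat -> (j < 3)%nat ->
  mx mat3_one i j = if Nat.eqb i j then 1 else 0.
Proof.
intros Hi Hj; destruct i as [|[|[|i]]], j as [|[|[|j]]]; try lia; reflexivity.
Qed.

Lemma SO3_iff (A : mat3) : SO3 A <->
  (forall j k, (j < 3)%nat -> (k < 3)%nat ->
     mx A 0 j * mx A 0 k + mx A 1 j * mx A 1 k + mx A 2 j * mx A 2 k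
     = if Nat.eqb j k then 1 else 0) /\ det3 A = 1.
Proof.
split; intros [H D]; split; trivial.
- intros j k Hj Hk; rewrite <- mx_one, <- H, mx_mul, !mx_transp by lia; reflexivity.
- apply mat3_eq; intros j k Hj Hk.
  rewrite mx_one, <- H, mx_mul, !mx_transp by lia; reflexivity.
Qed.

Lemma SO3_transp (A : mat3) : SO3 A -> SO3 (transp A).
Proof.
intros HA; destruct (SO3_inverse A HA) as [_ E]; split.
- rewrite <- E; f_equal; apply mat3_eq; intros i j Hi Hj; now rewrite !mx_transp.
- destruct HA as [_ D]; rewrite <- D; unfold det3; rewrite !mx_transp by lia; ring.
Qed.

Lemma SO3_rows (A : mat3) (j k : nat) : SO3 A -> (j < 3)%nat -> (k < 3)%nat ->
  mx A j 0 * mx A k 0 + mx A j 1 * mx A k 1 + mx A j 2 * mx A k 2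
  = if Nat.eqb j k then 1 else 0.
Proof.
intros HA Hj Hk; destruct (proj1 (SO3_iff _) (SO3_transp A HA)) as [H _].
specialize (H j k Hj Hk); now rewrite !mx_transp in H by lia.
Qed.

Lemma SO3_mul (A B : mat3) : SO3 A -> SO3 B -> SO3 (mat3_mul A B).
Proof.
intros [HA DA] [HB DB]; split.
- assert (E : transp (mat3_mul A B) = mat3_mul (transp B) (transp A)).
  { apply mat3_eq; intros i j Hi Hj; rewrite mx_transp, !mx_mul by assumption.
    rewrite !mx_transp by lia; ring. }
  rewrite E; unfold mat3_mul, mat3_one in *.
  now rewrite Mmult_assoc, <- (Mmult_assoc (transp B)), HA, Mmult_one_r.
- transitivity (det3 A * det3 B); [|rewrite DA, DB; ring].
  unfold det3; rewrite !mx_mul by lia; ring.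
Qed.

Lemma SO3_one : SO3 mat3_one.
Proof.
apply SO3_iff; split.
- intros j k Hj Hk; rewrite !mx_one by lia.
  destruct j as [|[|[|j]]], k as [|[|[|k]]]; try lia; simpl; ring.
- unfold det3; rewrite !mx_one by lia; simpl; ring.
Qed.

Lemma SO3_mul_transp_iff (A B X : mat3) : SO3 A ->
  mat3_mul (transp A) B = X <-> B = mat3_mul A X.
Proof.
intros HA; destruct (SO3_inverse A HA) as [E1 E2]; unfold mat3_mul, mat3_one in *; split.
- intros <-; now rewrite Mmult_assoc, E2, Mmult_one_l.
- intros ->; now rewrite Mmult_assoc, E1, Mmult_one_l.
Qed.

Lemma SO3_first_column (u : vec3) :
  vx u 0 * vx u 0 + vx u 1 * vx u 1 + vx u 2 * vx u 2 = 1 ->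
  exists Q, SO3 Q /\ forall i, (i < 3)%nat -> mx Q i 0 = vx u i.
Proof.
set (a := vx u 0); set (b := vx u 1); set (c := vx u 2); intros H.
assert (mk : forall M : mat3, mx M 0 0 = a -> mx M 1 0 = b -> mx M 2 0 = c ->
  forall i, (i < 3)%nat -> mx M i 0 = vx u i).
{ intros M E0 E1 E2 [|[|[|i]]] Hi; trivial; lia. }
(* The general formula divides by [1 + a]. In the antipodal case the half turn about the third axis
   serves. *)
destruct (Req_dec a (-1)) as [Ha|Ha].
- assert (Hb : b = 0) by nra; assert (Hc : c = 0) by nra.
  exists [[-1, 0, 0], [0, -1, 0], [0, 0, 1]]; split.
  + apply SO3_iff; split; [|unfold det3, mx, coeff_mat; simpl; ring].
    intros [|[|[|j]]] [|[|[|k]]] Hj Hk; try lia; unfold mx, coeff_mat; simpl; ring.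
  + apply mk; unfold mx, coeff_mat; simpl; congruence.
- assert (Hk : / (1 + a) * (1 + a) = 1) by (apply Rinv_l; lra).
  set (k := / (1 + a)) in Hk.
  (* the rotation about [e1 x u] taking the first basis vector to [u] *)
  exists [[a, - b, - c],
          [b, 1 - b * b * k, - (b * c * k)],
          [c, - (b * c * k), 1 - c * c * k]]; split; [|now apply mk].
  apply SO3_iff; split.
  + intros [|[|[|i]]] [|[|[|j]]] Hi Hj; try lia; unfold mx, coeff_mat; simpl;
      clearbody a b c k; clear - H Hk; nsatz.
  + unfold det3, mx, coeff_mat; simpl; clearbody a b c k; clear - H Hk; nsatz.
Qed.

Lemma choice_function {X Y : Type} (P : X -> Y -> Prop) :
  (forall x, exists y, P x y) -> exists f, forall x, P x (f x).
Proof.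
intros H; exists (fun x => proj1_sig (constructive_indefinite_description _ (H x))).
intros x; exact (proj2_sig (constructive_indefinite_description _ (H x))).
Qed.

(** Transport with angular velocities [a] and [b]; the hypothesis is [a_t - b_x + a x b = 0], which
    is flatness by the Jacobi identity. Vector multiplication is skew and traceless, so the inner
    products of the columns and the determinant keep the values they have for [Q]. *)
Lemma moving_frame (a b : nat -> R -> R -> R) (Q : mat3) :
  (forall i, smooth (a i)) -> (forall i, smooth (b i)) -> SO3 Q ->
  (forall x t,
     Dt (a 0%nat) x t - Dx (b 0%nat) x t
       + (a 1%nat x t * b 2%nat x t - a 2%nat x t * b 1%nat x t) = 0 /\
     Dt (a 1%nat) x t - Dx (b 1%nat) x t
       + (a 2%nat x t * b 0%nat x t - a 0%nat x t * b 2%nat x t) = 0 /\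
     Dt (a 2%nat) x t - Dx (b 2%nat) x t
       + (a 0%nat x t * b 1%nat x t - a 1%nat x t * b 0%nat x t) = 0) ->
  exists P : nat -> nat -> R -> R -> R,
    (forall i j, (i < 3)%nat -> smooth (P i j)) /\
    (forall x t, SO3 (mk_matrix 3 3 (fun i j => P i j x t))) /\
    (forall i j, (i < 3)%nat -> P i j 0 0 = mx Q i j) /\
    (forall j x t,
       Dx (P 0%nat j) x t = a 1%nat x t * P 2%nat j x t - a 2%nat x t * P 1%nat j x t /\
       Dx (P 1%nat j) x t = a 2%nat x t * P 0%nat j x t - a 0%nat x t * P 2%nat j x t /\
       Dx (P 2%nat j) x t = a 0%nat x t * P 1%nat j x t - a 1%nat x t * P 0%nat j x t /\
       Dt (P 0%nat j) x t = b 1%nat x t * P 2%nat j x t - b 2%nat x t * P 1%nat j x t /\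
       Dt (P 1%nat j) x t = b 2%nat x t * P 0%nat j x t - b 0%nat x t * P 2%nat j x t /\
       Dt (P 2%nat j) x t = b 0%nat x t * P 1%nat j x t - b 1%nat x t * P 0%nat j x t).
Proof.
intros Ha Hb HQ flat.
(* [hat w] is the matrix of the map sending [v] to [w x v]. *)
pose (hat := fun (w : nat -> R -> R -> R) (i j : nat) => match i, j with
  | 0%nat, 1%nat => fun x t => - w 2%nat x t
  | 0%nat, 2%nat => w 1%nat
  | 1%nat, 0%nat => w 2%nat
  | 1%nat, 2%nat => fun x t => - w 0%nat x t
  | 2%nat, 0%nat => fun x t => - w 1%nat x t
  | 2%nat, 1%nat => w 0%nat
  | _, _ => fun _ _ => 0 end).
assert (Hhat : forall w, (forall i, smooth (w i)) -> forall i j, smooth (hat w i j)).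
{ intros w Hw [|[|[|i]]] [|[|[|j]]]; simpl; auto with smooth. }
assert (col : forall j, exists v : nat -> R -> R -> R, forall i, (i <= 2)%nat ->
  smooth (v i) /\ v i 0 0 = mx Q i j /\ forall x t,
    Dx (v i) x t = sum_f_R0 (fun j => hat a i j x t * v j x t) 2 /\
    Dt (v i) x t = sum_f_R0 (fun j => hat b i j x t * v j x t) 2).
{ intros j; apply frobenius_linear; auto.
  intros x t u i Hi; destruct (flat x t) as [F0 [F1 F2]].
  assert (G0 : Dt (a 0%nat) x t = Dx (b 0%nat) x t
    - (a 1%nat x t * b 2%nat x t - a 2%nat x t * b 1%nat x t)) by lra.
  assert (G1 : Dt (a 1%nat) x t = Dx (b 1%nat) x t
    - (a 2%nat x t * b 0%nat x t - a 0%nat x t * b 2%nat x t)) by lra.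
  assert (G2 : Dt (a 2%nat) x t = Dx (b 2%nat) x t
    - (a 0%nat x t * b 1%nat x t - a 1%nat x t * b 0%nat x t)) by lra.
  destruct i as [|[|[|i]]]; try lia; simpl; Dsimpl; rewrite ?G0, ?G1, ?G2; ring. }
apply choice_function in col; destruct col as [V HV].
pose (P := fun i j => V j i).
assert (SP : forall i j, (i < 3)%nat -> smooth (P i j)).
{ intros i j Hi; apply (HV j i); lia. }
assert (S0 : forall j, smooth (P 0%nat j)) by (intros; apply SP; lia).
assert (S1 : forall j, smooth (P 1%nat j)) by (intros; apply SP; lia).
assert (S2 : forall j, smooth (P 2%nat j)) by (intros; apply SP; lia).
assert (IP : forall i j, (i < 3)%nat -> P i j 0 0 = mx Q i j).
{ intros i j Hi; apply (HV j i); lia. }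
assert (DP : forall j x t,
       Dx (P 0%nat j) x t = a 1%nat x t * P 2%nat j x t - a 2%nat x t * P 1%nat j x t /\
       Dx (P 1%nat j) x t = a 2%nat x t * P 0%nat j x t - a 0%nat x t * P 2%nat j x t /\
       Dx (P 2%nat j) x t = a 0%nat x t * P 1%nat j x t - a 1%nat x t * P 0%nat j x t /\
       Dt (P 0%nat j) x t = b 1%nat x t * P 2%nat j x t - b 2%nat x t * P 1%nat j x t /\
       Dt (P 1%nat j) x t = b 2%nat x t * P 0%nat j x t - b 0%nat x t * P 2%nat j x t /\
       Dt (P 2%nat j) x t = b 0%nat x t * P 1%nat j x t - b 1%nat x t * P 0%nat j x t).
{ intros j x t.
  destruct (proj2 (proj2 (HV j 0%nat ltac:(lia))) x t) as [X0 T0].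
  destruct (proj2 (proj2 (HV j 1%nat ltac:(lia))) x t) as [X1 T1].
  destruct (proj2 (proj2 (HV j 2%nat ltac:(lia))) x t) as [X2 T2].
  unfold P; rewrite X0, X1, X2, T0, T1, T2; simpl; repeat split; ring. }
exists P; split; [exact SP|]; split; [|split; [exact IP | exact DP]].
intros x t; apply SO3_iff; split.
- intros j k Hj Hk; unfold mx; rewrite !coeff_mat_bij by lia.
  rewrite <- (proj1 (proj1 (SO3_iff Q) HQ) j k Hj Hk), <- !IP by lia.
  apply (gradient_0_constant (fun x t => P 0%nat j x t * P 0%nat k x t
    + P 1%nat j x t * P 1%nat k x t + P 2%nat j x t * P 2%nat k x t));
    auto with smooth; intros y s;
    destruct (DP j y s) as [E0 [E1 [E2 [E3 [E4 E5]]]]];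
    destruct (DP k y s) as [F0 [F1 [F2 [F3 [F4 F5]]]]]; Dsimpl.
  + rewrite E0, E1, E2, F0, F1, F2; ring.
  + rewrite E3, E4, E5, F3, F4, F5; ring.
(* The first fifteen occurrences of [mx] are those of the left determinant; those of [Q] stay
   folded, to be rewritten by [IP]. *)
- rewrite <- (proj2 HQ); unfold det3, mx at 1 2 3 4 5 6 7 8 9 10 11 12 13 14 15.
  rewrite !coeff_mat_bij by lia; rewrite <- !IP by lia.
  apply (gradient_0_constant (fun x t =>
    P 0%nat 0%nat x t * (P 1%nat 1%nat x t * P 2%nat 2%nat x t
      - P 1%nat 2%nat x t * P 2%nat 1%nat x t)
    - P 0%nat 1%nat x t * (P 1%nat 0%nat x t * P 2%nat 2%nat x t
      - P 1%nat 2%nat x t * P 2%nat 0%nat x t)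
    + P 0%nat 2%nat x t * (P 1%nat 0%nat x t * P 2%nat 1%nat x t
      - P 1%nat 1%nat x t * P 2%nat 0%nat x t))); auto 20 with smooth; intros y s;
    destruct (DP 0%nat y s) as [E0 [E1 [E2 [E3 [E4 E5]]]]];
    destruct (DP 1%nat y s) as [F0 [F1 [F2 [F3 [F4 F5]]]]];
    destruct (DP 2%nat y s) as [G0 [G1 [G2 [G3 [G4 G5]]]]]; Dsimpl.
  + rewrite E0, E1, E2, F0, F1, F2, G0, G1, G2; ring.
  + rewrite E3, E4, E5, F3, F4, F5, G3, G4, G5; ring.
Qed.

(** * Adapted p-frames in coordinates *)

(** With [g^{-1}] moved to the other side, each row of the frame solves one and the same linear
    system. Constant linear combinations of rows, that is, constant rotations of space, therefore
    preserve it. *)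
Definition frame_eqs (P : nat -> nat -> R -> R -> R) (k1 k2 : R -> R -> R) : Prop :=
  forall i, (i < 3)%nat -> forall x t,
    Dx (P i 0%nat) x t = k1 x t * P i 1%nat x t + k2 x t * P i 2%nat x t /\
    Dx (P i 1%nat) x t = - k1 x t * P i 0%nat x t /\
    Dx (P i 2%nat) x t = - k2 x t * P i 0%nat x t /\
    Dt (P i 0%nat) x t = - (Dx k2 x t / 2) * P i 1%nat x t
      + Dx k1 x t / 2 * P i 2%nat x t /\
    Dt (P i 1%nat) x t = Dx k2 x t / 2 * P i 0%nat x t
      - (k1 x t ^ 2 + k2 x t ^ 2) / 4 * P i 2%nat x t /\
    Dt (P i 2%nat) x t = - (Dx k1 x t / 2) * P i 0%nat x t
      + (k1 x t ^ 2 + k2 x t ^ 2) / 4 * P i 1%nat x t.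

Lemma vx_entry (gamma : R -> R -> vec3) (i : nat) (x t : R) :
  vx (gamma x t) i = entry gamma i 0 x t.
Proof. reflexivity. Qed.

Lemma mx_entry (g : R -> R -> mat3) (i j : nat) (x t : R) :
  mx (g x t) i j = entry g i j x t.
Proof. reflexivity. Qed.

Lemma mat3_eq_mul_iff (A X B : mat3) : B = mat3_mul A X <->
  forall i j, (i < 3)%nat -> (j < 3)%nat ->
    mx B i j = mx A i 0 * mx X 0 j + mx A i 1 * mx X 1 j + mx A i 2 * mx X 2 j.
Proof.
split.
- intros ->; apply mx_mul.
- intros H; apply mat3_eq; intros i j Hi Hj; now rewrite mx_mul, H.
Qed.

Lemma forall_lt_3 (P : nat -> Prop) : (forall i, (i < 3)%nat -> P i) <->
  P 0%nat /\ P 1%nat /\ P 2%nat.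
Proof.
split; [intros H; repeat split; apply H; lia|].
intros [H0 [H1 H2]] [|[|[|i]]] Hi; trivial; lia.
Qed.

Lemma adapted_pframe_iff (gamma : curve) (g : R -> R -> mat3) (k1 k2 : R -> R -> R) :
  adapted_pframe gamma g k1 k2 <->
  Msmooth g /\ (forall x t, SO3 (g x t)) /\
  (forall i, (i < 3)%nat -> entry g i 0 = Dx (entry gamma i 0)) /\
  frame_eqs (entry g) k1 k2.
Proof.
assert (X : forall x t, SO3 (g x t) ->
  mat3_mul (transp (g x t)) (Mdx g x t) =
     [[0, - k1 x t, - k2 x t], [k1 x t, 0, 0], [k2 x t, 0, 0]] <->
  forall i, (i < 3)%nat ->
    Dx (entry g i 0) x t = k1 x t * entry g i 1 x t + k2 x t * entry g i 2 x t /\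
    Dx (entry g i 1) x t = - k1 x t * entry g i 0 x t /\
    Dx (entry g i 2) x t = - k2 x t * entry g i 0 x t).
{ intros x t HS; rewrite SO3_mul_transp_iff, mat3_eq_mul_iff by assumption.
  split; intros H i; [intros Hi | intros j Hi].
  - pose proof (H i 0%nat Hi ltac:(lia)) as H0; pose proof (H i 1%nat Hi ltac:(lia)) as H1;
      pose proof (H i 2%nat Hi ltac:(lia)) as H2.
    rewrite !(mx_entry (Mdx g)), !(mx_entry g), entry_Mdx in H0, H1, H2 by lia.
    rewrite H0, H1, H2; unfold mx, coeff_mat; simpl; repeat split; ring.
  - destruct (H i Hi) as [H0 [H1 H2]]; intros Hj.
    rewrite !(mx_entry (Mdx g)), !(mx_entry g), entry_Mdx by lia; revert j Hj;
      apply forall_lt_3.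
    rewrite H0, H1, H2; unfold mx, coeff_mat; simpl; repeat split; ring. }
assert (T : forall x t, SO3 (g x t) ->
  mat3_mul (transp (g x t)) (Mdt g x t) =
      [[0, Dx k2 x t / 2, - Dx k1 x t / 2],
       [- Dx k2 x t / 2, 0, (k1 x t ^ 2 + k2 x t ^ 2) / 4],
       [Dx k1 x t / 2, - (k1 x t ^ 2 + k2 x t ^ 2) / 4, 0]] <->
  forall i, (i < 3)%nat ->
    Dt (entry g i 0) x t = - (Dx k2 x t / 2) * entry g i 1 x t
      + Dx k1 x t / 2 * entry g i 2 x t /\
    Dt (entry g i 1) x t = Dx k2 x t / 2 * entry g i 0 x t
      - (k1 x t ^ 2 + k2 x t ^ 2) / 4 * entry g i 2 x t /\
    Dt (entry g i 2) x t = - (Dx k1 x t / 2) * entry g i 0 x t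
      + (k1 x t ^ 2 + k2 x t ^ 2) / 4 * entry g i 1 x t).
{ intros x t HS; rewrite SO3_mul_transp_iff, mat3_eq_mul_iff by assumption.
  split; intros H i; [intros Hi | intros j Hi].
  - pose proof (H i 0%nat Hi ltac:(lia)) as H0; pose proof (H i 1%nat Hi ltac:(lia)) as H1;
      pose proof (H i 2%nat Hi ltac:(lia)) as H2.
    rewrite !(mx_entry (Mdt g)), !(mx_entry g), entry_Mdt in H0, H1, H2 by lia.
    rewrite H0, H1, H2; unfold mx, coeff_mat; simpl; repeat split; field.
  - destruct (H i Hi) as [H0 [H1 H2]]; intros Hj.
    rewrite !(mx_entry (Mdt g)), !(mx_entry g), entry_Mdt by lia; revert j Hj;
      apply forall_lt_3.
    rewrite H0, H1, H2; unfold mx, coeff_mat; simpl; repeat split; field. }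
assert (C : (forall x t, col (g x t) 0 = Mdx gamma x t) <->
  forall i, (i < 3)%nat -> entry g i 0 = Dx (entry gamma i 0)).
{ split.
  - intros H i Hi; rewrite <- entry_Mdx by lia.
    do 2 (apply functional_extensionality; intro).
    rewrite <- vx_entry, <- H; unfold vx, col; now rewrite coeff_mat_bij by lia.
  - intros H x t; apply vec3_eq; intros i Hi.
    rewrite (vx_entry (Mdx gamma)), entry_Mdx, <- H by lia.
    unfold vx, col; now rewrite coeff_mat_bij by lia. }
unfold adapted_pframe, frame_eqs; rewrite C.
split.
- intros [HS [HO [H0 [HX HT]]]]; repeat (split; [assumption|]); intros i Hi x t.
  destruct (proj1 (X x t (HO x t)) (HX x t) i Hi) as [? [? ?]].
  destruct (proj1 (T x t (HO x t)) (HT x t) i Hi) as [? [? ?]]; tauto.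
- intros [HS [HO [H0 HF]]]; repeat (split; [assumption|]); split; intros x t.
  + apply X; trivial; intros i Hi; destruct (HF i Hi x t) as [? [? [? ?]]]; tauto.
  + apply T; trivial; intros i Hi; destruct (HF i Hi x t) as [? [? [? ?]]]; tauto.
Qed.

Lemma is_vfe_iff (gamma : R -> R -> vec3) : is_vfe gamma <->
  (forall i, (i < 3)%nat -> smooth (entry gamma i 0)) /\
  (forall x t, Dx (entry gamma 0 0) x t * Dx (entry gamma 0 0) x t
    + Dx (entry gamma 1 0) x t * Dx (entry gamma 1 0) x t
    + Dx (entry gamma 2 0) x t * Dx (entry gamma 2 0) x t = 1) /\
  (forall x t,
    Dt (entry gamma 0 0) x t =
      / 2 * (Dx (entry gamma 1 0) x t * Dx (Dx (entry gamma 2 0)) x t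
             - Dx (entry gamma 2 0) x t * Dx (Dx (entry gamma 1 0)) x t) /\
    Dt (entry gamma 1 0) x t =
      / 2 * (Dx (entry gamma 2 0) x t * Dx (Dx (entry gamma 0 0)) x t
             - Dx (entry gamma 0 0) x t * Dx (Dx (entry gamma 2 0)) x t) /\
    Dt (entry gamma 2 0) x t =
      / 2 * (Dx (entry gamma 0 0) x t * Dx (Dx (entry gamma 1 0)) x t
             - Dx (entry gamma 1 0) x t * Dx (Dx (entry gamma 0 0)) x t)).
Proof.
assert (S : Msmooth gamma <-> forall i, (i < 3)%nat -> smooth (entry gamma i 0)).
{ split; [intros H i Hi; apply H; lia | intros H i [|j] Hi Hj; [now apply H | lia]]. }
assert (Nm : forall x t, norm3 (Mdx gamma x t) = 1 <->
  Dx (entry gamma 0 0) x t * Dx (entry gamma 0 0) x t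
    + Dx (entry gamma 1 0) x t * Dx (entry gamma 1 0) x t
    + Dx (entry gamma 2 0) x t * Dx (entry gamma 2 0) x t = 1).
{ intros x t; unfold norm3; rewrite !vx_entry, !entry_Mdx by lia.
  split; intros H; [|rewrite H; apply sqrt_1].
  rewrite <- sqrt_1 in H; apply sqrt_inj in H; trivial; nra. }
assert (F : forall x t, Mdt gamma x t =
     scal3 (1 / 2) (cross (Mdx gamma x t) (Mdx (Mdx gamma) x t)) <->
  Dt (entry gamma 0 0) x t =
      / 2 * (Dx (entry gamma 1 0) x t * Dx (Dx (entry gamma 2 0)) x t
             - Dx (entry gamma 2 0) x t * Dx (Dx (entry gamma 1 0)) x t) /\
    Dt (entry gamma 1 0) x t =
      / 2 * (Dx (entry gamma 2 0) x t * Dx (Dx (entry gamma 0 0)) x t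
             - Dx (entry gamma 0 0) x t * Dx (Dx (entry gamma 2 0)) x t) /\
    Dt (entry gamma 2 0) x t =
      / 2 * (Dx (entry gamma 0 0) x t * Dx (Dx (entry gamma 1 0)) x t
             - Dx (entry gamma 1 0) x t * Dx (Dx (entry gamma 0 0)) x t)).
{ intros x t.
  assert (E : forall u v : vec3,
    u = v <-> vx u 0 = vx v 0 /\ vx u 1 = vx v 1 /\ vx u 2 = vx v 2).
  { intros u v; rewrite <- (forall_lt_3 (fun i => vx u i = vx v i)).
    split; [now intros -> | apply vec3_eq]. }
  assert (Sc : forall a (v : vec3) i, (i < 3)%nat -> vx (scal3 a v) i = a * vx v i).
  { intros a v i Hi; unfold scal3, vx; now rewrite coeff_mat_bij by lia. }
  assert (Cr : forall u v, vx (cross u v) 0 = vx u 1 * vx v 2 - vx u 2 * vx v 1 /\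
    vx (cross u v) 1 = vx u 2 * vx v 0 - vx u 0 * vx v 2 /\
    vx (cross u v) 2 = vx u 0 * vx v 1 - vx u 1 * vx v 0) by (repeat split).
  destruct (Cr (Mdx gamma x t) (Mdx (Mdx gamma) x t)) as [C0 [C1 C2]].
  rewrite E, !Sc, C0, C1, C2 by lia.
  rewrite !(vx_entry (Mdt gamma)), !(vx_entry (Mdx gamma)), !(vx_entry (Mdx (Mdx gamma))).
  rewrite !entry_Mdt, !entry_Mdx by lia.
  replace (1 / 2) with (/ 2) by field; tauto. }
unfold is_vfe; rewrite S; split; intros [H1 [H2 H3]]; repeat split; trivial;
  try (intros; now apply Nm).
all: try (intros; now apply F).
all: apply F; apply H3.
Qed.

Lemma fun2_ext (f g : R -> R -> R) : (forall x t, f x t = g x t) -> f = g.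
Proof. intros H; do 2 (apply functional_extensionality; intro); apply H. Qed.

Ltac columns_eq HS g i j name :=
  pose proof (proj1 (proj1 (SO3_iff _) HS) i j ltac:(lia) ltac:(lia)) as name;
  cbv [Nat.eqb] in name; rewrite ?(mx_entry g) in name.

Ltac rows_eq HS g i j name :=
  pose proof (SO3_rows _ i j HS ltac:(lia) ltac:(lia)) as name;
  cbv [Nat.eqb] in name; rewrite ?(mx_entry g) in name.

Lemma pframe_smooth (gamma : curve) (g : R -> R -> mat3) (k1 k2 : R -> R -> R) (i j : nat) :
  adapted_pframe gamma g k1 k2 -> (i < 3)%nat -> (j < 3)%nat -> smooth (entry g i j).
Proof. intros [HS _]; now apply HS. Qed.

Lemma pframe_eqs (gamma : curve) (g : R -> R -> mat3) (k1 k2 : R -> R -> R) :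
  adapted_pframe gamma g k1 k2 -> frame_eqs (entry g) k1 k2.
Proof. intros H; now apply adapted_pframe_iff in H. Qed.

Lemma pframe_SO3 (gamma : curve) (g : R -> R -> mat3) (k1 k2 : R -> R -> R) (x t : R) :
  adapted_pframe gamma g k1 k2 -> SO3 (g x t).
Proof. intros [_ [H _]]; apply H. Qed.

Lemma pframe_tangent (gamma : curve) (g : R -> R -> mat3) (k1 k2 : R -> R -> R) (i : nat) :
  adapted_pframe gamma g k1 k2 -> (i < 3)%nat -> entry g i 0 = Dx (entry gamma i 0).
Proof. intros H; apply adapted_pframe_iff in H; apply H. Qed.

Lemma pframe_curvatures (gamma : curve) (g : R -> R -> mat3) (k1 k2 : R -> R -> R) :
  adapted_pframe gamma g k1 k2 ->
  k1 = (fun x t => Dx (entry g 0 0) x t * entry g 0 1 x t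
    + Dx (entry g 1 0) x t * entry g 1 1 x t + Dx (entry g 2 0) x t * entry g 2 1 x t) /\
  k2 = (fun x t => Dx (entry g 0 0) x t * entry g 0 2 x t
    + Dx (entry g 1 0) x t * entry g 1 2 x t + Dx (entry g 2 0) x t * entry g 2 2 x t).
Proof.
intros H; split; apply fun2_ext; intros x t;
  pose proof (pframe_SO3 _ _ _ _ x t H) as HS;
  pose proof (pframe_eqs _ _ _ _ H) as F;
  destruct (F 0%nat ltac:(lia) x t) as [E0 _];
  destruct (F 1%nat ltac:(lia) x t) as [E1 _];
  destruct (F 2%nat ltac:(lia) x t) as [E2 _]; rewrite E0, E1, E2;
  columns_eq HS g 1%nat 1%nat C11; columns_eq HS g 1%nat 2%nat C12;
  columns_eq HS g 2%nat 2%nat C22.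
- transitivity (k1 x t * 1 + k2 x t * 0); [ring|]; rewrite <- C11, <- C12; ring.
- transitivity (k1 x t * 0 + k2 x t * 1); [ring|]; rewrite <- C22, <- C12; ring.
Qed.

(** [adapted_pframe] asks no regularity of [k1] and [k2]; they inherit it from the frame through
    [k_i = (e_0)_x . e_i]. *)
Lemma pframe_curvatures_smooth (gamma : curve) (g : R -> R -> mat3) (k1 k2 : R -> R -> R) :
  adapted_pframe gamma g k1 k2 -> smooth k1 /\ smooth k2.
Proof.
intros H.
assert (S : forall i j, (i < 3)%nat -> (j < 3)%nat -> smooth (entry g i j)).
{ intros; now apply (pframe_smooth gamma g k1 k2). }
destruct (pframe_curvatures _ _ _ _ H) as [-> ->].
split; repeat apply smooth_plus; apply smooth_mult; try apply smooth_Dx; apply S; lia.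
Qed.

Lemma hasimotoE (k1 k2 : R -> R -> R) :
  hasimoto k1 k2 = fun x t => (k1 x t / 2, k2 x t / 2).
Proof.
do 2 (apply functional_extensionality; intro).
unfold hasimoto, Cinv, Cmult, Cplus, RtoC, Ci; simpl; apply f_equal2; field.
Qed.

Lemma Cdx_pair (f g : R -> R -> R) :
  Cdx (fun x t => (f x t, g x t)) = fun x t => (Dx f x t, Dx g x t).
Proof. reflexivity. Qed.

Lemma is_nls_hasimoto_iff (k1 k2 : R -> R -> R) : smooth k1 -> smooth k2 ->
  is_nls (hasimoto k1 k2) <-> forall x t,
    Dt k1 x t = - (Dx (Dx k2) x t / 2 + (k1 x t ^ 2 + k2 x t ^ 2) / 4 * k2 x t) /\
    Dt k2 x t = Dx (Dx k1) x t / 2 + (k1 x t ^ 2 + k2 x t ^ 2) / 4 * k1 x t.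
Proof.
intros H1 H2; rewrite hasimotoE.
assert (D : forall k, smooth k -> Dx (fun x t => k x t / 2) = fun x t => Dx k x t / 2).
{ intros k Hk; apply fun2_ext; intros; now apply Dx_div_const. }
assert (E : forall x t, Cdt (fun x t => (k1 x t / 2, k2 x t / 2)) x t =
  (Ci / 2 * (Cdx (Cdx (fun x t => (k1 x t / 2, k2 x t / 2)%R)) x t
    + 2 * RtoC (Cmod ((k1 x t / 2, k2 x t / 2)%R) ^ 2) * (k1 x t / 2, k2 x t / 2)%R))%C <->
  Dt k1 x t = - (Dx (Dx k2) x t / 2 + (k1 x t ^ 2 + k2 x t ^ 2) / 4 * k2 x t) /\
    Dt k2 x t = Dx (Dx k1) x t / 2 + (k1 x t ^ 2 + k2 x t ^ 2) / 4 * k1 x t).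
{ intros x t; rewrite !Cdx_pair, !D by auto with smooth.
  assert (Q : Cmod (k1 x t / 2, k2 x t / 2) ^ 2 = (k1 x t / 2) ^ 2 + (k2 x t / 2) ^ 2).
  { apply pow2_sqrt, Rplus_le_le_0_compat; apply pow2_ge_0. }
  rewrite Q; unfold Cdt; simpl; rewrite !Dt_div_const by assumption.
  unfold Cinv, Cdiv, Cmult, Cplus, RtoC, Ci; simpl; split.
  - intros Heq; injection Heq; intros Him Hre; split.
    + transitivity (2 * (Dt k1 x t / 2)); [field|]; rewrite Hre; field.
    + transitivity (2 * (Dt k2 x t / 2)); [field|]; rewrite Him; field.
  - intros [-> ->]; apply f_equal2; field. }
unfold is_nls, Csmooth; simpl; split.
- intros [_ H] x t; apply E, H.
- intros H; split; [split; auto with smooth | intros x t; now apply E].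
Qed.

(** Mixed derivatives of [e_1] and [e_2] agree. In each coordinate all terms cancel except a
    residual of the NLS times that coordinate of [e_0], and [e_0] is a unit vector. *)
Lemma pframe_nls (gamma : curve) (g : R -> R -> mat3) (k1 k2 : R -> R -> R) :
  adapted_pframe gamma g k1 k2 -> is_nls (hasimoto k1 k2).
Proof.
intros H; destruct (pframe_curvatures_smooth _ _ _ _ H) as [S1 S2].
apply is_nls_hasimoto_iff; trivial; intros x t.
pose proof (pframe_eqs _ _ _ _ H) as F.
assert (mixed : forall i, (i < 3)%nat ->
  (Dt k1 x t + (Dx (Dx k2) x t / 2 + (k1 x t ^ 2 + k2 x t ^ 2) / 4 * k2 x t))
    * entry g i 0 x t = 0 /\
  (Dt k2 x t - (Dx (Dx k1) x t / 2 + (k1 x t ^ 2 + k2 x t ^ 2) / 4 * k1 x t))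
    * entry g i 0 x t = 0).
{ intros i Hi.
  assert (P0 : smooth (entry g i 0)) by (apply (pframe_smooth _ _ _ _ i 0 H); lia).
  assert (P1 : smooth (entry g i 1)) by (apply (pframe_smooth _ _ _ _ i 1 H); lia).
  assert (P2 : smooth (entry g i 2)) by (apply (pframe_smooth _ _ _ _ i 2 H); lia).
  assert (X1 : Dx (entry g i 1) = fun x t => - k1 x t * entry g i 0 x t).
  { apply fun2_ext; intros y s; now destruct (F i Hi y s) as [? [? ?]]. }
  assert (X2 : Dx (entry g i 2) = fun x t => - k2 x t * entry g i 0 x t).
  { apply fun2_ext; intros y s; now destruct (F i Hi y s) as [? [? [? ?]]]. }
  (* The squares are written as products, the form that [Dsimpl] differentiates. *)
  assert (T1 : Dt (entry g i 1) = fun x t => Dx k2 x t / 2 * entry g i 0 x t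
      - (k1 x t * k1 x t + k2 x t * k2 x t) / 4 * entry g i 2 x t).
  { apply fun2_ext; intros y s; destruct (F i Hi y s) as [_ [_ [_ [_ [E _]]]]].
    rewrite E; field. }
  assert (T2 : Dt (entry g i 2) = fun x t => - (Dx k1 x t / 2) * entry g i 0 x t
      + (k1 x t * k1 x t + k2 x t * k2 x t) / 4 * entry g i 1 x t).
  { apply fun2_ext; intros y s; destruct (F i Hi y s) as [_ [_ [_ [_ [_ E]]]]].
    rewrite E; field. }
  pose proof (smooth_Dt_Dx _ x t P1) as M1; pose proof (smooth_Dt_Dx _ x t P2) as M2.
  rewrite X1, T1 in M1; rewrite X2, T2 in M2.
  destruct (F i Hi x t) as [E0 [E1 [E2 [E3 [E4 E5]]]]].
  revert M1 M2; Dsimpl; rewrite E0, E1, E2, E3; intros M1 M2; split; lra. }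
pose proof (pframe_SO3 _ _ _ _ x t H) as HS.
columns_eq HS g 0%nat 0%nat C00.
destruct (mixed 0%nat ltac:(lia)) as [U0 V0].
destruct (mixed 1%nat ltac:(lia)) as [U1 V1].
destruct (mixed 2%nat ltac:(lia)) as [U2 V2].
assert (cancel : forall c, c * entry g 0 0 x t = 0 -> c * entry g 1 0 x t = 0 ->
  c * entry g 2 0 x t = 0 -> c = 0).
{ intros c h0 h1 h2; rewrite <- (Rmult_1_r c), <- C00, !Rmult_plus_distr_l.
  rewrite <- !Rmult_assoc, h0, h1, h2; ring. }
apply cancel in U0; trivial; apply cancel in V0; trivial; split; lra.
Qed.

(** The cofactor identities say [e_0 x e_1 = e_2] and [e_0 x e_2 = - e_1]. The velocity becomes
    linear in the frame, so two curves with the same curvatures have velocities related by the same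
    rotation as their frames. *)
Lemma curve_Dt_pframe (gamma : curve) (g : R -> R -> mat3) (k1 k2 : R -> R -> R) (i : nat)
    (x t : R) : adapted_pframe gamma g k1 k2 -> (i < 3)%nat ->
  Dt (entry gamma i 0) x t =
    / 2 * (k1 x t * entry g i 2 x t - k2 x t * entry g i 1 x t).
Proof.
intros H; pose proof (pframe_eqs _ _ _ _ H) as F.
destruct (proj1 (is_vfe_iff _) (curveP gamma)) as [_ [_ V]].
destruct (V x t) as [V0 [V1 V2]].
rewrite <- (pframe_tangent _ _ _ _ 0 H), <- (pframe_tangent _ _ _ _ 1 H) in V2 by lia.
rewrite <- (pframe_tangent _ _ _ _ 0 H), <- (pframe_tangent _ _ _ _ 2 H) in V1 by lia.
rewrite <- (pframe_tangent _ _ _ _ 1 H), <- (pframe_tangent _ _ _ _ 2 H) in V0 by lia.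
destruct (SO3_cofactors _ (pframe_SO3 _ _ _ _ x t H)) as [[_ [A1 A2]] [[_ [B1 B2]] [_ [C1 C2]]]].
rewrite !(mx_entry g) in A1, A2, B1, B2, C1, C2.
destruct (F 0%nat ltac:(lia) x t) as [E0 _].
destruct (F 1%nat ltac:(lia) x t) as [E1 _].
destruct (F 2%nat ltac:(lia) x t) as [E2 _].
rewrite E1, E2 in V0; rewrite E0, E2 in V1; rewrite E0, E1 in V2.
revert i; apply (forall_lt_3 (fun i => Dt (entry gamma i 0) x t =
    / 2 * (k1 x t * entry g i 2 x t - k2 x t * entry g i 1 x t))).
rewrite V0, V1, V2; repeat split.
- rewrite A1, A2; ring.
- rewrite B1, B2; ring.
- rewrite C1, C2; ring.
Qed.

(** * Rotation of p-frames, and uniqueness of frames and curves *)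

Lemma pframe_rotate (gamma : curve) (g : R -> R -> mat3) (k1 k2 : R -> R -> R) (a b : R) :
  adapted_pframe gamma g k1 k2 -> a * a + b * b = 1 ->
  exists h, adapted_pframe gamma h (fun x t => a * k1 x t + b * k2 x t)
    (fun x t => a * k2 x t - b * k1 x t).
Proof.
intros H Hab; pose proof (pframe_eqs _ _ _ _ H) as F.
destruct (pframe_curvatures_smooth _ _ _ _ H) as [S1 S2].
pose (P := fun i j => match j with
  | 0%nat => entry g i 0
  | 1%nat => fun x t => a * entry g i 1 x t + b * entry g i 2 x t
  | _ => fun x t => a * entry g i 2 x t - b * entry g i 1 x t end).
exists (fun x t => mk_matrix 3 3 (fun i j => P i j x t)).
assert (SP : forall i j, (i < 3)%nat -> (j < 3)%nat -> smooth (entry g i j)).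
{ intros; now apply (pframe_smooth _ _ _ _ i j H). }
apply adapted_pframe_iff; split; [|split; [|split]].
- intros i j Hi Hj; rewrite entry_mk_matrix by assumption.
  destruct j as [|[|j]]; simpl; auto 10 with smooth.
- intros x t; pose proof (pframe_SO3 _ _ _ _ x t H) as HS.
  apply SO3_iff; split.
  + columns_eq HS g 0%nat 0%nat C00; columns_eq HS g 0%nat 1%nat C01.
    columns_eq HS g 0%nat 2%nat C02; columns_eq HS g 1%nat 1%nat C11.
    columns_eq HS g 1%nat 2%nat C12; columns_eq HS g 2%nat 2%nat C22.
    intros j k Hj Hk; unfold mx; rewrite !coeff_mat_bij by lia.
    destruct j as [|[|[|j]]], k as [|[|[|k]]]; try lia; simpl;
      clear - Hab C00 C01 C02 C11 C12 C22; nsatz.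
  + transitivity ((a * a + b * b) * det3 (g x t)).
    * unfold det3; rewrite !(mx_entry g); unfold mx; rewrite !coeff_mat_bij by lia.
      simpl; ring.
    * rewrite Hab, (proj2 HS); ring.
- intros i Hi; rewrite entry_mk_matrix by lia; now apply (pframe_tangent _ _ _ _ _ H).
- intros i Hi x t; rewrite !entry_mk_matrix by lia; unfold P; cbv beta iota.
  destruct (F i Hi x t) as [E0 [E1 [E2 [E3 [E4 E5]]]]].
  assert (S1' : smooth (entry g i 1)) by (apply SP; lia).
  assert (S2' : smooth (entry g i 2)) by (apply SP; lia).
  Dsimpl; rewrite E0, E1, E2, E3, E4, E5.
  assert (K : (a * k1 x t + b * k2 x t) ^ 2 + (a * k2 x t - b * k1 x t) ^ 2
    = k1 x t ^ 2 + k2 x t ^ 2).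
  { transitivity ((a * a + b * b) * (k1 x t ^ 2 + k2 x t ^ 2)); [ring|].
    rewrite Hab; ring. }
  rewrite K; repeat split; try field.
  + transitivity ((a * a + b * b)
      * (k1 x t * entry g i 1 x t + k2 x t * entry g i 2 x t)); [|ring].
    rewrite Hab; ring.
  + transitivity ((a * a + b * b) * (- (Dx k2 x t / 2) * entry g i 1 x t
      + Dx k1 x t / 2 * entry g i 2 x t)); [|field].
    rewrite Hab; ring.
Qed.

Lemma pframe_rigid (M : rigid) (gamma : curve) (g : R -> R -> mat3) (k1 k2 : R -> R -> R) :
  adapted_pframe gamma g k1 k2 ->
  adapted_pframe (rigid_act M gamma) (fun x t => mat3_mul (rot M) (g x t)) k1 k2.
Proof.
intros H; pose proof (pframe_eqs _ _ _ _ H) as F.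
(* The trailing [+ 0] brings the entries to the shape of [smooth_affine], [Dx_affine] and
   [Dt_affine]. *)
assert (E : forall i j, (i < 3)%nat -> (j < 3)%nat ->
  entry (fun x t => mat3_mul (rot M) (g x t)) i j = fun x t =>
    mx (rot M) i 0 * entry g 0 j x t + mx (rot M) i 1 * entry g 1 j x t
    + mx (rot M) i 2 * entry g 2 j x t + 0).
{ intros i j Hi Hj; apply fun2_ext; intros x t.
  change (mx (mat3_mul (rot M) (g x t)) i j = mx (rot M) i 0 * entry g 0 j x t
    + mx (rot M) i 1 * entry g 1 j x t + mx (rot M) i 2 * entry g 2 j x t + 0).
  rewrite mx_mul, !(mx_entry g) by assumption; ring. }
assert (SP : forall i j, (i < 3)%nat -> (j < 3)%nat -> smooth (entry g i j)).
{ intros; now apply (pframe_smooth _ _ _ _ i j H). }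
apply adapted_pframe_iff; split; [|split; [|split]].
- intros i j Hi Hj; rewrite E by assumption.
  apply smooth_affine; apply SP; lia.
- intros x t; apply SO3_mul; [apply rotP | exact (pframe_SO3 _ _ _ _ x t H)].
- intros i Hi; simpl; rewrite E, entry_rigid by lia.
  destruct (proj1 (is_vfe_iff _) (curveP gamma)) as [S _].
  apply fun2_ext; intros x t; rewrite Dx_affine by (apply S; lia).
  rewrite !(pframe_tangent _ _ _ _ _ H) by lia; ring.
- intros i Hi x t; rewrite !E by lia.
  rewrite !Dx_affine, !Dt_affine by (apply SP; lia).
  destruct (F 0%nat ltac:(lia) x t) as [-> [-> [-> [-> [-> ->]]]]].
  destruct (F 1%nat ltac:(lia) x t) as [-> [-> [-> [-> [-> ->]]]]].
  destruct (F 2%nat ltac:(lia) x t) as [-> [-> [-> [-> [-> ->]]]]].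
  repeat split; field.
Qed.

(** The two frames share [e_0] and the orientation, so they differ by a rotation of the normal plane
    with cosine [A] and sine [B]. Along [x] both are parallel, and along [t] both turn in the normal
    plane at the same rate; hence [A] and [B] are constant. *)
Lemma pframe_unique (gamma : curve) (g h : R -> R -> mat3) (k1 k2 l1 l2 : R -> R -> R) :
  adapted_pframe gamma g k1 k2 -> adapted_pframe gamma h l1 l2 ->
  exists a b, a * a + b * b = 1 /\ l1 = (fun x t => a * k1 x t + b * k2 x t) /\
    l2 = (fun x t => a * k2 x t - b * k1 x t).
Proof.
intros H H'.
assert (e0 : forall i x t, (i < 3)%nat -> entry h i 0 x t = entry g i 0 x t).
{ intros i x t Hi; now rewrite (pframe_tangent _ _ _ _ _ H),
    (pframe_tangent _ _ _ _ _ H') by assumption. }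
assert (e0' : forall i, (i < 3)%nat -> entry h i 0 = entry g i 0).
{ intros i Hi; apply fun2_ext; intros; now apply e0. }
pose proof (pframe_eqs _ _ _ _ H) as F; pose proof (pframe_eqs _ _ _ _ H') as F'.
pose (A := fun x t => entry h 0 1 x t * entry g 0 1 x t
  + entry h 1 1 x t * entry g 1 1 x t + entry h 2 1 x t * entry g 2 1 x t).
pose (B := fun x t => entry h 0 1 x t * entry g 0 2 x t
  + entry h 1 1 x t * entry g 1 2 x t + entry h 2 1 x t * entry g 2 2 x t).
assert (SP : forall i j, (i < 3)%nat -> (j < 3)%nat -> smooth (entry g i j)).
{ intros; now apply (pframe_smooth _ _ _ _ i j H). }
assert (SP' : forall i j, (i < 3)%nat -> (j < 3)%nat -> smooth (entry h i j)).
{ intros; now apply (pframe_smooth _ _ _ _ i j H'). }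
assert (SA : smooth A).
{ repeat apply smooth_plus; apply smooth_mult; (apply SP || apply SP'); lia. }
assert (SB : smooth B).
{ repeat apply smooth_plus; apply smooth_mult; (apply SP || apply SP'); lia. }
assert (loc : forall x t, A x t * A x t + B x t * B x t = 1 /\
  forall i, (i < 3)%nat ->
  entry h i 1 x t = A x t * entry g i 1 x t + B x t * entry g i 2 x t /\
  entry h i 2 x t = A x t * entry g i 2 x t - B x t * entry g i 1 x t).
{ intros x t; pose proof (pframe_SO3 _ _ _ _ x t H) as HS.
  pose proof (pframe_SO3 _ _ _ _ x t H') as HS'.
  rows_eq HS g 0%nat 0%nat R00; rows_eq HS g 0%nat 1%nat R01; rows_eq HS g 0%nat 2%nat R02.
  rows_eq HS g 1%nat 1%nat R11; rows_eq HS g 1%nat 2%nat R12; rows_eq HS g 2%nat 2%nat R22.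
  columns_eq HS' h 0%nat 1%nat C01; columns_eq HS' h 1%nat 1%nat C11.
  rewrite !e0 in C01 by lia.
  destruct (SO3_cofactors _ HS) as [[A0 [A1 A2]] [[B0 [B1 B2]] [C0 [C1 C2]]]].
  destruct (SO3_cofactors _ HS') as [[_ [_ A2']] [[_ [_ B2']] [_ [_ C2']]]].
  rewrite ?(mx_entry g), ?(mx_entry h) in *.
  rewrite ?e0 in A2', B2', C2' by lia.
  assert (X : forall i, (i < 3)%nat ->
    entry h i 1 x t = A x t * entry g i 1 x t + B x t * entry g i 2 x t).
  { unfold A, B; apply forall_lt_3; clear - R00 R01 R02 R11 R12 R22 C01.
    repeat split; nsatz. }
  destruct (proj1 (forall_lt_3 _) X) as [X0 [X1 X2]].
  split.
  - rewrite X0, X1, X2 in C11; clear - C11 HS.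
    columns_eq HS g 1%nat 1%nat D11; columns_eq HS g 1%nat 2%nat D12;
      columns_eq HS g 2%nat 2%nat D22.
    generalize dependent (A x t); generalize dependent (B x t); intros;
      clear - C11 D11 D12 D22.
    nsatz.
  - intros i Hi; split; [now apply X|]; revert i Hi.
    apply (forall_lt_3 (fun i => entry h i 2 x t
      = A x t * entry g i 2 x t - B x t * entry g i 1 x t)).
    rewrite A2', B2', C2', X0, X1, X2; repeat split.
    + rewrite A1, A2; ring.
    + rewrite B1, B2; ring.
    + rewrite C1, C2; ring. }
assert (kl : forall x t, l1 x t = A x t * k1 x t + B x t * k2 x t /\
  l2 x t = A x t * k2 x t - B x t * k1 x t).
{ intros x t.
  destruct (pframe_curvatures _ _ _ _ H) as [K1 K2].
  destruct (pframe_curvatures _ _ _ _ H') as [L1 L2].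
  pose proof (f_equal (fun f => f x t) K1) as K1x;
    pose proof (f_equal (fun f => f x t) K2) as K2x.
  pose proof (f_equal (fun f => f x t) L1) as L1x;
    pose proof (f_equal (fun f => f x t) L2) as L2x.
  cbv beta in K1x, K2x, L1x, L2x; clear K1 K2 L1 L2.
  rewrite L1x, L2x, K1x, K2x, !e0' by lia.
  destruct (loc x t) as [_ X].
  destruct (X 0%nat ltac:(lia)) as [-> ->]; destruct (X 1%nat ltac:(lia)) as [-> ->];
    destruct (X 2%nat ltac:(lia)) as [-> ->]; split; ring. }
assert (cst : forall x t, Dx A x t = 0 /\ Dx B x t = 0 /\ Dt A x t = 0 /\ Dt B x t = 0).
{ intros x t; pose proof (pframe_SO3 _ _ _ _ x t H) as HS.
  columns_eq HS g 0%nat 1%nat C01; columns_eq HS g 0%nat 2%nat C02.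
  columns_eq HS g 1%nat 1%nat C11; columns_eq HS g 1%nat 2%nat C12;
  columns_eq HS g 2%nat 2%nat C22.
  destruct (loc x t) as [AB X]; destruct (kl x t) as [L1 L2].
  destruct (F 0%nat ltac:(lia) x t) as [_ [E01 [E02 [_ [T01 T02]]]]].
  destruct (F 1%nat ltac:(lia) x t) as [_ [E11 [E12 [_ [T11 T12]]]]].
  destruct (F 2%nat ltac:(lia) x t) as [_ [E21 [E22 [_ [T21 T22]]]]].
  destruct (F' 0%nat ltac:(lia) x t) as [_ [E01' [_ [_ [T01' _]]]]].
  destruct (F' 1%nat ltac:(lia) x t) as [_ [E11' [_ [_ [T11' _]]]]].
  destruct (F' 2%nat ltac:(lia) x t) as [_ [E21' [_ [_ [T21' _]]]]].
  destruct (X 0%nat ltac:(lia)) as [X01 X02]; destruct (X 1%nat ltac:(lia)) as [X11 X12];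
    destruct (X 2%nat ltac:(lia)) as [X21 X22].
  (* This is the equality of the two rates of turning in [t], on which the vanishing of [Dt A] and
     [Dt B] rests. *)
  assert (KK : l1 x t ^ 2 + l2 x t ^ 2 = k1 x t ^ 2 + k2 x t ^ 2).
  { rewrite L1, L2; transitivity ((A x t * A x t + B x t * B x t) * (k1 x t ^ 2 + k2 x t ^ 2));
      [ring | rewrite AB; ring]. }
  assert (P01 : smooth (entry g 0 1)) by (apply SP; lia).
  assert (P11 : smooth (entry g 1 1)) by (apply SP; lia).
  assert (P21 : smooth (entry g 2 1)) by (apply SP; lia).
  assert (P02 : smooth (entry g 0 2)) by (apply SP; lia).
  assert (P12 : smooth (entry g 1 2)) by (apply SP; lia).
  assert (P22 : smooth (entry g 2 2)) by (apply SP; lia).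
  assert (P01' : smooth (entry h 0 1)) by (apply SP'; lia).
  assert (P11' : smooth (entry h 1 1)) by (apply SP'; lia).
  assert (P21' : smooth (entry h 2 1)) by (apply SP'; lia).
  rewrite KK in T01', T11', T21'.
  unfold A, B; Dsimpl.
  rewrite E01, E02, E11, E12, E21, E22, T01, T02, T11, T12, T21, T22,
    E01', E11', E21', T01', T11', T21', !e0 by lia.
  rewrite X01, X11, X21, X02, X12, X22.
  generalize ((k1 x t ^ 2 + k2 x t ^ 2) / 4) (Dx k1 x t / 2) (Dx k2 x t / 2)
    (Dx l2 x t / 2).
  generalize (A x t) (B x t); clear - C01 C02 C11 C12 C22; intros.
  repeat split; nsatz. }
exists (A 0 0), (B 0 0).
assert (HA : forall x t, A x t = A 0 0).
{ apply gradient_0_constant; trivial; intros; apply cst. }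
assert (HB : forall x t, B x t = B 0 0).
{ apply gradient_0_constant; trivial; intros; apply cst. }
split; [apply loc|]; split; apply fun2_ext; intros x t; rewrite <- (HA x t), <- (HB x t);
  apply kl.
Qed.

Lemma curve_ext (gamma delta : curve) :
  (forall i x t, (i < 3)%nat -> entry gamma i 0 x t = entry delta i 0 x t) -> gamma = delta.
Proof.
destruct gamma as [c Hc], delta as [d Hd]; simpl; intros H.
assert (E : c = d).
{ do 2 (apply functional_extensionality; intro).
  apply vec3_eq; intros i Hi; rewrite !vx_entry; now apply H. }
subst d; f_equal; apply proof_irrelevance.
Qed.

(** Both frames solve the same system with skew coefficients, so [h] times the transpose of [g] is
    constant; this is the rotation [Q]. The translation is [delta - Q gamma], constant because the
    tangents correspond under [Q] and, by [curve_Dt_pframe], so do the velocities. *)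
Lemma pframe_congruent (gamma delta : curve) (g h : R -> R -> mat3) (k1 k2 : R -> R -> R) :
  adapted_pframe gamma g k1 k2 -> adapted_pframe delta h k1 k2 ->
  exists M, delta = rigid_act M gamma.
Proof.
intros H H'.
pose proof (pframe_eqs _ _ _ _ H) as F; pose proof (pframe_eqs _ _ _ _ H') as F'.
assert (SP : forall i j, (i < 3)%nat -> (j < 3)%nat -> smooth (entry g i j)).
{ intros; now apply (pframe_smooth _ _ _ _ i j H). }
assert (SP' : forall i j, (i < 3)%nat -> (j < 3)%nat -> smooth (entry h i j)).
{ intros; now apply (pframe_smooth _ _ _ _ i j H'). }
pose (Q := mat3_mul (h 0 0) (transp (g 0 0))).
assert (HQ : SO3 Q).
{ apply SO3_mul; [|apply SO3_transp].
  - exact (pframe_SO3 _ _ _ _ 0 0 H').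
  - exact (pframe_SO3 _ _ _ _ 0 0 H). }
assert (cst : forall i j x t, (i < 3)%nat -> (j < 3)%nat ->
  entry h i 0 x t * entry g j 0 x t + entry h i 1 x t * entry g j 1 x t
  + entry h i 2 x t * entry g j 2 x t = mx Q i j).
{ intros i j x t Hi Hj; unfold Q; rewrite mx_mul, !mx_transp by lia.
  rewrite !(mx_entry g), !(mx_entry h).
  assert (P0 : smooth (entry g j 0)) by (apply SP; lia).
  assert (P1 : smooth (entry g j 1)) by (apply SP; lia).
  assert (P2 : smooth (entry g j 2)) by (apply SP; lia).
  assert (P0' : smooth (entry h i 0)) by (apply SP'; lia).
  assert (P1' : smooth (entry h i 1)) by (apply SP'; lia).
  assert (P2' : smooth (entry h i 2)) by (apply SP'; lia).
  apply (gradient_0_constant (fun x t => entry h i 0 x t * entry g j 0 x t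
    + entry h i 1 x t * entry g j 1 x t + entry h i 2 x t * entry g j 2 x t));
    auto with smooth; intros y s; Dsimpl;
    destruct (F j Hj y s) as [E0 [E1 [E2 [E3 [E4 E5]]]]];
    destruct (F' i Hi y s) as [E0' [E1' [E2' [E3' [E4' E5']]]]].
  - rewrite E0, E1, E2, E0', E1', E2'; ring.
  - rewrite E3, E4, E5, E3', E4', E5'; field. }
assert (hQ : forall i j x t, (i < 3)%nat -> (j < 3)%nat -> entry h i j x t =
  mx Q i 0 * entry g 0 j x t + mx Q i 1 * entry g 1 j x t + mx Q i 2 * entry g 2 j x t).
{ intros i j x t Hi Hj; rewrite <- !(cst i _ x t) by lia.
  pose proof (pframe_SO3 _ _ _ _ x t H) as HS.
  pose proof (proj1 (proj1 (SO3_iff _) HS)) as C.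
  pose proof (C 0%nat j ltac:(lia) Hj) as C0; pose proof (C 1%nat j ltac:(lia) Hj) as C1;
    pose proof (C 2%nat j ltac:(lia) Hj) as C2; rewrite !(mx_entry g) in C0, C1, C2.
  transitivity (entry h i 0 x t * (if Nat.eqb 0 j then 1 else 0)
    + entry h i 1 x t * (if Nat.eqb 1 j then 1 else 0)
    + entry h i 2 x t * (if Nat.eqb 2 j then 1 else 0)).
  - destruct j as [|[|[|j]]]; simpl; try ring; lia.
  - rewrite <- C0, <- C1, <- C2; ring. }
destruct (proj1 (is_vfe_iff _) (curveP gamma)) as [S _].
destruct (proj1 (is_vfe_iff _) (curveP delta)) as [S' _].
assert (S0 : smooth (entry gamma 0 0)) by (apply S; lia).
assert (S1 : smooth (entry gamma 1 0)) by (apply S; lia).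
assert (S2 : smooth (entry gamma 2 0)) by (apply S; lia).
pose (w := fun i x t => entry delta i 0 x t - (mx Q i 0 * entry gamma 0 0 x t
  + mx Q i 1 * entry gamma 1 0 x t + mx Q i 2 * entry gamma 2 0 x t)).
assert (Hw : forall i x t, (i < 3)%nat -> w i x t = w i 0 0).
{ intros i x t Hi; pose proof (S' i Hi) as Si; revert x t; apply gradient_0_constant.
  - unfold w; auto 10 with smooth.
  - intros x t; unfold w; Dsimpl.
    rewrite <- (pframe_tangent _ _ _ _ i H'), <- (pframe_tangent _ _ _ _ 0 H),
      <- (pframe_tangent _ _ _ _ 1 H), <- (pframe_tangent _ _ _ _ 2 H) by lia.
    rewrite hQ by lia; ring.
  - intros x t; unfold w; Dsimpl.
    rewrite (curve_Dt_pframe _ _ _ _ i x t H'), (curve_Dt_pframe _ _ _ _ 0 x t H),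
      (curve_Dt_pframe _ _ _ _ 1 x t H), (curve_Dt_pframe _ _ _ _ 2 x t H) by lia.
    rewrite (hQ i 1%nat), (hQ i 2%nat) by lia; ring. }
exists (Rigid Q HQ (mk_matrix 3 1 (fun i _ => w i 0 0))).
apply curve_ext; intros i x t Hi; simpl; rewrite entry_rigid by assumption; simpl.
unfold vx; rewrite coeff_mat_bij by lia; rewrite <- (Hw i x t) by assumption.
unfold w; ring.
Qed.

(** * Existence of p-frames and of curves *)

Ltac normalize_entries gP P0 H :=
  repeat rewrite gP in H by lia; repeat rewrite P0 in H by lia.

Lemma pframe_exists (gamma : curve) : exists g k1 k2, adapted_pframe gamma g k1 k2.
Proof.
destruct (proj1 (is_vfe_iff _) (curveP gamma)) as [S [U V]].
assert (S0 : smooth (entry gamma 0 0)) by (apply S; lia).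
assert (S1 : smooth (entry gamma 1 0)) by (apply S; lia).
assert (S2 : smooth (entry gamma 2 0)) by (apply S; lia).
pose (e := fun i => match i with 0%nat => Dx (entry gamma 0 0)
  | 1%nat => Dx (entry gamma 1 0) | _ => Dx (entry gamma 2 0) end).
assert (Se : forall i, smooth (e i)) by (intros [|[|i]]; simpl; auto with smooth).
assert (Ee : forall i, (i < 3)%nat -> Dx (entry gamma i 0) = e i).
{ now apply forall_lt_3. }
pose (p := fun i => Dx (e i)); pose (q := fun i => Dx (p i)); pose (r := fun i => Dt (e i)).
assert (Sp : forall i, smooth (p i)) by (intros; apply smooth_Dx, Se).
assert (Sq : forall i, smooth (q i)) by (intros; apply smooth_Dx, Sp).
assert (Sr : forall i, smooth (r i)) by (intros; apply smooth_Dt, Se).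
assert (ee : forall x t, e 0%nat x t * e 0%nat x t + e 1%nat x t * e 1%nat x t
  + e 2%nat x t * e 2%nat x t = 1) by exact U.
assert (ep : forall x t, e 0%nat x t * p 0%nat x t + e 1%nat x t * p 1%nat x t
  + e 2%nat x t * p 2%nat x t = 0).
{ intros x t.
  assert (D : Dx (fun x t => e 0%nat x t * e 0%nat x t + e 1%nat x t * e 1%nat x t
    + e 2%nat x t * e 2%nat x t) x t = 0).
  { rewrite (fun2_ext _ (fun _ _ => 1) ee); apply Dx_const. }
  revert D; Dsimpl; fold (p 0%nat) (p 1%nat) (p 2%nat); lra. }
(* The equation of the curve differentiated in [x] is [e_t = (e x e_xx) / 2], as [e_x x e_x]
   vanishes. *)
assert (rE : forall x t,
  r 0%nat x t = / 2 * (e 1%nat x t * q 2%nat x t - e 2%nat x t * q 1%nat x t) /\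
  r 1%nat x t = / 2 * (e 2%nat x t * q 0%nat x t - e 0%nat x t * q 2%nat x t) /\
  r 2%nat x t = / 2 * (e 0%nat x t * q 1%nat x t - e 1%nat x t * q 0%nat x t)).
{ intros x t.
  assert (V0 : Dt (entry gamma 0 0) = fun x t =>
    / 2 * (e 1%nat x t * p 2%nat x t - e 2%nat x t * p 1%nat x t)).
  { apply fun2_ext; intros; apply V. }
  assert (V1 : Dt (entry gamma 1 0) = fun x t =>
    / 2 * (e 2%nat x t * p 0%nat x t - e 0%nat x t * p 2%nat x t)).
  { apply fun2_ext; intros; apply V. }
  assert (V2 : Dt (entry gamma 2 0) = fun x t =>
    / 2 * (e 0%nat x t * p 1%nat x t - e 1%nat x t * p 0%nat x t)).
  { apply fun2_ext; intros; apply V. }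
  assert (R0 : r 0%nat x t = Dx (Dt (entry gamma 0 0)) x t) by now apply smooth_Dt_Dx.
  assert (R1 : r 1%nat x t = Dx (Dt (entry gamma 1 0)) x t) by now apply smooth_Dt_Dx.
  assert (R2 : r 2%nat x t = Dx (Dt (entry gamma 2 0)) x t) by now apply smooth_Dt_Dx.
  rewrite R0, R1, R2, V0, V1, V2; Dsimpl.
  fold (p 0%nat) (p 1%nat) (p 2%nat); fold (q 0%nat) (q 1%nat) (q 2%nat).
  repeat split; ring. }
assert (pt : forall i x t, Dt (p i) x t = Dx (r i) x t).
{ intros; apply smooth_Dt_Dx, Se. }
pose (K := fun x t => (p 0%nat x t * p 0%nat x t + p 1%nat x t * p 1%nat x t
  + p 2%nat x t * p 2%nat x t) / 4).
assert (SK : smooth K) by (unfold K; auto with smooth).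
pose (a := fun i => match i with
  | 0%nat => fun x t => e 1%nat x t * p 2%nat x t - e 2%nat x t * p 1%nat x t
  | 1%nat => fun x t => e 2%nat x t * p 0%nat x t - e 0%nat x t * p 2%nat x t
  | _ => fun x t => e 0%nat x t * p 1%nat x t - e 1%nat x t * p 0%nat x t end).
pose (b := fun i => match i with
  | 0%nat => fun x t => e 1%nat x t * r 2%nat x t - e 2%nat x t * r 1%nat x t
      - K x t * e 0%nat x t
  | 1%nat => fun x t => e 2%nat x t * r 0%nat x t - e 0%nat x t * r 2%nat x t
      - K x t * e 1%nat x t
  | _ => fun x t => e 0%nat x t * r 1%nat x t - e 1%nat x t * r 0%nat x t
      - K x t * e 2%nat x t end).
(* [(e x p) x e = p], since [e] is a unit vector orthogonal to [p]. The same identity recovers [r]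
   from [b], whose tangential part drops out of [b x e]. *)
assert (ax : forall x t,
  p 0%nat x t = a 1%nat x t * e 2%nat x t - a 2%nat x t * e 1%nat x t /\
  p 1%nat x t = a 2%nat x t * e 0%nat x t - a 0%nat x t * e 2%nat x t /\
  p 2%nat x t = a 0%nat x t * e 1%nat x t - a 1%nat x t * e 0%nat x t).
{ intros x t; generalize (ee x t) (ep x t); simpl; clear; intros; repeat split; nsatz. }
assert (bx : forall x t,
  r 0%nat x t = b 1%nat x t * e 2%nat x t - b 2%nat x t * e 1%nat x t /\
  r 1%nat x t = b 2%nat x t * e 0%nat x t - b 0%nat x t * e 2%nat x t /\
  r 2%nat x t = b 0%nat x t * e 1%nat x t - b 1%nat x t * e 0%nat x t).
{ intros x t.
  assert (er : e 0%nat x t * r 0%nat x t + e 1%nat x t * r 1%nat x t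
    + e 2%nat x t * r 2%nat x t = 0).
  { destruct (rE x t) as [-> [-> ->]]; ring. }
  generalize (ee x t) er; simpl; generalize (K x t); clear; intros; repeat split; nsatz. }
destruct (SO3_first_column (Mdx gamma 0 0)) as [Q [HQ Q0]].
{ rewrite !(vx_entry (Mdx gamma)), !entry_Mdx by lia; apply U. }
assert (Qe : forall i, (i < 3)%nat -> mx Q i 0 = e i 0 0).
{ intros i Hi; rewrite Q0, (vx_entry (Mdx gamma)), entry_Mdx, Ee by lia; reflexivity. }
destruct (moving_frame a b Q) as [P [SP [HO [IP DP]]]]; trivial.
{ intros [|[|i]]; simpl; auto with smooth. }
{ intros [|[|i]]; simpl; auto with smooth. }
{ intros x t; destruct (rE x t) as [R0 [R1 R2]].
  pose proof (ee x t) as E1; pose proof (ep x t) as E2.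
  unfold a, b, K; Dsimpl; rewrite !pt.
  fold (p 0%nat) (p 1%nat) (p 2%nat); fold (r 0%nat) (r 1%nat) (r 2%nat);
    fold (q 0%nat) (q 1%nat) (q 2%nat).
  rewrite R0, R1, R2.
  (* the curvature is a combination of [e.e - 1] and [e.e_x] *)
  pose (qp := q 0%nat x t * p 0%nat x t + q 1%nat x t * p 1%nat x t + q 2%nat x t * p 2%nat x t).
  pose (eq := e 0%nat x t * q 0%nat x t + e 1%nat x t * q 1%nat x t + e 2%nat x t * q 2%nat x t).
  assert (Z : forall c d, (e 0%nat x t * p 0%nat x t + e 1%nat x t * p 1%nat x t
    + e 2%nat x t * p 2%nat x t) * c + (e 0%nat x t * e 0%nat x t + e 1%nat x t * e 1%nat x t
    + e 2%nat x t * e 2%nat x t - 1) * d = 0) by (intros; rewrite E1, E2; ring).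
  repeat split.
  - rewrite <- (Z (q 0%nat x t - e 0%nat x t * eq / 2 + K x t * e 0%nat x t)
      (e 0%nat x t * qp / 2 - K x t * p 0%nat x t)); unfold qp, eq, K; field.
  - rewrite <- (Z (q 1%nat x t - e 1%nat x t * eq / 2 + K x t * e 1%nat x t)
      (e 1%nat x t * qp / 2 - K x t * p 1%nat x t)); unfold qp, eq, K; field.
  - rewrite <- (Z (q 2%nat x t - e 2%nat x t * eq / 2 + K x t * e 2%nat x t)
      (e 2%nat x t * qp / 2 - K x t * p 2%nat x t)); unfold qp, eq, K; field. }
set (g := fun x t => mk_matrix 3 3 (fun i j => P i j x t) : mat3).
assert (gP : forall i j, (i < 3)%nat -> (j < 3)%nat -> entry g i j = P i j).
{ intros i j Hi Hj; exact (entry_mk_matrix P i j Hi Hj). }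
assert (HSg : forall x t, SO3 (g x t)) by exact HO.
assert (SP0 : forall j, smooth (P 0%nat j)) by (intros; apply SP; lia).
assert (SP1 : forall j, smooth (P 1%nat j)) by (intros; apply SP; lia).
assert (SP2 : forall j, smooth (P 2%nat j)) by (intros; apply SP; lia).
(* [e] solves the same linear system as the first column of [P] *)
assert (Pe : forall x t, P 0%nat 0%nat x t * e 0%nat x t + P 1%nat 0%nat x t * e 1%nat x t
  + P 2%nat 0%nat x t * e 2%nat x t = 1).
{ intros x t.
  transitivity (P 0%nat 0%nat 0 0 * e 0%nat 0 0 + P 1%nat 0%nat 0 0 * e 1%nat 0 0
    + P 2%nat 0%nat 0 0 * e 2%nat 0 0).
  - apply (gradient_0_constant (fun x t => P 0%nat 0%nat x t * e 0%nat x t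
      + P 1%nat 0%nat x t * e 1%nat x t + P 2%nat 0%nat x t * e 2%nat x t));
      auto with smooth; intros y s; destruct (DP 0%nat y s) as [X0 [X1 [X2 [T0 [T1 T2]]]]];
      Dsimpl; fold (p 0%nat) (p 1%nat) (p 2%nat); fold (r 0%nat) (r 1%nat) (r 2%nat).
    + destruct (ax y s) as [-> [-> ->]]; rewrite X0, X1, X2; ring.
    + destruct (bx y s) as [-> [-> ->]]; rewrite T0, T1, T2; ring.
  - rewrite !IP, !Qe by lia; apply ee. }
(* Two unit vectors with inner product 1 coincide: their squared distance is [1 - 2 + 1]. *)
assert (P0 : forall i, (i < 3)%nat -> P i 0%nat = e i).
{ intros i Hi; apply fun2_ext; intros x t; pose proof (Pe x t) as E; pose proof (ee x t) as E'.
  columns_eq (HSg x t) g 0%nat 0%nat C00; rewrite !gP in C00 by lia.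
  revert i Hi; apply (forall_lt_3 (fun i => P i 0%nat x t = e i x t)).
  assert (D : (P 0%nat 0%nat x t - e 0%nat x t) ^ 2 + (P 1%nat 0%nat x t - e 1%nat x t) ^ 2
    + (P 2%nat 0%nat x t - e 2%nat x t) ^ 2 = 0) by nra.
  pose proof (pow2_ge_0 (P 0%nat 0%nat x t - e 0%nat x t)).
  pose proof (pow2_ge_0 (P 1%nat 0%nat x t - e 1%nat x t)).
  pose proof (pow2_ge_0 (P 2%nat 0%nat x t - e 2%nat x t)).
  assert (Z : forall c d, (c - d) ^ 2 = 0 -> c = d).
  { intros c d Hcd; apply Rminus_diag_uniq; apply Rsqr_0_uniq; unfold Rsqr; lra. }
  repeat split; apply Z; lra. }
pose (k := fun j x t => p 0%nat x t * P 0%nat j x t + p 1%nat x t * P 1%nat j x t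
  + p 2%nat x t * P 2%nat j x t).
exists g, (k 1%nat), (k 2%nat); apply adapted_pframe_iff.
split; [|split; [exact HSg|split]].
{ intros i j Hi Hj; rewrite gP by assumption; now apply SP. }
{ intros i Hi; rewrite gP, P0, Ee by lia; reflexivity. }
(* In the second clause the derivative of [e_j] contributes nothing to that of [k_j = p . e_j],
   because it is tangential and [p] is normal. *)
assert (loc : forall x t,
  (forall i, (i < 3)%nat ->
     p i x t = k 1%nat x t * P i 1%nat x t + k 2%nat x t * P i 2%nat x t) /\
  (forall j, (j = 1 \/ j = 2)%nat -> Dx (k j) x t = q 0%nat x t * P 0%nat j x t
    + q 1%nat x t * P 1%nat j x t + q 2%nat x t * P 2%nat j x t) /\
  (forall j, (j = 1 \/ j = 2)%nat -> e 0%nat x t * P 0%nat j x t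
    + e 1%nat x t * P 1%nat j x t + e 2%nat x t * P 2%nat j x t = 0)).
{ intros x t.
  assert (eP : forall j, (j = 1 \/ j = 2)%nat -> e 0%nat x t * P 0%nat j x t
    + e 1%nat x t * P 1%nat j x t + e 2%nat x t * P 2%nat j x t = 0).
  { intros j Hj; pose proof (proj1 (proj1 (SO3_iff _) (HSg x t)) 0%nat j ltac:(lia) ltac:(lia))
      as C; rewrite !(mx_entry g), !gP, !P0 in C by lia; rewrite C.
    now destruct Hj as [-> | ->]. }
  split; [|split; [|exact eP]].
  - rows_eq (HSg x t) g 0%nat 0%nat R00; rows_eq (HSg x t) g 0%nat 1%nat R01;
      rows_eq (HSg x t) g 0%nat 2%nat R02; rows_eq (HSg x t) g 1%nat 1%nat R11;
      rows_eq (HSg x t) g 1%nat 2%nat R12; rows_eq (HSg x t) g 2%nat 2%nat R22.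
    normalize_entries gP P0 R00; normalize_entries gP P0 R01;
      normalize_entries gP P0 R02; normalize_entries gP P0 R11;
      normalize_entries gP P0 R12; normalize_entries gP P0 R22.
    pose proof (ep x t) as E.
    apply forall_lt_3; unfold k; clear - R00 R01 R02 R11 R12 R22 E; repeat split; nsatz.
  - intros j Hj; unfold k; Dsimpl; fold (q 0%nat) (q 1%nat) (q 2%nat).
    destruct (DP j x t) as [X0 [X1 [X2 _]]]; rewrite X0, X1, X2; simpl.
    generalize (eP j Hj) (ep x t); clear; intros; nsatz. }
intros i Hi x t; rewrite !gP, !P0 by lia.
destruct (loc x t) as [Lp [Lk Le]].
assert (L1 := Lk 1%nat ltac:(lia)); assert (L2 := Lk 2%nat ltac:(lia)).
assert (e1 := Le 1%nat ltac:(lia)); assert (e2 := Le 2%nat ltac:(lia)); clear Lk Le.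
destruct (SO3_cofactors _ (HSg x t)) as [[A0 [A1 A2]] [[B0 [B1 B2]] [C0 [C1 C2]]]].
rewrite !(mx_entry g) in A0, A1, A2, B0, B1, B2, C0, C1, C2.
normalize_entries gP P0 A0; normalize_entries gP P0 A1; normalize_entries gP P0 A2;
  normalize_entries gP P0 B0; normalize_entries gP P0 B1; normalize_entries gP P0 B2;
  normalize_entries gP P0 C0; normalize_entries gP P0 C1; normalize_entries gP P0 C2.
(* With [e = e_1 x e_2], the triple product [e x q] is [(q . e_1) e_2 - (q . e_2) e_1], and
   [q . e_j] is the [x]-derivative of [k_j]. *)
assert (rk : forall i, (i < 3)%nat -> r i x t =
  - (Dx (k 2%nat) x t / 2) * P i 1%nat x t + Dx (k 1%nat) x t / 2 * P i 2%nat x t).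
{ rewrite L1, L2; destruct (rE x t) as [R0 [R1 R2]].
  apply (forall_lt_3 (fun i => r i x t = _)); rewrite R0, R1, R2; repeat split.
  - rewrite B0, C0; field.
  - rewrite A0, C0; field.
  - rewrite A0, B0; field. }
columns_eq (HSg x t) g 1%nat 1%nat D11; columns_eq (HSg x t) g 1%nat 2%nat D12;
  columns_eq (HSg x t) g 2%nat 2%nat D22; normalize_entries gP P0 D11;
  normalize_entries gP P0 D12; normalize_entries gP P0 D22.
assert (KE : (k 1%nat x t ^ 2 + k 2%nat x t ^ 2) / 4 = K x t).
{ unfold K; rewrite (Lp 0%nat), (Lp 1%nat), (Lp 2%nat) by lia.
  generalize (k 1%nat x t) (k 2%nat x t); intros c d; clear - D11 D12 D22.
  apply (f_equal (fun z => z / 4)).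
  transitivity (c ^ 2 * 1 + d ^ 2 * 1 + 2 * c * d * 0); [ring|].
  rewrite <- D11 at 1; rewrite <- D22, <- D12; ring. }
assert (r1 : r 0%nat x t * P 0%nat 1%nat x t + r 1%nat x t * P 1%nat 1%nat x t
  + r 2%nat x t * P 2%nat 1%nat x t = - (Dx (k 2%nat) x t / 2)).
{ rewrite (rk 0%nat), (rk 1%nat), (rk 2%nat) by lia;
  generalize (Dx (k 2%nat) x t / 2) (Dx (k 1%nat) x t / 2).
  clear - D11 D12; intros; nsatz. }
assert (r2 : r 0%nat x t * P 0%nat 2%nat x t + r 1%nat x t * P 1%nat 2%nat x t
  + r 2%nat x t * P 2%nat 2%nat x t = Dx (k 1%nat) x t / 2).
{ rewrite (rk 0%nat), (rk 1%nat), (rk 2%nat) by lia;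
  generalize (Dx (k 2%nat) x t / 2) (Dx (k 1%nat) x t / 2).
  clear - D22 D12; intros; nsatz. }
rewrite KE; split; [now apply Lp|].
destruct (DP 1%nat x t) as [X10 [X11 [X12 [T10 [T11 T12]]]]].
destruct (DP 2%nat x t) as [X20 [X21 [X22 [T20 [T21 T22]]]]].
assert (D2 : Dx (k 2%nat) x t / 2 = - (r 0%nat x t * P 0%nat 1%nat x t
  + r 1%nat x t * P 1%nat 1%nat x t + r 2%nat x t * P 2%nat 1%nat x t)) by lra.
split; [|split; [|split; [|split]]].
3: now apply rk.
all: revert i Hi.
- apply (forall_lt_3 (fun i => Dx (P i 1%nat) x t = - k 1%nat x t * e i x t)).
  rewrite X10, X11, X12; unfold k; simpl; clear - e1; repeat split; nsatz.
- apply (forall_lt_3 (fun i => Dx (P i 2%nat) x t = - k 2%nat x t * e i x t)).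
  rewrite X20, X21, X22; unfold k; simpl; clear - e2; repeat split; nsatz.
(* As [e . e_1 = 0], one has [b x e_1 = - (r . e_1) e - K (e x e_1)]. Writing [e_2] as [e x e_1]
   leaves an identity in [e] and [e_1]; the last case uses [e_1 = e_2 x e] in the same way. *)
- apply (forall_lt_3 (fun i => Dt (P i 1%nat) x t
    = Dx (k 2%nat) x t / 2 * e i x t - K x t * P i 2%nat x t)).
  rewrite T10, T11, T12, D2, A2, B2, C2; simpl; clear - e1; generalize (K x t); intros.
  repeat split; nsatz.
- apply (forall_lt_3 (fun i => Dt (P i 2%nat) x t
    = - (Dx (k 1%nat) x t / 2) * e i x t + K x t * P i 1%nat x t)).
  rewrite T20, T21, T22, <- r2, A1, B1, C1; simpl; clear - e2; generalize (K x t); intros.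
  repeat split; nsatz.
Qed.

(** * From a solution of the NLS to a curve *)

Lemma nls_pframe_exists (k1 k2 : R -> R -> R) : smooth k1 -> smooth k2 ->
  is_nls (hasimoto k1 k2) -> exists gamma g, adapted_pframe gamma g k1 k2.
Proof.
intros S1 S2 Hq.
pose proof (proj1 (is_nls_hasimoto_iff k1 k2 S1 S2) Hq) as E.
(* the rows of [g] are transported with the angular velocities [a] and [b] *)
pose (a := fun i => match i with
  | 0%nat => fun _ _ : R => 0
  | 1%nat => k2
  | _ => fun x t => - k1 x t end).
pose (b := fun i => match i with
  | 0%nat => fun x t => (k1 x t * k1 x t + k2 x t * k2 x t) / 4
  | 1%nat => fun x t => Dx k1 x t / 2
  | _ => fun x t => Dx k2 x t / 2 end).
destruct (moving_frame a b mat3_one) as [P [SP [HO [_ DP]]]].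
{ intros [|[|i]]; simpl; auto with smooth. }
{ intros [|[|i]]; simpl; auto 10 with smooth. }
{ exact SO3_one. }
{ intros x t; destruct (E x t) as [E1 E2]; unfold a, b; Dsimpl; rewrite E1, E2.
  repeat split; field. }
unfold a, b in DP.
(* The curve must have [gamma_x = e_0] and [gamma_t = (k1 e_2 - k2 e_1) / 2], the value of half of
   [gamma_x x gamma_xx] in the frame. The frame equations make this pair closed, one coordinate at a
   time. *)
assert (pot : forall i, exists f, smooth f /\ forall x t, Dx f x t = P 0%nat i x t /\
  Dt f x t = (k1 x t * P 2%nat i x t - k2 x t * P 1%nat i x t) / 2).
{ intros i.
  assert (P0 : smooth (P 0%nat i)) by (apply SP; lia).
  assert (P1 : smooth (P 1%nat i)) by (apply SP; lia).
  assert (P2 : smooth (P 2%nat i)) by (apply SP; lia).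
  apply (potential (P 0%nat i)
    (fun x t => (k1 x t * P 2%nat i x t - k2 x t * P 1%nat i x t) / 2));
    auto with smooth.
  intros x t; destruct (DP i x t) as [X0 [X1 [X2 [T0 [T1 T2]]]]].
  Dsimpl; rewrite T0, X1, X2; field. }
apply choice_function in pot; destruct pot as [G HG].
pose (c := fun x t => mk_matrix 3 1 (fun i _ => G i x t) : vec3).
assert (cE : forall i, (i < 3)%nat -> entry c i 0 = G i).
{ intros i Hi; exact (entry_mk_matrix (fun i _ => G i) i 0 Hi Nat.lt_0_1). }
assert (GX : forall i, Dx (G i) = P 0%nat i).
{ intros i; apply fun2_ext; intros; apply HG. }
set (p := fun x t => mk_matrix 3 3 (fun i j => P i j x t) : mat3).
assert (pE : forall i j, (i < 3)%nat -> (j < 3)%nat -> entry p i j = P i j).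
{ intros i j Hi Hj; exact (entry_mk_matrix P i j Hi Hj). }
assert (Hp : forall x t, SO3 (p x t)) by exact HO.
assert (Hc : is_vfe c).
{ apply is_vfe_iff; rewrite !cE, !GX by lia; split; [|split].
  - intros i Hi; rewrite cE by assumption; apply HG.
  - intros x t; rows_eq (Hp x t) p 0%nat 0%nat R00.
    rewrite (pE 0%nat 0%nat), (pE 0%nat 1%nat), (pE 0%nat 2%nat) in R00 by lia; exact R00.
  - intros x t.
    destruct (SO3_cofactors _ (Hp x t)) as [_ [[B0 [B1 B2]] [C0 [C1 C2]]]].
    change (mx (p x t)) with (fun i j => entry p i j x t) in *; cbv beta in *.
    repeat rewrite pE in B0 by lia; repeat rewrite pE in B1 by lia.
    repeat rewrite pE in B2 by lia; repeat rewrite pE in C0 by lia.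
    repeat rewrite pE in C1 by lia; repeat rewrite pE in C2 by lia.
    destruct (DP 0%nat x t) as [X0 _]; destruct (DP 1%nat x t) as [X1 _];
      destruct (DP 2%nat x t) as [X2 _].
    rewrite (proj2 (proj2 (HG 0%nat) x t)), (proj2 (proj2 (HG 1%nat) x t)),
      (proj2 (proj2 (HG 2%nat) x t)), X0, X1, X2; repeat split.
    + rewrite B0, C0; field.
    + rewrite B1, C1; field.
    + rewrite B2, C2; field. }
(* The columns transported by [moving_frame] are the rows of the frame, hence the transpose. *)
pose (g := fun x t => mk_matrix 3 3 (fun i j => P j i x t) : mat3).
assert (gE : forall i j, (i < 3)%nat -> (j < 3)%nat -> entry g i j = P j i).
{ intros i j Hi Hj; exact (entry_mk_matrix (fun i j => P j i) i j Hi Hj). }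
exists (Curve c Hc), g; apply adapted_pframe_iff; split; [|split; [|split]].
- intros i j Hi Hj; rewrite gE by assumption; now apply SP.
- intros x t; replace (g x t) with (transp (p x t)); [apply SO3_transp, Hp|].
  apply mat3_eq; intros i j Hi Hj; rewrite mx_transp by assumption.
  change (entry p j i x t = entry g i j x t); now rewrite pE, gE.
- intros i Hi; simpl; rewrite gE, cE, GX by lia; reflexivity.
- intros i Hi x t; rewrite !gE by lia.
  destruct (DP i x t) as [-> [-> [-> [-> [-> ->]]]]]; repeat split; field.
Qed.

(** * Orbits *)

Lemma nls_ext (q r : nls) : (forall x t, q x t = r x t) -> q = r.
Proof.
destruct q as [q Hq], r as [r Hr]; simpl; intros H.
assert (E : q = r) by (do 2 (apply functional_extensionality; intro); apply H).
subst r; f_equal; apply proof_irrelevance.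
Qed.

Lemma nls_eq_hasimoto (q : nls) : exists k1 k2 (Hq : is_nls (hasimoto k1 k2)),
  smooth k1 /\ smooth k2 /\ q = Nls (hasimoto k1 k2) Hq.
Proof.
pose (k1 := fun x t => 2 * Re (q x t)); pose (k2 := fun x t => 2 * Im (q x t)).
destruct (nlsP q) as [[SR SI] _].
assert (E : hasimoto k1 k2 = q).
{ rewrite hasimotoE; do 2 (apply functional_extensionality; intro).
  rewrite (surjective_pairing (q x x0)); unfold k1, k2, Re, Im.
  apply f_equal2; field. }
assert (Hq : is_nls (hasimoto k1 k2)) by (rewrite E; apply nlsP).
exists k1, k2, Hq; split; [|split].
- apply smooth_mult; trivial; apply smooth_const.
- apply smooth_mult; trivial; apply smooth_const.
- apply nls_ext; intros; simpl; now rewrite E.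
Qed.

(** Turning the normal frame by an angle multiplies the complex curvature by the opposite phase,
    whence the conjugate [(a, - b)]. *)
Lemma hasimoto_rotate (k1 k2 : R -> R -> R) (a b : R) :
  hasimoto (fun x t => a * k1 x t + b * k2 x t) (fun x t => a * k2 x t - b * k1 x t) =
  fun x t => ((a, - b)%R * hasimoto k1 k2 x t)%C.
Proof.
rewrite !hasimotoE; do 2 (apply functional_extensionality; intro).
unfold Cmult; simpl; apply f_equal2; field.
Qed.

Lemma hasimoto_inj (k1 k2 l1 l2 : R -> R -> R) :
  hasimoto k1 k2 = hasimoto l1 l2 -> k1 = l1 /\ k2 = l2.
Proof.
rewrite !hasimotoE; intros H; split; apply fun2_ext; intros x t;
  pose proof (f_equal (fun f => f x t) H) as E; cbv beta in E;
  injection E; intros; lra.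
Qed.

Lemma Cmod_1_iff (a b : R) : Cmod (a, b) = 1 <-> a * a + b * b = 1.
Proof.
unfold Cmod; simpl; rewrite !Rmult_1_r; split; intros H.
- rewrite <- sqrt_1 in H; apply sqrt_inj in H; nra.
- rewrite H; apply sqrt_1.
Qed.

Section Orbits.
Context {G X : Type} (act : G -> X -> X).
Hypotheses (act_mul : forall a b, exists c, forall x, act a (act b x) = act c x)
  (act_inv : forall a, exists b, forall x, act b (act a x) = x)
  (act_one : exists e, forall x, act e x = x).

(** The group laws enter only as existence of acting elements, so no group operation has to be
    defined on [rigid] or [unit_circle]. *)
Lemma orbit_class_eq_iff (x y : X) :
  orbit_class act x = orbit_class act y <-> exists a, y = act a x.
Proof.
split.
- intros H; apply (f_equal (@proj1_sig _ _)) in H; simpl in H.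
  change (orbit act x y); rewrite H.
  destruct act_one as [e He]; exists e; now rewrite He.
- intros [a ->].
  assert (E : orbit act x = orbit act (act a x)).
  { apply functional_extensionality; intros z; apply propositional_extensionality.
    destruct (act_inv a) as [b Hb]; split; intros [c ->].
    - destruct (act_mul c b) as [d Hd]; exists d; now rewrite <- Hd, Hb.
    - destruct (act_mul c a) as [d Hd]; exists d; now rewrite <- Hd. }
  unfold orbit_class; apply eq_sig_hprop; [intros; apply proof_irrelevance | exact E].
Qed.

Lemma orbit_class_surj (O : orbit_space act) : exists x, O = orbit_class act x.
Proof.
destruct O as [O [x E]]; exists x; apply eq_sig_hprop;
  [intros; apply proof_irrelevance | exact E].
Qed.

End Orbits.

Lemma circle_class_eq_iff (q r : nls) :
  orbit_class circle_act q = orbit_class circle_act r <-> exists c, r = circle_act c q.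
Proof.
apply orbit_class_eq_iff.
- intros [a Ha] [b Hb].
  assert (Hab : Cmod (a * b)%C = 1) by (rewrite Cmod_mult, Ha, Hb; ring).
  exists (UnitCircle _ Hab); intros p; apply nls_ext; intros; simpl; ring.
- intros [[a b] Ha].
  assert (Hb : Cmod (a, - b) = 1).
  { apply Cmod_1_iff; apply Cmod_1_iff in Ha; lra. }
  exists (UnitCircle _ Hb); intros p; apply nls_ext; intros x t; simpl.
  apply Cmod_1_iff in Ha.
  rewrite Cmult_assoc; replace (Cmult (a, - b) (a, b)) with (RtoC 1); [ring|].
  unfold Cmult, RtoC; simpl; apply f_equal2; lra.
- exists (UnitCircle 1 Cmod_1); intros p; apply nls_ext; intros; simpl; ring.
Qed.

Lemma rigid_class_eq_iff (gamma delta : curve) :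
  orbit_class rigid_act gamma = orbit_class rigid_act delta <->
  exists M, delta = rigid_act M gamma.
Proof.
apply orbit_class_eq_iff.
- intros [A HA u] [B HB v].
  exists (Rigid _ (SO3_mul A B HA HB) (mk_matrix 3 1 (fun i _ =>
    mx A i 0 * vx v 0 + mx A i 1 * vx v 1 + mx A i 2 * vx v 2 + vx u i))).
  intros c; apply curve_ext; intros i x t Hi; simpl.
  rewrite (entry_rigid _ (fun x t => rigid_map _ (c x t))), !entry_rigid by lia; simpl.
  rewrite !mx_mul by lia; unfold vx at 5; rewrite coeff_mat_bij by lia; ring.
- intros [A HA u].
  exists (Rigid _ (SO3_transp A HA) (mk_matrix 3 1 (fun i _ =>
    - (mx A 0 i * vx u 0 + mx A 1 i * vx u 1 + mx A 2 i * vx u 2)))).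
  intros c; apply curve_ext; intros i x t Hi; simpl.
  rewrite (entry_rigid _ (fun x t => rigid_map _ (c x t))), !entry_rigid by lia; simpl.
  rewrite !mx_transp by lia; unfold vx at 4; rewrite coeff_mat_bij by lia.
  pose proof (proj1 (proj1 (SO3_iff A) HA)) as C.
  pose proof (C i 0%nat Hi ltac:(lia)) as C0; pose proof (C i 1%nat Hi ltac:(lia)) as C1;
    pose proof (C i 2%nat Hi ltac:(lia)) as C2.
  transitivity ((if Nat.eqb i 0 then 1 else 0) * entry c 0 0 x t
    + (if Nat.eqb i 1 then 1 else 0) * entry c 1 0 x t
    + (if Nat.eqb i 2 then 1 else 0) * entry c 2 0 x t).
  + rewrite <- C0, <- C1, <- C2; ring.
  + destruct i as [|[|[|i]]]; simpl; try ring; lia.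
- exists (Rigid _ SO3_one (mk_matrix 3 1 (fun _ _ => 0))).
  intros c; apply curve_ext; intros i x t Hi; simpl.
  rewrite entry_rigid by lia; simpl.
  rewrite !mx_one by lia; unfold vx; rewrite coeff_mat_bij by lia.
  destruct i as [|[|[|i]]]; simpl; try ring; lia.
Qed.

(** Read from left to right this is well-definedness of the map on orbits, for any representatives
    and any frames; from right to left it is injectivity. *)
Lemma pframe_class_iff (gamma delta : curve) (g h : R -> R -> mat3)
    (k1 k2 l1 l2 : R -> R -> R)
    (Hk : is_nls (hasimoto k1 k2)) (Hl : is_nls (hasimoto l1 l2)) :
  adapted_pframe gamma g k1 k2 -> adapted_pframe delta h l1 l2 ->
  orbit_class rigid_act gamma = orbit_class rigid_act delta <->
  orbit_class circle_act (Nls _ Hk) = orbit_class circle_act (Nls _ Hl).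
Proof.
intros H H'; rewrite rigid_class_eq_iff, circle_class_eq_iff; split.
- intros [M ->].
  destruct (pframe_unique _ _ _ _ _ _ _ (pframe_rigid M _ _ _ _ H) H')
    as [a [b [Hab [-> ->]]]].
  assert (Hc : Cmod (a, - b) = 1) by (apply Cmod_1_iff; lra).
  exists (UnitCircle _ Hc); apply nls_ext; intros x t; simpl.
  now rewrite hasimoto_rotate.
- intros [[[a b] Hc] E].
  apply Cmod_1_iff in Hc as Hab.
  (* The unit [a + i b] corresponds to the normal rotation with parameters [a] and [- b]; after it
     the two curves have equal curvatures. *)
  assert (El : hasimoto l1 l2 = hasimoto (fun x t => a * k1 x t + (- b) * k2 x t)
    (fun x t => a * k2 x t - (- b) * k1 x t)).
  { rewrite hasimoto_rotate, Ropp_involutive.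
    exact (f_equal nls_map E). }
  apply hasimoto_inj in El; destruct El as [-> ->].
  destruct (pframe_rotate _ _ _ _ a (- b) H) as [g' Hg']; [lra|].
  exact (pframe_congruent _ _ _ _ _ _ Hg' H').
Qed.

Theorem theorem4p10 :
  (forall gamma : curve, exists (g : R -> R -> mat3) (k1 k2 : R -> R -> R),
     adapted_pframe gamma g k1 k2) /\
  (forall (gamma : curve) (g : R -> R -> mat3) (k1 k2 : R -> R -> R),
     adapted_pframe gamma g k1 k2 -> is_nls (hasimoto k1 k2)) /\
  (exists Psi : orbit_space rigid_act -> orbit_space circle_act,
     unique
       (fun Phi : orbit_space rigid_act -> orbit_space circle_act =>
          forall (gamma : curve) (g : R -> R -> mat3) (k1 k2 : R -> R -> R)
                 (Hq : is_nls (hasimoto k1 k2)),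
            adapted_pframe gamma g k1 k2 ->
            Phi (orbit_class rigid_act gamma) =
            orbit_class circle_act (Nls (hasimoto k1 k2) Hq))
       Psi /\
     Injective Psi /\ Surjective Psi).
Proof.
split; [exact pframe_exists|]; split; [exact pframe_nls|].
assert (rep : forall O : orbit_space rigid_act, exists gamma g k1 k2
  (Hq : is_nls (hasimoto k1 k2)),
  O = orbit_class rigid_act gamma /\ adapted_pframe gamma g k1 k2).
{ intros O; destruct (orbit_class_surj _ O) as [gamma ->].
  destruct (pframe_exists gamma) as [g [k1 [k2 H]]].
  exists gamma, g, k1, k2, (pframe_nls _ _ _ _ H); now split. }
(* The chosen relation quantifies over all representatives and all frames of an orbit, so [Psi]
   meets its specification directly. That some value satisfies it is the forward direction of
   [pframe_class_iff]. *)
destruct (choice_function (fun (O : orbit_space rigid_act) (O' : orbit_space circle_act) =>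
  forall gamma g k1 k2 (Hq : is_nls (hasimoto k1 k2)), O = orbit_class rigid_act gamma ->
  adapted_pframe gamma g k1 k2 -> O' = orbit_class circle_act (Nls _ Hq))) as [Psi HPsi].
{ intros O; destruct (rep O) as [gamma [g [k1 [k2 [Hq [-> H]]]]]].
  exists (orbit_class circle_act (Nls _ Hq)); intros delta h l1 l2 Hl E H'.
  now apply (pframe_class_iff gamma delta g h). }
exists Psi; split; [split|split].
- intros gamma g k1 k2 Hq H; now apply (HPsi _ gamma g).
- intros Phi HPhi; apply functional_extensionality; intros O.
  destruct (rep O) as [gamma [g [k1 [k2 [Hq [-> H]]]]]].
  rewrite (HPhi gamma g k1 k2 Hq H); now apply (HPsi _ gamma g).
- intros O O' E.
  destruct (rep O) as [gamma [g [k1 [k2 [Hk [-> H]]]]]].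
  destruct (rep O') as [delta [h [l1 [l2 [Hl [-> H']]]]]].
  rewrite (HPsi _ gamma g k1 k2 Hk eq_refl H), (HPsi _ delta h l1 l2 Hl eq_refl H') in E.
  now apply (pframe_class_iff gamma delta g h k1 k2 l1 l2 Hk Hl).
- intros O'; destruct (orbit_class_surj _ O') as [q ->].
  destruct (nls_eq_hasimoto q) as [k1 [k2 [Hq [S1 [S2 ->]]]]].
  destruct (nls_pframe_exists k1 k2 S1 S2 Hq) as [gamma [g H]].
  exists (orbit_class rigid_act gamma); now apply (HPsi _ gamma g).
Qed.
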